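(* Let $\lambda\in(1,R]$ and $i\in\mathcal I$. Then $\mathbb P[\Lambda\cap\Omega_i\neq\emptyset]\in\{0,1\}$, and $\mathbb P[\Lambda\cap\Omega_i\neq\emptyset]=1$ if and only if $\xi_i(\lambda)>1$. More precisely, almost surely: (1) If $\xi_i(\lambda)\le 1$, then $\emptyset\subsetneq\Lambda\subseteq\Omega_\infty$. (2) If $\xi_i(\lambda)>1$, then $\emptyset\subsetneq\Omega_\infty\cap\Lambda\subset\Lambda$ with $\Lambda\cap\Omega_i\neq\emptyset$ and $|\Lambda\cap\Omega_i|=\infty$.
   Context: Groups. Let $r\ge 2$, $\mathcal I=\{1,\dots,r\}$, and let $\Gamma_1,\dots,\Gamma_r$ be non-trivial finitely generated groups with identities $e_i$; the case $r=2=|\Gamma_1|=|\Gamma_2|$ is excluded. Put $\Gamma_i^\times=\Gamma_i\setminus\{e_i\}$. The free product $\Gamma=\Gamma_1\ast\dots\ast\Gamma_r$ is the set of words $x_1\dots x_n$ ($n\ge 1$, $x_j\in\bigcup_i\Gamma_i^\times$, consecutive letters not from the same $\Gamma_i$) together with the empty word $e$; each $\Gamma_i$ is regarded as a subset of $\Gamma$, with $e_i$ identified with $e$. Random walk. For each $i$, $\mu_i$ is a symmetric, finitely supported probability measure on $\Gamma_i$ with $\langle\mathrm{supp}(\mu_i)\rangle=\Gamma_i$ and $\mu_i(e_i)=0$; $\bar\mu_i$ is its extension to $\Gamma$ by $0$; $\alpha_i>0$ with $\sum_i\alpha_i=1$; $\mu=\sum_i\alpha_i\bar\mu_i$. $(X_n)$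 is the random walk on $\Gamma$ with transition probabilities $p(x,y)=\mu(x^{-1}y)$, $X_0=e$. $\mathcal X$ is the Cayley graph of $\Gamma$ with respect to $\mathrm{supp}(\mu)$ and $\mathcal X_i$ the Cayley graph of $\Gamma_i$ with respect to $\mathrm{supp}(\mu_i)$. $R$ is the radius of convergence of $G(e,e|z)=\sum_{n\ge0}\mu^{(n)}(e)z^n$, where $\mu^{(n)}$ is the $n$-th convolution power of $\mu$ (one has $R>1$). Define $$\xi_i(z)=\sum_{n\ge1}\mathbb P\bigl[X_n\in\Gamma_i^\times,\ X_m\notin\Gamma_i^\times\ \forall\,1\le m\le n-1\mid X_0=e\bigr]z^n .$$ Branching random walk (BRW). Let $\nu$ be a probability measure on $\{0,1,2,\dots\}$ with $\nu(0)=0$, $\nu(1)<1$, finite second moment and mean $\lambda$. The BRW starts with one particle at $e$; at each time step each particle, independently of everything else, dies and produces a $\nu$-distributed number of offspring, and each offspring independently moves one step according to $\mu$ (from $x$ to $xs$ with probability $\mu(s)$). Ends. A ray in an infinite locally finite graph is a semi-infinite path without repeated vertices; two rays are equivalent if some third ray shares infinitely many vertices with each of them; ends are the equivalence classes. $\Omega$ is the set of ends of $\mathcal X$. $\Omega_i^{(0)}$ is the set of ends of $\mathcal X_i$ (regarded as ends of $\mathcal X$ via $\mathcal X_i\subseteq\mathcal X$), $\Omega_i=\{x\omega: x\in\Gamma,\ \omega\in\Omega_i^{(0)}\}$, where $x\omega$ is the translate of the end by $x$, and $\Omega_\infty$ is the set of infinite words $x_1x_2\dots$ with $x_j\in\bigcup_i\Gamma_i^\times$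 and consecutive letters not from the same $\Gamma_i$, each such word being identified with the end it describes. Then $\Omega$ is the disjoint union of $\Omega_\infty,\Omega_1,\dots,\Omega_r$. For a finite vertex set $F$, the $\omega$-component of $\mathcal X\setminus F$ is the connected component that contains all but finitely many vertices of every ray in $\omega$. The BRW accumulates at $\omega\in\Omega$ if for every finite $F\subseteq\mathcal X$ at least one particle visits the $\omega$-component of $\mathcal X\setminus F$; $\Lambda$ is the random set of ends at which the BRW accumulates.
   Formalization: Clause (1) fails for a single i if another ξ_j(λ)>1, as Λ then meets Ω_j. It is replaced by: if ξ_i(λ)≤1, then a.s. Λ≠∅ and Λ∩Ω_i=∅; if ξ_j(λ)≤1 for all j, then a.s. ∅≠Λ⊆Ω_∞. *)

(* Defs.v *)
From HB Require Import structures.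
From mathcomp Require Import all_boot all_order all_algebra.
From mathcomp Require Import all_classical all_reals all_analysis.

Set Implicit Arguments.
Unset Strict Implicit.
Unset Printing Implicit Defensive.

Import Order.TTheory GRing.Theory Num.Theory.
Import numFieldNormedType.Exports.

Local Open Scope classical_set_scope.
Local Open Scope ring_scope.

Section FreeProduct.
Variables (I : choiceType) (G : I -> groupType).

Definition letter := {i : I & G i}.

Definition reduced (w : seq letter) : bool :=
  all (fun l : letter => tagged l != 1%g) w &&
  sorted (fun l l' : letter => tag l != tag l') w.

Definition freeprod := {w : seq letter | reduced w}.

HB.instance Definition _ := Choice.on freeprod.

Implicit Types (u v : letter) (w : seq letter).

(* Left multiplication of a word by a letter; a trivial letter acts as the
   identity, and [tagged_as u v] is the group element of [v] read in the group
   of [u] when the two groups coincide. *)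
Definition mul_letter u w : seq letter :=
  if tagged u == 1%g then w else
  if w is v :: w' then
    if tag v == tag u then
      let h := (tagged u * tagged_as u v)%g in
      if h == 1%g then w' else Tagged G h :: w'
    else u :: w
  else [:: u].

Lemma reduced_cons u w : reduced (u :: w) =
  [&& tagged u != 1%g, (if w is v :: _ then tag u != tag v else true)
    & reduced w].
Proof.
rewrite /reduced /=; case: w => [|v w] /=; first by rewrite !andbT.
by case: (_ == 1%g); case: (tag u == tag v); case: (_ == 1%g);
   rewrite ?andbF ?andbT.
Qed.

Lemma reduced_mul_letter u w : reduced w -> reduced (mul_letter u w).
Proof.
rewrite /mul_letter; case: eqVneq => // u1; case: w => [|v w] rw.
  by rewrite reduced_cons u1.
case: eqVneq => [e|ne]; last by rewrite reduced_cons u1 eq_sym ne.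
move: rw; rewrite !reduced_cons => /and3P[_ h rw].
case: ifP => h1 //; rewrite reduced_cons h1 /= rw andbT.
by case: w h {rw} => //= a w; rewrite e.
Qed.

Lemma mul_letterM i (g h : G i) w : reduced w ->
  mul_letter (Tagged G (g * h)%g) w =
  mul_letter (Tagged G g) (mul_letter (Tagged G h) w).
Proof.
have [->|h1] := eqVneq h 1%g; first by rewrite mulg1 /mul_letter /= eqxx.
have [->|g1] := eqVneq g 1%g; first by rewrite mul1g /mul_letter /= eqxx.
case: w => [|[j k] w] rw.
  by rewrite /mul_letter /= (negPf g1) (negPf h1) /= eqxx tagged_asE.
case: (eqVneq j i) => [eji|ji]; last first.
  rewrite /mul_letter /= (negPf g1) (negPf h1) (negPf ji) /= eqxx.
  by rewrite tagged_asE.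
subst j; move: rw; rewrite reduced_cons => /and3P[/= k1 hw rw].
have nt : forall l : G i, l != 1%g ->
    mul_letter (Tagged G l) w = Tagged G l :: w.
  move=> l l1; rewrite /mul_letter /= (negPf l1).
  by case: w hw {rw} => //= a w; rewrite eq_sym => /negPf ->.
rewrite {1}/mul_letter /= eqxx tagged_asE.
have -> : mul_letter (Tagged G h) (Tagged G k :: w) =
    if (h * k)%g == 1%g then w else Tagged G (h * k)%g :: w.
  by rewrite /mul_letter /= (negPf h1) eqxx tagged_asE.
have [hk|hk] := eqVneq (h * k)%g 1%g.
  rewrite nt // -mulgA hk mulg1 (negPf g1).
  case: eqVneq => // gh; congr (Tagged G _ :: w).
  by rewrite -[k]mul1g -gh -mulgA hk mulg1.
rewrite {1}/mul_letter /= (negPf g1) eqxx tagged_asE -mulgA.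
case: eqVneq => // gh.
by rewrite mulgA gh mul1g (negPf k1).
Qed.

Definition mul_word w1 w2 := foldr mul_letter w2 w1.

Lemma reduced_mul_word w1 w2 : reduced w2 -> reduced (mul_word w1 w2).
Proof. by move=> r2; elim: w1 => //= u w1; exact: reduced_mul_letter. Qed.

Definition inv_word w : seq letter :=
  rev [seq Tagged G (tagged u)^-1%g | u <- w].

Lemma reduced_inv_word w : reduced w -> reduced (inv_word w).
Proof.
rewrite /reduced /inv_word all_rev rev_sorted => /andP[w1 sw].
apply/andP; split.
  by rewrite all_map; apply: sub_all w1 => u /=; rewrite invg_eq1.
rewrite sorted_map.
by move: sw; apply: sub_sorted => u v /=; rewrite eq_sym.
Qed.

Lemma mul_letter_word u w1 w2 : reduced w1 -> reduced w2 ->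
  mul_word (mul_letter u w1) w2 = mul_letter u (mul_word w1 w2).
Proof.
move=> r1 r2; rewrite {1}/mul_letter.
case: eqVneq => [u1|u1]; first by rewrite /mul_letter u1 eqxx.
case: w1 r1 => [//|v w1] r1; case: eqVneq => [e|//].
case: u v e u1 r1 => i g [j k] /= e g1 r1; subst j.
rewrite tagged_asE [RHS]/= -mul_letterM; last exact: reduced_mul_word.
by case: eqVneq => [->|//]; rewrite /mul_letter /= eqxx.
Qed.

Lemma mul_wordA w1 w2 w3 : reduced w1 -> reduced w2 -> reduced w3 ->
  mul_word w1 (mul_word w2 w3) = mul_word (mul_word w1 w2) w3.
Proof.
move=> r1 r2 r3; elim: w1 r1 => //= u w1 IH.
rewrite reduced_cons => /and3P[_ _ r1].
by rewrite mul_letter_word ?IH //; apply: reduced_mul_word.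
Qed.

Lemma mul_word1 w : reduced w -> mul_word w [::] = w.
Proof.
elim: w => //= u w IH; rewrite reduced_cons => /and3P[u1 h rw].
rewrite IH // /mul_letter (negPf u1).
by case: w h {IH rw} => //= v w; rewrite eq_sym => /negPf ->.
Qed.

Lemma mul_wordV w : reduced w -> mul_word (inv_word w) w = [::].
Proof.
elim: w => //= u w IH; rewrite reduced_cons => /and3P[u1 h rw].
rewrite /mul_word /inv_word /= rev_cons foldr_rcons.
have -> : mul_letter (Tagged G (tagged u)^-1%g) (u :: w) = w.
  case: u u1 {h} => i g /= g1.
  by rewrite /mul_letter /= invg_eq1 (negPf g1) eqxx tagged_asE mulVg eqxx.
exact: IH.
Qed.

Lemma inv_wordK : involutive inv_word.
Proof.
move=> w; rewrite /inv_word map_rev revK -map_comp -[RHS]map_id.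
by apply: eq_map => -[i g] /=; rewrite invgK.
Qed.

Lemma reduced_nil : reduced [::]. Proof. by []. Qed.

Definition fp_one : freeprod := exist reduced [::] reduced_nil.
Definition fp_mul (x y : freeprod) : freeprod :=
  exist _ (mul_word (val x) (val y)) (reduced_mul_word (val x) (valP y)).
Definition fp_inv (x : freeprod) : freeprod :=
  exist _ (inv_word (val x)) (reduced_inv_word (valP x)).

Lemma fp_mulA : associative fp_mul.
Proof. by move=> x y z; apply: val_inj; apply: mul_wordA; exact: valP. Qed.

Lemma fp_mul1g : left_id fp_one fp_mul.
Proof. by move=> x; apply: val_inj. Qed.

Lemma fp_mulg1 : right_id fp_one fp_mul.
Proof. by move=> x; apply: val_inj; apply: mul_word1; exact: valP. Qed.

Lemma fp_mulVg : left_inverse fp_one fp_inv fp_mul.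
Proof. by move=> x; apply: val_inj; apply: mul_wordV; exact: valP. Qed.

Lemma fp_mulgV : right_inverse fp_one fp_inv fp_mul.
Proof.
move=> x; apply: val_inj => /=; rewrite -{1}[val x]inv_wordK.
by apply: mul_wordV; apply: reduced_inv_word; exact: valP.
Qed.

HB.instance Definition _ := isGroup.Build freeprod
  fp_mulA fp_mul1g fp_mulg1 fp_mulVg fp_mulgV.

Lemma reduced_emb i (x : G i) :
  reduced (if x == 1%g then [::] else [:: Tagged G x]).
Proof. by case: eqVneq => // x1; rewrite reduced_cons x1. Qed.

Definition emb i (x : G i) : freeprod :=
  exist reduced _ (reduced_emb x).

Definition factor_nontrivial i : set freeprod :=
  [set emb x | x in [set x : G i | x <> 1%g]].

End FreeProduct.

Arguments emb {I G} i x.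

Definition is_subgroup (H : groupType) (K : set H) :=
  [/\ K 1%g, forall x y, K x -> K y -> K (x * y)%g
    & forall x, K x -> K x^-1%g].

Definition generates (H : groupType) (S : set H) :=
  forall K : set H, is_subgroup K -> S `<=` K -> K = setT.

Definition finitely_generated (H : groupType) :=
  exists2 S : set H, finite_set S & generates S.

Section Laws.
Variables (R : realType).

Definition supp (T : Type) (m : T -> R) : set T := [set x | m x != 0].

Definition finite_pmf (T : choiceType) (m : T -> R) :=
  [/\ forall x, 0 <= m x, finite_set (supp m)
    & \sum_(x \in [set: T]) m x = 1].

Definition step_law (H : groupType) (m : H -> R) :=
  [/\ finite_pmf m, forall x, m x^-1%g = m x, generates (supp m)
    & m 1%g = 0].

Fixpoint conv_pow (H : groupType) (m : H -> R) (n : nat) : H -> R :=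
  if n is n'.+1
  then fun x => \sum_(y \in [set: H]) conv_pow m n' y * m (y^-1 * x)%g
  else fun x => (x == 1%g)%:R.

Definition radius_of_convergence (a : nat -> R) : \bar R :=
  ereal_sup [set z%:E | z in [set z : R |
    0 <= z /\ cvgn (series (fun n => a n * z ^+ n))]].

(* As [emb i] is injective, the inner sum is the extension by 0 of [mu_ i]. *)
Definition fp_law (r : nat) (G : 'I_r -> groupType) (alpha : 'I_r -> R)
    (mu_ : forall i, G i -> R) : freeprod G -> R :=
  fun w => \sum_(i < r)
    alpha i * \sum_(x \in emb i @^-1` [set w]) mu_ i x.

End Laws.

Section Graph.
Variables (V : Type) (E : V -> V -> Prop).

Definition ray (rho : nat -> V) :=
  injective rho /\ forall n, E (rho n) (rho n.+1).

Definition ray_equiv (rho rho' : nat -> V) :=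
  exists sigma, [/\ ray sigma, infinite_set (range sigma `&` range rho)
    & infinite_set (range sigma `&` range rho')].

(* An end is an equivalence class of rays, i.e. a set of rays. *)
Definition ends : set (set (nat -> V)) :=
  [set [set rho' | ray rho' /\ ray_equiv rho rho'] | rho in ray].

Definition connected_off (F : set V) (u v : V) :=
  exists (n : nat) (p : nat -> V),
    [/\ p 0%N = u, p n = v, forall k, (k <= n)%N -> ~ F (p k)
      & forall k, (k < n)%N -> E (p k) (p k.+1)].

Definition component (F : set V) (v : V) : set V := [set u | connected_off F v u].

Definition end_component (F : set V) (omega : set (nat -> V)) : set V :=
  [set v | ~ F v /\
    forall rho, omega rho -> finite_set (range rho `\` component F v)].

Definition limit_ends (A : set V) : set (set (nat -> V)) :=
  [set omega | ends omega /\
    forall F, finite_set F -> A `&` end_component F omega !=set0].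

End Graph.

Definition cayley (H : groupType) (S : set H) (x y : H) := S (x^-1 * y)%g.

Section FreeProductEnds.
Variables (R : realType) (r : nat) (G : 'I_r -> groupType).
Variables (alpha : 'I_r -> R) (mu_ : forall i, G i -> R).

Definition fp_graph := cayley (supp (fp_law alpha mu_)).

Definition ends_factor0 (i : 'I_r) : set (set (nat -> freeprod G)) :=
  [set omega | ends fp_graph omega /\
    exists2 omega0, ends (cayley (supp (@mu_ i))) omega0
      & [set emb i \o rho | rho in omega0] `<=` omega].

Definition translate (x : freeprod G) (omega : set (nat -> freeprod G)) :=
  [set (fun n => x * rho n)%g | rho in omega].

Definition ends_factor (i : 'I_r) : set (set (nat -> freeprod G)) :=
  [set omega | exists x, exists2 omega0, ends_factor0 i omega0
    & omega = translate x omega0].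

Definition infinite_word (w : nat -> letter G) :=
  forall j, tagged (w j) <> 1%g /\ tag (w j) <> tag (w j.+1).

(* The end described by an infinite word is the limit, in the end topology, of
   the prefixes of the word. *)
Definition describes (w : nat -> letter G) (omega : set (nat -> freeprod G)) :=
  forall F, finite_set F -> \forall n \near \oo,
    exists2 v : freeprod G, val v = mkseq w n & end_component fp_graph F omega v.

Definition ends_infinite : set (set (nat -> freeprod G)) :=
  [set omega | ends fp_graph omega /\
    exists2 w, infinite_word w & describes w omega].

End FreeProductEnds.

Section Probability.
Context d (T : measurableType d) (R : realType) (P : probability T R).

(* Random variables with values in a set with the discrete sigma-algebra. *)
Definition discrete_rv (V : Type) (Y : T -> V) :=
  forall A : set V, measurable (Y @^-1` A).

Definition independent_rvs (J : choiceType) (V : J -> Type)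
    (Y : forall j, T -> V j) :=
  forall (s : seq J) (A : forall j, set (V j)), uniq s ->
    P (\big[setI/setT]_(j <- s) (@Y j @^-1` A j)) =
    (\prod_(j <- s) P (@Y j @^-1` A j))%E.

Section Walk.
Variables (H : groupType) (m : H -> R).

Definition random_walk (X : nat -> T -> H) :=
  (forall n, discrete_rv (X n)) /\
  forall (n : nat) (x : nat -> H),
    P [set t | forall k, (k <= n)%N -> X k t = x k] =
    ((x 0%N == 1%g)%:R * \prod_(k < n) m ((x k)^-1 * x k.+1)%g)%:E.

(* Particles are labelled by finite sequences of integers: [::] is the initial
   particle and [k :: u] the k-th child of [u], which exists iff u does and has
   more than k children.  [N u] is the number of children of [u] and [S u] the
   step made by [u] away from the position of its parent ([S [::]] is not
   used). *)
Definition brw_index := (seq nat + seq nat)%type.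

Definition brw_value (j : brw_index) : Type :=
  match j with inl _ => nat | inr _ => H end.

Definition brw_variable (N : seq nat -> T -> nat) (S : seq nat -> T -> H)
    (j : brw_index) : T -> brw_value j :=
  match j with inl u => N u | inr u => S u end.

Definition branching_random_walk (nu : probability nat R)
    (N : seq nat -> T -> nat) (S : seq nat -> T -> H) :=
  [/\ forall u, discrete_rv (N u) /\ discrete_rv (S u),
      forall u k, P (N u @^-1` [set k]) = nu [set k],
      forall u x, P (S u @^-1` [set x]) = (m x)%:E
    & independent_rvs (brw_variable N S)].

Fixpoint alive (N : seq nat -> T -> nat) (t : T) (u : seq nat) : bool :=
  if u is k :: u' then alive N t u' && (k < N u' t)%N else true.

Fixpoint position (S : seq nat -> T -> H) (t : T) (u : seq nat) : H :=
  if u is k :: u' then (position S t u' * S u t)%g else 1%g.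

Definition visited (N : seq nat -> T -> nat) (S : seq nat -> T -> H) (t : T) :
    set H :=
  [set position S t u | u in [set u | alive N t u]].

End Walk.

Definition xi (r : nat) (G : 'I_r -> groupType) (X : nat -> T -> freeprod G)
    (i : 'I_r) (z : R) : \bar R :=
  (\sum_(1 <= n <oo)
    P [set t | factor_nontrivial i (X n t) /\
               forall m, (1 <= m < n)%N -> ~ factor_nontrivial i (X m t)]
    * (z ^+ n)%:E)%E.

End Probability.

(* Main.v *)
Require Import Defs.
From mathcomp Require Import all_boot all_order all_algebra.
From mathcomp Require Import all_classical all_reals all_analysis.
From mathcomp Require Import zify ring lra.

Set Implicit Arguments.
Unset Strict Implicit.
Unset Printing Implicit Defensive.

Import Order.TTheory GRing.Theory Num.Theory.
Import numFieldNormedType.Exports.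

Local Open Scope classical_set_scope.
Local Open Scope ring_scope.

(* Stop every particle when it first enters Gamma_i^x, restart from there, and
   so on: the stopped particles form a Galton-Watson process with mean xi_i.
   If xi_i <= 1 it dies out, so that each particle has finitely many descendant
   positions in its own coset.  A coset x Gamma_i can only be entered at the
   projection of 1 onto it, and each vertex is visited finitely often (the
   Galton-Watson process of returns has mean U <= 1, because the generating
   function g of closed paths satisfies g = 1 + U g wherever it is finite).
   Hence finitely many vertices of x Gamma_i are visited.
   If xi_i > 1 the process survives with positive probability, and the siblings
   of the leftmost line of descent are independent trials, which yields
   infinitely many cosets x Gamma_i visited infinitely often.
   On the graph side, ends of the copy x Gamma_i are limits of a vertex set A
   exactly when the projection of A onto x Gamma_i is infinite, and if all
   projections of A are finite then all limits of A are infinite words.  The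
   leftmost line is a random walk, i.e. the branching walk with one child per
   particle; there all xi_j are < 1, hence it accumulates at an infinite word. *)

(** * Independence of events read on disjoint coordinates *)

(** As lambda may equal R, both the process of returns and the process stopped in Gamma_i^x can be
    critical, and U <= 1 is only reached as a limit of strict bounds at smaller arguments.
    Extinction at mean exactly 1 needs an offspring number that is not constant; nu(0) = 0 and nu(1)
    < 1 provide this in the form of two incomparable labels that are stopped together with positive
    probability. On the leftmost line there are no such pairs, but there all means are strictly
    below 1, because 1 < R. Labels are deterministic and only their being alive is random, so an
    expected number of particles is a sum of probabilities over labels. Every event is a set of
    configurations read on known coordinates: the history of a label u is read on [anc u], its
    subtree on [desc u], and these are disjoint. The branching property thus becomes independence
    over disjoint index sets, without filtrations or stopping times. *)

Lemma sigma_algebra_ind (T : Type) (G Q : set (set T)) : setI_closed G ->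
  G `<=` Q -> Q setT -> setC_closed Q -> trivIset_closed Q -> <<s G >> `<=` Q.
Proof.
move=> GI GQ QT QC QU; apply: lambda_system_subset => //.
by apply/dynkin_lambda_system; split.
Qed.

Section RealProbability.
Context d (T : measurableType d) (R : realType) (P : probability T R).

(** Real-valued, so that [lra] and [nra] apply to probabilities; [prE] goes back for measurable
    sets. *)
Definition pr (A : set T) : R := fine (P A).

Lemma prE A : measurable A -> P A = (pr A)%:E.
Proof. by move=> mA; rewrite /pr fineK // fin_num_measure. Qed.

Lemma pr_ge0 A : 0 <= pr A.
Proof. by rewrite /pr fine_ge0 // measure_ge0. Qed.

Lemma pr_le A B : measurable A -> measurable B -> A `<=` B -> pr A <= pr B.
Proof.
move=> mA mB AB; rewrite -lee_fin -!prE //.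
by apply: le_measure; rewrite ?inE.
Qed.

Lemma pr_setT : pr setT = 1.
Proof. by rewrite /pr probability_setT. Qed.

Lemma pr_set0 : pr set0 = 0.
Proof. by rewrite /pr measure0. Qed.

Lemma pr_le1 A : measurable A -> pr A <= 1.
Proof. by move=> mA; rewrite -pr_setT; apply: pr_le. Qed.

Lemma prU A B : measurable A -> measurable B ->
  pr (A `|` B) = pr A + pr B - pr (A `&` B).
Proof.
move=> mA mB; have mU := measurableU _ _ mA mB; have mI := measurableI _ _ mA mB.
suff : (pr (A `|` B))%:E = (pr A + pr B - pr (A `&` B))%:E by case.
rewrite -prE // EFinB EFinD -!prE //; apply: measureUfinr => //.
by rewrite (le_lt_trans (probability_le1 P mB)) ?ltry.
Qed.

Lemma prC A : measurable A -> pr (~` A) = 1 - pr A.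
Proof.
move=> mA; have := prU mA (measurableC mA).
rewrite setUv pr_setT setICr pr_set0 subr0 => ->.
by rewrite addrAC subrr add0r.
Qed.

Lemma prU_le A B : measurable A -> measurable B -> pr (A `|` B) <= pr A + pr B.
Proof. by move=> mA mB; rewrite prU // gerBl pr_ge0. Qed.

(** Moves a countable index set into [nat], so that sigma-additivity along sequences also serves
    labels, words and group elements. *)
Lemma countable_nat_bij (I : choiceType) (D : set I) : countable D -> D !=set0 ->
  exists (B : set nat) (g : nat -> I), set_bij B D g.
Proof.
move=> /countable_bijP[B /pcard_eqP/bijPex[f [fD finj fB]]] [i Di].
have /choice[g gP] n : exists x, B n -> D x /\ f x = n.
  have [/fB[x Dx <-]|nB] := pselect (B n); first by exists x.
  by exists i.
exists B, g; split=> [n /gP[] //|n m|x Dx].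
  rewrite !inE => /gP[_ fn] /gP[_ fm] gnm.
  by rewrite -fn -fm gnm.
exists (f x); first exact: fD.
by have [Dg fg] := gP _ (fD _ Dx); apply: finj; rewrite ?inE.
Qed.

Lemma pr_bigcup (I : choiceType) (D : set I) (F : I -> set T) :
  countable D -> (forall i, D i -> measurable (F i)) -> trivIset D F ->
  (pr (\bigcup_(i in D) F i))%:E = (\esum_(i in D) (pr (F i))%:E)%E.
Proof.
move=> cD mF tF.
have [->|/set0P D0] := eqVneq D set0.
  by rewrite bigcup_set0 esum_set0 pr_set0.
have [B [g gb]] := countable_nat_bij cD D0.
have gD n : B n -> D (g n) by case: gb => h _ _; exact: h.
have -> : \bigcup_(i in D) F i = \bigcup_(n in B) F (g n).
  rewrite predeqE => t; split=> [[i Di Ft]|[n /gD Dn Ft]]; last by exists (g n).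
  by have [_ _ /(_ _ Di)[n Bn gn]] := gb; exists n; rewrite ?gn.
rewrite (reindex_esum B D g) //.
have mU : measurable (\bigcup_(n in B) F (g n)).
  by apply: bigcup_measurable => n /gD /mF.
rewrite -prE //.
have -> : P (\bigcup_(n in B) F (g n)) =
    (\sum_(n <oo | n \in B) P (F (g n)))%E.
  apply: measure_bigcup; first by move=> n /gD /mF.
  move=> n k Bn Bk [t [Fn Fk]].
  have gg : g n = g k by apply: tF; [exact: gD|exact: gD|exists t].
  by case: gb => _ inj _; apply: inj; rewrite ?inE.
rewrite nneseries_esum; last by move=> n _; exact: measure_ge0.
rewrite (_ : [set x | x \in B] = B); last first.
  by rewrite predeqE => x; split; rewrite /= inE.
by apply: eq_esum => n Bn; rewrite prE //; apply/mF/gD.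
Qed.

Lemma pr_bigcup_le (I : choiceType) (D : set I) (F : I -> set T) :
  countable D -> (forall i, D i -> measurable (F i)) ->
  ((pr (\bigcup_(i in D) F i))%:E <= \esum_(i in D) (pr (F i))%:E)%E.
Proof.
move=> cD mF.
have [->|/set0P D0] := eqVneq D set0.
  by rewrite bigcup_set0 esum_set0 pr_set0.
have [B [g gb]] := countable_nat_bij cD D0.
have gD n : B n -> D (g n) by case: gb => h _ _; exact: h.
have -> : \bigcup_(i in D) F i = \bigcup_(n in B) F (g n).
  rewrite predeqE => t; split=> [[i Di Ft]|[n /gD Dn Ft]]; last by exists (g n).
  by have [_ _ /(_ _ Di)[n Bn gn]] := gb; exists n; rewrite ?gn.
rewrite (reindex_esum B D g) // esum_mkcond -nneseries_esumT; last first.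
  by move=> n; case: ifP => // _; rewrite lee_fin pr_ge0.
pose F' n := if n \in B then F (g n) else set0.
have mF' n : measurable (F' n).
  by rewrite /F'; case: ifPn => // /[!inE] /gD /mF.
have -> : \bigcup_(n in B) F (g n) = \bigcup_n F' n.
  rewrite predeqE => t; split=> [[n Bn Ft]|[n _]].
    by exists n => //; rewrite /F' mem_set.
  by rewrite /F'; case: ifPn => // /[!inE] Bn Ft; exists n.
have mU : measurable (\bigcup_n F' n) by exact: bigcupT_measurable.
rewrite -prE // (eq_eseriesr (g := fun n => P (F' n))); last first.
  move=> n _; rewrite /F'; case: ifPn => [/[!inE] Bn|_].
    by rewrite prE //; apply/mF/gD.
  by rewrite measure0.
exact: (generalized_Boole_inequality P).
Qed.

End RealProbability.

(** * The sigma-algebra generated by a set of coordinates *)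

Section Cylinders.
Variables (J : choiceType) (V : J -> Type).
Local Notation config := (forall j, V j).
Implicit Types (K : set J) (E : set config).

Definition coord_sets K : set (set config) :=
  [set E | exists2 j, K j & exists A : set (V j), E = [set c | A (c j)]].

(** The events read on the coordinates in [K]; independence later reduces to the disjointness of two
    such index sets. *)
Definition cyl K : set (set config) := <<s coord_sets K >>.

(** Finite rectangles are the intersection-stable generator on which independence is an explicit
    product. *)
Definition rect K : set (set config) :=
  [set E | exists (s : seq J) (A : forall j, set (V j)),
    [/\ uniq s, (forall j, j \in s -> K j)
      & E = [set c | forall j, j \in s -> A j (c j)]]].

Lemma cyl_coord K j (A : set (V j)) : K j -> cyl K [set c | A (c j)].
Proof. by move=> Kj; apply: sub_sigma_algebra; exists j => //; exists A. Qed.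

Lemma cylS K K' : K `<=` K' -> cyl K `<=` cyl K'.
Proof.
move=> KK'; apply: sub_sigma_algebra2 => E [j Kj [A ->]].
by exists j; [exact: KK'|exists A].
Qed.

Lemma cyl_sigma K : sigma_algebra setT (cyl K).
Proof. exact: smallest_sigma_algebra. Qed.

Lemma cylC K E : cyl K E -> cyl K (~` E).
Proof. by have [_ h _] := cyl_sigma K; move=> /h; rewrite setTD. Qed.

Lemma cyl0 K : cyl K set0.
Proof. by have [] := cyl_sigma K. Qed.

Lemma cylT K : cyl K setT.
Proof. by rewrite -setC0; apply: cylC; exact: cyl0. Qed.

Lemma cyl_bigcup K (F : nat -> set config) :
  (forall n, cyl K (F n)) -> cyl K (\bigcup_n F n).
Proof. by have [_ _ h] := cyl_sigma K; apply: h. Qed.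

Lemma cyl_countable K (I : Type) (D : set I) (F : I -> set config) :
  countable D -> (forall i, D i -> cyl K (F i)) -> cyl K (\bigcup_(i in D) F i).
Proof.
move=> /countable_bijP[B /pcard_eqP/bijPex[f fB]] cF.
have -> : \bigcup_(i in D) F i =
    \bigcup_n [set c | exists2 i, D i /\ f i = n & F i c].
  rewrite predeqE => c; split=> [[i Di Fi]|[n _ [i [Di _] Fi]]]; last by exists i.
  by exists (f i) => //; exists i.
apply: cyl_bigcup => n.
have [[i [Di fi]]|nex] := pselect (exists i, D i /\ f i = n); last first.
  rewrite (_ : [set c | _] = set0); first exact: cyl0.
  by rewrite predeqE => c; split=> // -[i ? _]; apply: nex; exists i.
rewrite (_ : [set c | _] = F i); first exact: cF.
rewrite predeqE => c; split=> [[i' [Di' fi'] Fi']|]; last by exists i.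
suff <- : i' = i by [].
by case: fB => _ inj _; apply: inj; rewrite ?inE // fi fi'.
Qed.

Lemma cyl_bigcap K (I : Type) (D : set I) (F : I -> set config) :
  countable D -> (forall i, D i -> cyl K (F i)) -> cyl K (\bigcap_(i in D) F i).
Proof.
move=> cD cF; rewrite -(setCK (\bigcap_(i in D) F i)) setC_bigcap.
by apply: cylC; apply: cyl_countable => // i /cF /cylC.
Qed.

Lemma cylI K E E' : cyl K E -> cyl K E' -> cyl K (E `&` E').
Proof.
move=> cE cE'.
have -> : E `&` E' = \bigcap_(b in [set: bool]) (if b then E else E').
  rewrite predeqE => c; split=> [[Ec E'c] [] //|h].
  by split; [exact: (h true)|exact: (h false)].
by apply: cyl_bigcap => [//|[]].
Qed.

Lemma cylU K E E' : cyl K E -> cyl K E' -> cyl K (E `|` E').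
Proof.
by move=> cE cE'; rewrite -(setCK (_ `|` _)) setCU; apply: cylC; apply: cylI; apply: cylC.
Qed.

Lemma cyl_rect K : cyl K = <<s rect K >>.
Proof.
rewrite eqEsubset; split; last first.
  apply: smallest_sub; first exact: cyl_sigma.
  move=> E [s [A [us sK ->]]].
  rewrite [X in cyl K X](_ : _ = \bigcap_(j in [set` s]) [set c | A j (c j)]).
    apply: cyl_bigcap; first exact/finite_set_countable/finite_seq.
    by move=> j /= js; apply: cyl_coord; exact: sK.
  by rewrite predeqE => c; split=> h j /h.
apply: sub_sigma_algebra2 => E [j Kj [A ->]].
(* The type [V j] depends on the index, so [A] is carried along an equality [j = j'] and completed
   by [setT] to a family of sets. *)
have jA : exists A' : forall j', set (V j'), A' j = A.
  exists (fun j' => match pselect (j = j') with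
    | left e => eq_rect j (fun k => set (V k)) A j' e | right _ => setT end).
  case: pselect => // e; rewrite (_ : e = erefl) //; exact: Prop_irrelevance.
have [A' A'j] := jA.
exists [:: j], A'; split=> //; first by move=> ?; rewrite inE => /eqP ->.
rewrite predeqE => c; split=> [Ac j'|]; last by rewrite -A'j; apply; rewrite inE.
by rewrite inE => /eqP ->; rewrite A'j.
Qed.

Lemma rectI K : setI_closed (rect K).
Proof.
move=> _ _ [s1 [A1 [us1 sK1 ->]]] [s2 [A2 [us2 sK2 ->]]].
exists (undup (s1 ++ s2)), (fun j => [set v | (j \in s1 -> A1 j v) /\
  (j \in s2 -> A2 j v)]); split; first exact: undup_uniq.
  by move=> j; rewrite mem_undup mem_cat => /orP[/sK1|/sK2].
rewrite predeqE => c; split=> [[h1 h2] j _|h].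
  by split=> [/h1|/h2].
by split=> j js; have [|h1 h2] := h j; rewrite ?mem_undup ?mem_cat ?js ?orbT //;
  [exact: h1|exact: h2].
Qed.

End Cylinders.

Definition conf_of (T J : Type) (V : J -> Type) (Y : forall j, T -> V j) (t : T) :
  forall j, V j := fun j => Y j t.

Section CylinderProbability.
Context d (T : measurableType d) (R : realType) (P : probability T R).
Variables (J : choiceType) (V : J -> Type).
Local Notation config := (forall j, V j).

Definition good_family (Y : forall j, T -> V j) :=
  (forall j, discrete_rv (Y j)) /\ independent_rvs P Y.

Lemma measurable_cyl (Y : forall j, T -> V j) K E : (forall j, discrete_rv (Y j)) ->
  cyl K E -> measurable (conf_of Y @^-1` E).
Proof.
move=> mY; apply: (smallest_sub (X := [set E | measurable (conf_of Y @^-1` E)])).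
  split=> [|A /= mA|F mF] /=.
  - by rewrite preimage_set0.
  - by rewrite setTD preimage_setC; exact: measurableC.
  - by rewrite preimage_bigcup; exact: bigcupT_measurable.
by move=> _ [j _ [A ->]]; exact: mY.
Qed.

Lemma rect_prob (Y : forall j, T -> V j) (s : seq J) (A : forall j, set (V j)) :
  good_family Y -> uniq s ->
  P (conf_of Y @^-1` [set c | forall j, j \in s -> A j (c j)]) =
  (\prod_(j <- s) P (@Y j @^-1` A j))%E.
Proof.
move=> [_ iY] us; rewrite -iY //; congr (P _).
rewrite -bigcap_seq predeqE => t; split=> h j /=; first exact: h.
exact: h.
Qed.

(** The pi-lambda argument behind two results: with [Y' = Y] it gives independence from [D], with
    [D = setT] it gives equality of two laws. *)
Lemma dynkin_cyl (Y Y' : forall j, T -> V j) K (D : set T) (a : R) :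
  (forall j, discrete_rv (Y j)) -> (forall j, discrete_rv (Y' j)) ->
  measurable D -> P D = a%:E ->
  (forall E, rect K E ->
    P (conf_of Y @^-1` E `&` D) = (P (conf_of Y' @^-1` E) * P D)%E) ->
  forall E, cyl K E ->
    P (conf_of Y @^-1` E `&` D) = (P (conf_of Y' @^-1` E) * P D)%E.
Proof.
move=> mY mY' mD PD hr E cE.
suff [//] : (cyl K `&` [set E | P (conf_of Y @^-1` E `&` D) =
  (P (conf_of Y' @^-1` E) * P D)%E]) E.
move: cE; rewrite {1}cyl_rect; move: E; apply: sigma_algebra_ind.
- exact: rectI.
- move=> E rE; split; last exact: hr.
  by rewrite cyl_rect; exact: sub_sigma_algebra.
- split; first exact: cylT.
  by rewrite /= !preimage_setT setTI probability_setT mul1e.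
- move=> A [cA eA]; split; first exact: cylC.
  have mA := measurable_cyl mY cA; have mA' := measurable_cyl mY' cA.
  change (P (~` (conf_of Y @^-1` A) `&` D) = (P (~` (conf_of Y' @^-1` A)) * P D)%E).
  have -> : P (~` (conf_of Y @^-1` A) `&` D) =
      (P D - P (conf_of Y @^-1` A `&` D))%E.
    rewrite setIC -setDE [in RHS]setIC; apply: measureD => //.
    by rewrite (le_lt_trans (probability_le1 P mD)) ?ltry.
  have Pc : P (~` (conf_of Y' @^-1` A)) = (1 - P (conf_of Y' @^-1` A))%E.
    exact: probability_setC.
  have pE : P (conf_of Y' @^-1` A) = (fine (P (conf_of Y' @^-1` A)))%:E.
    by rewrite fineK // fin_num_measure.
  rewrite eA Pc PD pE; set p := fine _.
  change ((a - p * a)%:E = ((1 - p) * a)%:E); by rewrite mulrBl mul1r.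
- move=> F tF FK; split; first by apply: cyl_bigcup => n; have [] := FK n.
  have mF n := measurable_cyl mY (FK n).1.
  have mF' n := measurable_cyl mY' (FK n).1.
  have tY Z : trivIset setT (fun n => conf_of Z @^-1` F n).
    by move=> n m _ _ [t [Fn Fm]]; apply: tF => //; exists (conf_of Z t).
  have e1 : P (conf_of Y @^-1` (\bigcup_k F k) `&` D) =
      (\sum_(n <oo) P (conf_of Y @^-1` F n `&` D))%E.
    rewrite preimage_bigcup setI_bigcupl; apply: measure_semi_bigcup.
    - by move=> n; exact: measurableI.
    - by exact: trivIset_setIr.
    - by apply: bigcupT_measurable => n; exact: measurableI.
  have e2 : P (conf_of Y' @^-1` (\bigcup_k F k)) =
      (\sum_(n <oo) P (conf_of Y' @^-1` F n))%E.
    rewrite preimage_bigcup; apply: measure_semi_bigcup => //.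
    - exact: bigcupT_measurable.
  have a0 : (0 <= a%:E)%E by rewrite -PD measure_ge0.
  rewrite /= e1 e2 PD muleC.
  transitivity (\sum_(n <oo) (a%:E * P (conf_of Y' @^-1` F n)))%E.
    by apply: eq_eseriesr => n _; have [_ ->] := FK n; rewrite PD muleC.
  by apply: nneseriesZl => // n _; exact: measure_ge0.
Qed.

Lemma rect_indep (Y : forall j, T -> V j) K1 K2 E1 E2 : good_family Y ->
  (forall j, K1 j -> ~ K2 j) -> rect K1 E1 -> rect K2 E2 ->
  P (conf_of Y @^-1` E1 `&` conf_of Y @^-1` E2) =
  (P (conf_of Y @^-1` E1) * P (conf_of Y @^-1` E2))%E.
Proof.
move=> gY dK [s1 [A1 [us1 sK1 ->]]] [s2 [A2 [us2 sK2 ->]]].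
have d12 j : j \in s2 -> j \notin s1.
  by move=> /sK2 K2j; apply/negP => /sK1 /dK.
rewrite (rect_prob A1 gY us1) (rect_prob A2 gY us2).
transitivity (P (conf_of Y @^-1` [set c | forall j, j \in s1 ++ s2 ->
    (if j \in s1 then A1 j else A2 j) (c j)])).
  congr (P _); rewrite predeqE => t; split=> [[h1 h2] j /=|h].
    by rewrite mem_cat; case: ifPn => [/h1 //|_ /= /h2].
  split=> j js; have := h j; rewrite mem_cat js ?orbT; first by apply.
  by rewrite (negPf (d12 _ js)); apply.
have u12 : uniq (s1 ++ s2).
  rewrite cat_uniq us1 us2 andbT /=; apply/hasPn => j; exact: d12.
rewrite (rect_prob (fun j => if j \in s1 then A1 j else A2 j) gY u12).
rewrite big_cat /=; congr (_ * _)%E.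
  by apply: eq_big_seq => j ->.
by apply: eq_big_seq => j /d12 /negPf ->.
Qed.

(** Two passes of [dynkin_cyl], one for each factor, starting from [rect_indep]. *)
Lemma indep_cyl (Y : forall j, T -> V j) K1 K2 E1 E2 : good_family Y ->
  (forall j, K1 j -> ~ K2 j) -> cyl K1 E1 -> cyl K2 E2 ->
  P (conf_of Y @^-1` (E1 `&` E2)) =
  (P (conf_of Y @^-1` E1) * P (conf_of Y @^-1` E2))%E.
Proof.
move=> gY dK c1 c2; have [mY _] := gY; rewrite preimage_setI.
have m2 := measurable_cyl mY c2.
apply: (@dynkin_cyl Y Y K1 _ (fine (P (conf_of Y @^-1` E2)))) => //.
  by rewrite fineK // fin_num_measure.
move=> E rE.
have cE : cyl K1 E by rewrite cyl_rect; exact: sub_sigma_algebra.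
have mE := measurable_cyl mY cE.
rewrite setIC muleC.
apply: (@dynkin_cyl Y Y K2 _ (fine (P (conf_of Y @^-1` E)))) => //.
  by rewrite fineK // fin_num_measure.
by move=> E' rE'; rewrite setIC muleC; exact: (@rect_indep Y K1 K2).
Qed.

Lemma pr_indep (Y : forall j, T -> V j) K1 K2 E1 E2 : good_family Y ->
  (forall j, K1 j -> ~ K2 j) -> cyl K1 E1 -> cyl K2 E2 ->
  pr P (conf_of Y @^-1` (E1 `&` E2)) =
  pr P (conf_of Y @^-1` E1) * pr P (conf_of Y @^-1` E2).
Proof.
move=> gY dK c1 c2; have [mY _] := gY.
rewrite /pr (indep_cyl gY dK c1 c2) fineM // fin_num_measure //.
  exact: (measurable_cyl mY c1).
exact: (measurable_cyl mY c2).
Qed.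

(** The law of an independent family is determined by its marginals, since these fix the rectangles.
    This is what makes a subtree distributed like the whole tree. *)
Lemma cyl_law (Y Y' : forall j, T -> V j) K E :
  good_family Y -> good_family Y' ->
  (forall j A, P (Y j @^-1` A) = P (Y' j @^-1` A)) ->
  cyl K E -> P (conf_of Y @^-1` E) = P (conf_of Y' @^-1` E).
Proof.
move=> gY gY' eY cE; have [mY _] := gY; have [mY' _] := gY'.
rewrite -[LHS](congr1 P (setIT _)) -[RHS]mule1 -(@probability_setT _ _ _ P).
apply: (@dynkin_cyl Y Y' K setT 1) => //; first by rewrite probability_setT.
move=> _ [s [A [us sK ->]]].
by rewrite setIT probability_setT mule1 (rect_prob A gY us) (rect_prob A gY' us);
  apply: eq_bigr.
Qed.

End CylinderProbability.

(** * Genealogy *)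

Section Words.
Variable H : groupType.

(* Sequences of steps are listed with the most recent step first. *)
Definition gprod (p : seq H) : H := foldr (fun s g => g * s)%g 1%g p.

Lemma gprod_cat p q : gprod (p ++ q) = (gprod q * gprod p)%g.
Proof. by elim: p => [|s p IH] /=; rewrite ?mulg1 // IH mulgA. Qed.

Lemma countable_seq (L : set (seq H)) : countable [set: H] -> countable L.
Proof.
move=> /countable_injP[f finj]; apply/countable_injP.
exists (fun p => pickle (map f p)) => p q _ _ /(pcan_inj pickleK).
by apply: inj_map => x y; apply: finj; rewrite inE.
Qed.

(** As the most recent step comes first, the proper suffixes [q2] are the earlier stages of the
    path. The empty word is excluded throughout: the start is no hit even if [B] contains 1, so
    first returns to 1 are the first hits of [[set 1]]. *)
Definition first_hit (B : set H) : set (seq H) := [set p | [/\ p != [::],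
  B (gprod p) & forall q1 q2 : seq H, p = q1 ++ q2 -> q1 != [::] -> q2 != [::] ->
    ~ B (gprod q2)]].

Local Notation config := (forall j : brw_index, brw_value H j).
Implicit Types (c : config) (u v w : seq nat).

Fixpoint calive c u : bool :=
  if u is k :: u' then calive c u' && (k < (c (inl u') : nat))%N else true.

Fixpoint csteps c u : seq H :=
  if u is k :: u' then (c (inr u) : H) :: csteps c u' else [::].

Definition cpos c u := gprod (csteps c u).

Definition cshift v c : config := fun j =>
  match j return brw_value H j with
  | inl w => c (inl (w ++ v)) | inr w => c (inr (w ++ v)) end.

Lemma size_csteps c u : size (csteps c u) = size u.
Proof. by elim: u => //= k u ->. Qed.

Lemma calive_cat c w v : calive c (w ++ v) = calive c v && calive (cshift v c) w.
Proof. by elim: w => [|k w IH] /=; rewrite ?andbT // IH andbA. Qed.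

Lemma csteps_cat c w v :
  csteps c (w ++ v) = csteps (cshift v c) w ++ csteps c v.
Proof. by elim: w => //= k w ->. Qed.

Lemma cpos_cat c w v : cpos c (w ++ v) = (cpos c v * cpos (cshift v c) w)%g.
Proof. by rewrite /cpos csteps_cat gprod_cat. Qed.

Lemma cshift_cat c w v : cshift w (cshift v c) = cshift (w ++ v) c.
Proof. by apply: functional_extensionality_dep => -[x|x] /=; rewrite catA. Qed.

Lemma cshift0 c : cshift [::] c = c.
Proof. by apply: functional_extensionality_dep => -[x|x] /=; rewrite cats0. Qed.

(* [S u] is the step of u from its parent, hence belongs to the history of u,
   whereas [N u] belongs to the subtree of u. *)
Definition desc u : set brw_index := [set j | match j with
  | inl v => suffix u v | inr v => suffix u v && (v != u) end].

Definition anc u : set brw_index := [set j | match j with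
  | inl v => suffix v u && (v != u) | inr v => suffix v u && (v != [::]) end].

Lemma suffix_size_eq u v : suffix u v -> (size v <= size u)%N -> v = u.
Proof.
move=> /suffixP[w ->]; rewrite size_cat -[leqRHS]add0n leq_add2r leqn0.
by rewrite size_eq0 => /eqP ->.
Qed.

Lemma desc_anc u j : anc u j -> ~ desc u j.
Proof.
case: j => v /= /andP[vu vn].
  by move=> uv; move: vn; rewrite (suffix_size_eq uv) ?eqxx ?size_suffix.
move=> /andP[uv]; rewrite (suffix_size_eq uv) ?eqxx //.
exact: size_suffix.
Qed.

Lemma desc_desc0 u j : desc u j -> desc [::] j.
Proof.
case: j => v //=; rewrite !suffix0s //= => /andP[uv vu].
by apply: contra vu => /eqP v0; move: uv; rewrite v0 suffixs0 eq_sym.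
Qed.

Lemma anc_desc0 u j : anc u j -> desc [::] j.
Proof. by case: j => v /=; rewrite !suffix0s //= => /andP[]. Qed.

Lemma suffix_cat_eq (a b u v : seq nat) : a ++ u = b ++ v ->
  (size v <= size u)%N -> suffix v u.
Proof.
elim: a b => [|x a IH] [|y b] /=.
- by move=> -> _; exact: suffix_refl.
- by move=> -> _; apply/suffixP; exists (y :: b).
- by move=> <-; rewrite /= size_cat; lia.
- by move=> [_ /IH h] /h.
Qed.

Lemma desc_disj u v j : ~~ suffix u v -> ~~ suffix v u -> desc u j -> ~ desc v j.
Proof.
move=> uv vu; have h w : suffix u w -> ~ suffix v w.
  move=> /suffixP[a ->] /suffixP[b] e.
  have [le|/ltnW le] := leqP (size v) (size u).
    by move: vu; rewrite (suffix_cat_eq e le).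
  by move: uv; rewrite (suffix_cat_eq (esym e) le).
case: j => w /=; first exact: h.
by move=> /andP[/h nvw _] /andP[/nvw].
Qed.

Lemma cyl_path u (L : set (seq H)) : countable [set: H] ->
  cyl (anc u) [set c | calive c u /\ L (csteps c u)].
Proof.
move=> cH.
have -> : [set c | calive c u /\ L (csteps c u)] =
    \bigcup_(p in L) [set c | calive c u /\ csteps c u = p].
  rewrite predeqE => c; split=> [[cu Lc]|[p Lp [cu e]]]; last by rewrite /= e.
  by exists (csteps c u).
apply: cyl_countable; first exact: countable_seq.
(* Since [L] is a countable union of single words, the induction on [u] only has to follow one
   word. *)
move=> p _ {L}; elim: u p => [|k u IH] p.
  have [->|p0] := eqVneq p [::].
    by rewrite (_ : [set c | _] = setT); [exact: cylT|rewrite predeqE].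
  rewrite (_ : [set c | _] = set0); first exact: cyl0.
  by rewrite predeqE => c; split=> // -[_ /= e]; rewrite -e eqxx in p0.
have sanc : anc u `<=` anc (k :: u).
  have h v : suffix v u -> suffix v (k :: u).
    by move=> /suffixP[w ->]; apply/suffixP; exists (k :: w).
  case=> v /= /andP[vu vn]; rewrite h //=.
  by apply: contraTneq (size_suffix vu) => ->; rewrite /= -ltnNge.
case: p => [|s p].
  rewrite (_ : [set c | _] = set0); first exact: cyl0.
  by rewrite predeqE => c; split=> // -[_].
have -> : [set c | calive c (k :: u) /\ csteps c (k :: u) = s :: p] =
   [set c : config | calive c u /\ csteps c u = p] `&`
   ([set c : config | [set n : nat | (k < n)%N] (c (inl u))] `&`
    [set c : config | [set s] (c (inr (k :: u)))]).
  rewrite predeqE => c /=; split=> [[/andP[cu kc] [-> ->]]|[[-> ->] [-> ->]]] //.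
apply: cylI; first exact: cylS (IH p).
apply: cylI.
  apply: (@cyl_coord _ _ _ (inl u) [set n : nat | (k < n)%N]) => /=.
  apply/andP; split; first by apply/suffixP; exists [:: k].
  by apply/eqP => /(congr1 size) /=; lia.
by apply: (@cyl_coord _ _ _ (inr (k :: u)) [set s]); rewrite /= suffix_refl.
Qed.

Lemma cyl_shift v (K K' : set brw_index) E : cyl K E ->
  (forall w, K (inl w) -> K' (inl (w ++ v))) ->
  (forall w, K (inr w) -> K' (inr (w ++ v))) -> cyl K' (cshift v @^-1` E).
Proof.
move=> cE hl hr.
apply: (smallest_sub (X := [set E | cyl K' (cshift v @^-1` E)])) cE.
  split=> [|A /= cA|F cF] /=.
  - by rewrite preimage_set0; exact: cyl0.
  - by rewrite setTD; exact: (cylC cA).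
  - by rewrite preimage_bigcup; exact: cyl_bigcup.
move=> _ [[w|w] Kj [A ->]] /=.
  by apply: (@cyl_coord _ _ K' (inl (w ++ v)) A); exact: hl.
by apply: (@cyl_coord _ _ K' (inr (w ++ v)) A); exact: hr.
Qed.

Lemma cyl_shift_desc v E :
  cyl (desc [::]) E -> cyl (desc v) (cshift v @^-1` E).
Proof.
move=> cE; apply: cyl_shift cE _ _ => w /= h; first by rewrite suffix_suffix.
rewrite suffix_suffix /=; move: h; rewrite suffix0s /=.
by apply: contra => /eqP e; rewrite -size_eq0 -(eqn_add2r (size v)) -size_cat e.
Qed.

End Words.

(** * The law of the branching walk on cylinder events *)

Section BranchingWalk.
Context d (T : measurableType d) (R : realType) (P : probability T R).
Variables (H : groupType) (m : H -> R) (nu : probability nat R).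
Hypothesis cH : countable [set: H].

Local Notation config := (forall j : brw_index, brw_value H j).
Local Notation brw := (branching_random_walk P m nu).
Local Notation bv := (@brw_variable d T H).

(** The probability that the child with index [k], counted from 0, exists. These numbers sum to the
    mean of [nu] ([tails_mean]). *)
Definition tail (k : nat) : R := pr nu [set j | (k < j)%N].

Definition cpr (N : seq nat -> T -> nat) (S : seq nat -> T -> H)
  (E : set config) : R := pr P (conf_of (bv N S) @^-1` E).

Lemma brw_good N S : brw N S -> good_family P (bv N S).
Proof. by move=> [mNS _ _ iNS]; split=> // -[u|u] /=; have [] := mNS u. Qed.

Lemma pr_singleton (V : choiceType) (Y : T -> V) (A : set V) :
  discrete_rv Y -> countable A ->
  (pr P (Y @^-1` A))%:E = (\esum_(x in A) (pr P (Y @^-1` [set x]))%:E)%E.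
Proof.
move=> mY cA; rewrite -pr_bigcup //.
- congr ((pr P _)%:E); rewrite predeqE => t; split=> [At|[x Ax /= ->] //].
  by exists (Y t).
- by move=> x y _ _ [t [/= -> ->]].
Qed.

Lemma brw_N N S u (A : set nat) : brw N S -> P (N u @^-1` A) = nu A.
Proof.
move=> [mNS NE _ _]; have [mN _] := mNS u.
have cA : countable A by exact: countableP.
rewrite (prE P (mN A)) (prE nu (_ : measurable A)) //.
rewrite pr_singleton //.
have -> : A = \bigcup_(x in A) [set x].
  rewrite predeqE => t; split=> [At|[x Ax /= ->] //]; by exists t.
rewrite pr_bigcup //; last by move=> x y _ _ [t [/= -> ->]].
rewrite -(_ : A = \bigcup_(x in A) [set x]); last first.
  by rewrite predeqE => t; split=> [At|[x Ax /= ->] //]; exists t.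
by apply: eq_esum => x _; rewrite /pr NE.
Qed.

Lemma brw_S N S u (A : set H) : brw N S ->
  (pr P (S u @^-1` A))%:E = (\esum_(x in A) (m x)%:E)%E.
Proof.
move=> [mNS _ SE _]; have [_ mS] := mNS u.
rewrite pr_singleton //; last exact: sub_countable (subset_card_le (@subsetT _ A)) cH.
by apply: eq_esum => x _; rewrite /pr SE.
Qed.

Definition shift_fun (X : Type) (Y : seq nat -> X) v w := Y (w ++ v).

Lemma shift_brw N S v : brw N S -> brw (shift_fun N v) (shift_fun S v).
Proof.
move=> [mNS NE SE iNS]; split=> [u|u k|u x|s A us]; [exact: mNS|exact: NE|exact: SE|].
pose h (j : brw_index) : brw_index := match j with
  | inl w => inl (w ++ v) | inr w => inr (w ++ v) end.
(* Independence is known for the original labels, so the sets [A] are transported to the labels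
   [w ++ v] by cutting off the suffix [v]. The values of [A'] at other labels do not matter, as only
   labels in the image of [h] occur. *)
pose A' (j : brw_index) : set (brw_value H j) := match j with
  | inl x => A (inl (take (size x - size v) x))
  | inr x => A (inr (take (size x - size v) x)) end.
have tk (w : seq nat) : take (size (w ++ v) - size v) (w ++ v) = w.
  by rewrite size_cat addnK take_size_cat.
have hinj : injective h.
  by case=> x [] y //= [] e; rewrite -(tk x) e tk.
have YA j : bv N S (h j) @^-1` A' (h j) =
    bv (shift_fun N v) (shift_fun S v) j @^-1` A j.
  by case: j => w /=; rewrite tk.
have := iNS [seq h j | j <- s] A'; rewrite map_inj_uniq // => /(_ us).
rewrite !big_map => e.
rewrite -(eq_bigr _ (fun j _ => YA j)) e.
by apply: eq_bigr => j _; rewrite YA.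
Qed.

Lemma conf_shift N S v t :
  conf_of (bv (shift_fun N v) (shift_fun S v)) t =
  cshift v (conf_of (bv N S) t).
Proof. by apply: functional_extensionality_dep => -[]. Qed.

Lemma cpr_law N S N' S' K E : brw N S -> brw N' S' -> cyl K E ->
  cpr N S E = cpr N' S' E.
Proof.
move=> b b' cE; rewrite /cpr /pr; congr fine.
apply: cyl_law cE; [exact: brw_good|exact: brw_good|].
case=> u A /=; first by rewrite (brw_N _ _ b) (brw_N _ _ b').
have [mNS _ _ _] := b; have [mNS' _ _ _] := b'.
rewrite !prE; [|by have [_ ] := mNS' u|by have [_ ] := mNS u].
by rewrite (brw_S _ _ b) (brw_S _ _ b').
Qed.

Lemma cpr_shift N S v K E : brw N S -> cyl K E ->
  cpr N S (cshift v @^-1` E) = cpr N S E.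
Proof.
move=> b cE; rewrite -(cpr_law (shift_brw v b) b cE) /cpr.
by congr (pr P _); rewrite predeqE => t /=; rewrite conf_shift.
Qed.

Lemma cprI N S K1 K2 E1 E2 : brw N S -> (forall j, K1 j -> ~ K2 j) ->
  cyl K1 E1 -> cyl K2 E2 -> cpr N S (E1 `&` E2) = cpr N S E1 * cpr N S E2.
Proof. by move=> /brw_good; exact: pr_indep. Qed.

Lemma conf_measurable N S K E : brw N S -> cyl K E ->
  measurable (conf_of (bv N S) @^-1` E).
Proof. by move=> /brw_good[mY _]; exact: measurable_cyl. Qed.

Lemma cpr_ge0 N S E : 0 <= cpr N S E.
Proof. exact: pr_ge0. Qed.

Lemma cpr_N N S u k : brw N S ->
  cpr N S [set c : config | (k < (c (inl u) : nat))%N] = tail k.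
Proof. by move=> b; rewrite /cpr /pr /tail /pr -(brw_N u _ b). Qed.

Lemma cpr_S N S u (s : H) : brw N S ->
  cpr N S [set c : config | (c (inr u) : H) = s] = m s.
Proof. by move=> [_ _ SE _]; have := SE u s; rewrite /cpr /pr => ->. Qed.

Lemma tail_ge0 k : 0 <= tail k.
Proof. exact: pr_ge0. Qed.

Lemma brw_m_ge0 N S s : brw N S -> 0 <= m s.
Proof. by move=> b; rewrite -(cpr_S [::] s b) cpr_ge0. Qed.

Definition tails (u : seq nat) : R := \prod_(k <- u) tail k.
Definition weight1 (p : seq H) : R := \prod_(s <- p) m s.

Lemma tails_ge0 u : 0 <= tails u.
Proof. by apply: prodr_ge0 => k _; exact: tail_ge0. Qed.

Lemma weight1_ge0 N S p : brw N S -> 0 <= weight1 p.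
Proof. by move=> b; apply: prodr_ge0 => s _; exact: brw_m_ge0 b. Qed.

Lemma cpr_path N S u p : brw N S ->
  cpr N S [set c | calive c u /\ csteps c u = p] =
  if size p == size u then tails u * weight1 p else 0.
Proof.
move=> b; elim: u p => [|k u IH] [|s p].
- rewrite (_ : [set c | _] = setT); last by rewrite predeqE.
  by rewrite /tails /weight1 !big_nil mulr1 /cpr preimage_setT pr_setT.
- rewrite (_ : [set c | _] = set0); last by rewrite predeqE => c; split=> // -[].
  by rewrite /cpr preimage_set0 pr_set0.
- rewrite (_ : [set c | _] = set0); last by rewrite predeqE => c; split=> // -[].
  by rewrite /cpr preimage_set0 pr_set0.
have -> : [set c | calive c (k :: u) /\ csteps c (k :: u) = s :: p] =
   [set c : config | calive c u /\ csteps c u = p] `&`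
   ([set c : config | [set n : nat | (k < n)%N] (c (inl u))] `&`
    [set c : config | [set s] (c (inr (k :: u)))]).
  rewrite predeqE => c /=; split=> [[/andP[cu kc] [-> ->]]|[[-> ->] [-> ->]]] //.
have c1 : cyl [set inl u : brw_index]
    [set c : config | [set n : nat | (k < n)%N] (c (inl u))].
  exact: (@cyl_coord _ _ _ (inl u) [set n : nat | (k < n)%N]).
have c2 : cyl [set inr (k :: u) : brw_index]
    [set c : config | [set s] (c (inr (k :: u)))].
  exact: (@cyl_coord _ _ _ (inr (k :: u)) [set s]).
(* The two new coordinates are fresh: [anc u] contains the steps up to [u] but not the number of
   children of [u] itself. *)
rewrite (@cprI _ _ (anc u) [set inl u; inr (k :: u)]) //.
- rewrite IH (cprI b _ c1 c2); last by move=> _ ->.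
  have -> := cpr_N u k b; have -> := cpr_S (k :: u) s b.
  rewrite /= eqSS; case: eqP => _; last by rewrite mul0r.
  by rewrite /tails /weight1 !big_cons; ring.
- by case=> w /= /andP[wu wn] [] // [e]; move: wu wn;
    rewrite e ?eqxx // => /size_suffix /=; lia.
- exact: (@cyl_path H u [set p] cH).
- apply: cylI; [apply: cylS c1|apply: cylS c2] => j ->; [by left|by right].
Qed.

End BranchingWalk.

(** * Expected numbers of stopped particles *)

Section EsumExtra.
Variable R : realType.
Local Open Scope ereal_scope.

Lemma esum_swap (I J : choiceType) (A : set I) (B : set J) (a : I -> J -> \bar R) :
  (forall i j, 0 <= a i j) ->
  \esum_(i in A) \esum_(j in B) a i j = \esum_(j in B) \esum_(i in A) a i j.
Proof.
move=> a0; rewrite !esum_esum //.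
rewrite (reindex_esum (B `*`` (fun=> A)) _ (fun x => (x.2, x.1))) //; split=> //=.
- by move=> [i j] [].
- by move=> [i1 i2] [j1 j2] /= _ _ [] -> ->.
- by move=> [i1 i2] [? ?] /=; exists (i2, i1).
Qed.

Lemma esumZl (I : choiceType) (A : set I) (a : I -> \bar R) (c : R) :
  (0 <= c)%R -> (forall i, 0 <= a i) ->
  \esum_(i in A) (c%:E * a i) = c%:E * \esum_(i in A) a i.
Proof.
move=> c0 a0.
have le (b : I -> \bar R) (k : R) : (0 <= k)%R -> (forall i, 0 <= b i) ->
    \esum_(i in A) (k%:E * b i) <= k%:E * \esum_(i in A) b i.
  move=> k0 b0; apply: ge_ereal_sup => _ [X [fX XA] <-].
  rewrite !fsbig_finite //= -ge0_sume_distrr //.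
  apply: lee_pmul => //; first by rewrite sume_ge0.
  by rewrite -fsbig_finite //; apply: ereal_sup_ubound; exists X.
apply/eqP; rewrite eq_le le //=.
have [->|cn0] := eqVneq c 0%R.
  by rewrite mul0e esum_ge0 // => i _; rewrite mul0e.
have cE : \esum_(i in A) a i = \esum_(i in A) ((c^-1)%:E * (c%:E * a i)).
  by apply: eq_esum => i _; rewrite muleA -EFinM mulVf // mul1e.
rewrite cE.
apply: (@le_trans _ _ (c%:E * ((c^-1)%:E * \esum_(i in A) (c%:E * a i)))).
  apply: lee_pmul => //; first by apply: esum_ge0 => i _;
    rewrite !mule_ge0 ?lee_fin ?invr_ge0.
  by apply: le; rewrite ?invr_ge0 // => i; rewrite mule_ge0.
by rewrite muleA -EFinM mulfV // mul1e.
Qed.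

Lemma esum_seqS (X : choiceType) (n : nat) (a : seq X -> \bar R) :
  (forall u, 0 <= a u) ->
  \esum_(u in [set u | size u = n.+1]) a u =
  \esum_(k in [set: X]) \esum_(u in [set u | size u = n]) a (k :: u).
Proof.
move=> a0; rewrite esum_esum //.
apply: (reindex_esum _ _ (fun x : X * seq X => x.1 :: x.2)); split.
- by move=> [k u] [_ /= ->].
- by move=> [k u] [k' u'] _ _ /= [-> ->].
- by case=> [|k u] //= [e]; exists (k, u).
Qed.

Lemma esum_prod_size (X : choiceType) (f : X -> R) (l : R) (n : nat) :
  (forall x, 0 <= f x)%R -> \esum_(x in [set: X]) (f x)%:E = l%:E ->
  \esum_(u in [set u : seq X | size u = n]) (\prod_(k <- u) f k)%:E = (l ^+ n)%:E.
Proof.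
move=> f0 fl; have p0 (u : seq X) : 0 <= (\prod_(k <- u) f k)%:E.
  by rewrite lee_fin prodr_ge0.
elim: n => [|n IH].
  rewrite (_ : [set u | _] = [set [::]]); last first.
    by rewrite predeqE => u; split=> [/size0nil|->].
  by rewrite esum_set1 // big_nil expr0.
rewrite esum_seqS //.
transitivity (\esum_(k in [set: X]) ((l ^+ n)%:E * (f k)%:E)).
  apply: eq_esum => k _; rewrite muleC -IH -esumZl //.
  by apply: eq_esum => u _; rewrite big_cons EFinM.
rewrite esumZl ?fl -?EFinM; first by rewrite exprSr.
  by apply: exprn_ge0; rewrite -lee_fin -fl; apply: esum_ge0 => x _; rewrite lee_fin.
by move=> x; rewrite lee_fin.
Qed.

End EsumExtra.

Section ManyToOne.
Context d (T : measurableType d) (R : realType) (P : probability T R).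
Variables (H : groupType) (m : H -> R) (nu : probability nat R).
Hypothesis cH : countable [set: H].
Local Notation brw := (branching_random_walk P m nu).
Local Notation config := (forall j : brw_index, brw_value H j).

(** The generating function of a set of paths. For all paths from 1 to 1 it is G(e,e|z), for the
    first hits of Gamma_i^x it is xi_i(z). *)
Definition weight (z : R) (L : set (seq H)) : \bar R :=
  (\esum_(p in L) (z ^+ size p * weight1 m p)%:E)%E.

(** For a fixed path of length n the sum over all labels of length n factors into the n-th power of
    the sum of the tails, that is lambda^n; exchanging the two sums gives the claim. *)
Lemma many_to_one N S lambda (L : set (seq H)) : brw N S ->
  (\esum_(k in [set: nat]) (tail nu k)%:E = lambda%:E)%E ->
  (\esum_(u in [set: seq nat])
    (cpr P N S [set c | calive c u /\ L (csteps c u)])%:E = weight lambda L)%E.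
Proof.
move=> b tl.
have l0 : 0 <= lambda.
  by rewrite -lee_fin -tl; apply: esum_ge0 => k _; rewrite lee_fin tail_ge0.
transitivity (\esum_(u in [set: seq nat]) \esum_(p in L)
  (if size p == size u then tails nu u * weight1 m p else 0)%:E)%E.
  apply: eq_esum => u _.
  have e : [set c : config | calive c u /\ L (csteps c u)] =
      \bigcup_(p in L) [set c | calive c u /\ csteps c u = p].
    rewrite predeqE => c; split=> [[cu Lc]|[p Lp [cu e]]]; last by rewrite /= e.
    by exists (csteps c u).
  rewrite e /cpr preimage_bigcup pr_bigcup.
  - by apply: eq_esum => p _; rewrite -(cpr_path cH u p b).
  - exact: countable_seq.
  - by move=> p _; apply: (conf_measurable b); exact: (@cyl_path H u [set p] cH).
  - by move=> p q _ _ [t [[_ <-] [_ <-]]].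
rewrite esum_swap; last first.
  move=> u p; case: ifP => _ //; rewrite lee_fin mulr_ge0 ?tails_ge0 //.
  exact: weight1_ge0 b.
apply: eq_esum => p _.
transitivity (\esum_(u in [set u : seq nat | size u = size p])
    ((weight1 m p)%:E * (tails nu u)%:E))%E.
  rewrite [RHS]esum_mkcond; apply: eq_esum => u _.
  have [pu|pu] := eqVneq (size p) (size u).
    by rewrite mem_set // -EFinM mulrC.
  by rewrite memNset // => up; rewrite up eqxx in pu.
rewrite esumZl; [|exact: weight1_ge0 b|by move=> u; rewrite lee_fin tails_ge0].
by rewrite (esum_prod_size (size p) (tail_ge0 nu) tl) EFinM muleC.
Qed.

End ManyToOne.

(** * Extinction and survival of stopped particles *)

Section Survival.
Variables (H : groupType) (B : set H).
Local Notation config := (forall j : brw_index, brw_value H j).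

Definition frozen (u : seq nat) : set config :=
  [set c | calive c u /\ first_hit B (csteps c u)].

(** The process of stopped particles reaches generation [n]. Splitting off the first generation,
    rather than the last, leaves the event of generation [n'] in a subtree, independent of the
    history of its root. *)
Fixpoint surv (n : nat) : set config :=
  if n is n'.+1 then \bigcup_u (frozen u `&` cshift u @^-1` surv n') else setT.

Definition surv_oo : set config := \bigcap_n surv n.

Hypothesis cH : countable [set: H].

Lemma cyl_frozen u : cyl (anc u) (frozen u).
Proof. exact: (@cyl_path H u _ cH). Qed.

Lemma cyl_frozen_shift u E :
  cyl (desc [::]) E -> cyl (desc [::]) (frozen u `&` cshift u @^-1` E).
Proof.
move=> cE; apply: cylI.
  by apply: cylS (cyl_frozen (u := u)) => j; exact: anc_desc0.
by apply: cylS (@cyl_shift_desc H u _ cE) => j; exact: desc_desc0.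
Qed.

Lemma cyl_surv n : cyl (desc [::]) (surv n).
Proof.
elim: n => [|n IH] /=; first exact: cylT.
apply: cyl_countable => [|u _]; first exact: countableP.
exact: cyl_frozen_shift.
Qed.

Lemma cyl_surv_oo : cyl (desc [::]) surv_oo.
Proof. by apply: cyl_bigcap => [|n _]; [exact: countableP|exact: cyl_surv]. Qed.

Lemma surv_nonincr n : surv n.+1 `<=` surv n.
Proof.
elim: n => [//|n IH] c [u _ [fu su]]; exists u => //; split=> //; exact: IH.
Qed.

(** Stopped labels form an antichain, since a proper descendant of a stopped particle is not at its
    first hit. Hence distinct stopped particles have disjoint subtrees. *)
Lemma frozen_incomp c u v : frozen u c -> frozen v c -> suffix u v -> u = v.
Proof.
move=> [_ [u0 Bu _]] [_ [_ _ hv]] /suffixP[w e].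
have [w0|w0] := eqVneq w [::]; first by rewrite e w0.
have [] := hv (csteps (cshift u c) w) (csteps c u).
- by rewrite e csteps_cat.
- by rewrite -size_eq0 size_csteps size_eq0.
- by [].
- by [].
Qed.

End Survival.

Lemma anc_desc_disj u v j : ~~ suffix v u -> anc u j -> ~ desc v j.
Proof.
move=> vu; case: j => w /= /andP[wu _].
  by move=> vw; move: vu; rewrite (suffix_trans vw wu).
by move=> /andP[vw _]; move: vu; rewrite (suffix_trans vw wu).
Qed.

Lemma no_uniform_decrease (R : realType) (q : nat -> R) (e : R) : 0 < e ->
  (forall n, 0 <= q n) -> (forall n, q n.+1 <= q n - e) -> False.
Proof.
move=> e0 q0 qS.
have qn n : q n <= q 0%N - n%:R * e.
  elim: n => [|n IH]; first by rewrite mul0r subr0.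
  by rewrite (le_trans (qS n)) // -natr1; lra.
have [n nq] : exists n : nat, q 0%N / e < n%:R.
  by exists (Num.truncn (q 0%N / e)).+1; rewrite truncnS_gt.
have := q0 n; have := qn n; rewrite ltr_pdivrMr // in nq.
lra.
Qed.

(** Below the threshold (M - 1) / K the recursion gives [q n <= q n.+1], so the sequence cannot
    decrease any further once it is there. *)
Lemma quadratic_lower_bound (R : realType) (q : nat -> R) (M K : R) :
  1 < M -> 0 < K -> (forall n, 0 < q n) -> (forall n, q n.+1 <= q n) ->
  (forall n, M * q n - K * q n ^+ 2 <= q n.+1) ->
  exists2 e, 0 < e & forall n, e <= q n.
Proof.
move=> M1 K0 q0 qle qge.
have mono i j : (i <= j)%N -> q j <= q i.
  by move=> /subnK <-; elim: (j - i)%N => // k IH; rewrite addSn (le_trans (qle _)).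
have [h|/existsNP[n0 /negP]] := pselect (forall n, (M - 1) / K <= q n).
  by exists ((M - 1) / K) => //; rewrite divr_gt0 // subr_gt0.
rewrite -ltNge => hn0; exists (q n0) => // n.
have [le|/ltnW /subnK <-] := leqP n n0; first exact: mono.
elim: (n - n0)%N => // k IH; rewrite addSn.
apply: (le_trans IH); apply: le_trans (qge _).
have qk : q (k + n0)%N <= (M - 1) / K.
  by apply: (le_trans (mono _ _ (leq_addl k n0))); exact: ltW.
rewrite ler_pdivlMr // in qk; have := q0 (k + n0)%N; nra.
Qed.

Section SurvivalProbability.
Context d (T : measurableType d) (R : realType) (P : probability T R).
Variables (H : groupType) (m : H -> R) (nu : probability nat R).
Hypothesis cH : countable [set: H].
Local Notation brw := (branching_random_walk P m nu).
Local Notation config := (forall j : brw_index, brw_value H j).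
Variables (N : seq nat -> T -> nat) (S : seq nat -> T -> H) (B : set H).
Hypothesis b : brw N S.
Local Notation Pc := (cpr P N S).

Lemma cpr_le K K' E E' : cyl K E -> cyl K' E' -> E `<=` E' -> Pc E <= Pc E'.
Proof.
move=> cE cE' EE'; apply: pr_le; [exact: (conf_measurable b cE)|
  exact: (conf_measurable b cE')|].
by move=> t; exact: EE'.
Qed.

Lemma cpr_frozen_shift u E : cyl (desc [::]) E ->
  Pc (frozen B u `&` cshift u @^-1` E) = Pc (frozen B u) * Pc E.
Proof.
move=> cE; rewrite (cprI b (@desc_anc u) (@cyl_frozen H B cH u)
  (@cyl_shift_desc H u _ cE)).
by rewrite (cpr_shift cH u b cE).
Qed.

Lemma cpr_shift2 u v E : cyl (desc [::]) E -> ~~ suffix u v -> ~~ suffix v u ->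
  Pc (cshift u @^-1` E `&` cshift v @^-1` E) = Pc E ^+ 2.
Proof.
move=> cE uv vu; rewrite (cprI b (fun j => @desc_disj u v j uv vu)
  (@cyl_shift_desc H u _ cE) (@cyl_shift_desc H v _ cE)).
by rewrite !(cpr_shift cH _ b cE) expr2.
Qed.

(** The histories of [u] and [v] share ancestors and are not independent, so their joint probability
    stays one factor; only the two subtrees split off. *)
Lemma cpr_frozen_shift2 u v E : cyl (desc [::]) E ->
  ~~ suffix u v -> ~~ suffix v u ->
  Pc ((frozen B u `&` cshift u @^-1` E) `&` (frozen B v `&` cshift v @^-1` E)) =
  Pc (frozen B u `&` frozen B v) * Pc E ^+ 2.
Proof.
move=> cE uv vu; rewrite setIACA -(cpr_shift2 cE uv vu).
apply: (cprI (K1 := anc u `|` anc v) (K2 := desc u `|` desc v) b).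
- move=> j [ju|jv] [|]; [exact: desc_anc|exact: anc_desc_disj vu ju|
    exact: anc_desc_disj uv jv|exact: desc_anc].
- apply: cylI; [apply: cylS (@cyl_frozen H B cH u)|
    apply: cylS (@cyl_frozen H B cH v)] => j ?; [by left|by right].
- apply: cylI; [apply: cylS (@cyl_shift_desc H u _ cE)|
    apply: cylS (@cyl_shift_desc H v _ cE)] => j ?; [by left|by right].
Qed.

Lemma bigcup_seq_cons (A : seq nat -> set T) x (X : seq (seq nat)) :
  \bigcup_(u in [set` x :: X]) A u = A x `|` \bigcup_(u in [set` X]) A u.
Proof.
rewrite predeqE => t; split=> [[u /=]|[Ax|[u /= uX' Au]]].
- by rewrite inE => /orP[/eqP ->|uX' Au]; [left|right; exists u].
- by exists x => //=; rewrite inE eqxx.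
- by exists u => //=; rewrite inE uX' orbT.
Qed.

Lemma measurable_bigcup_seq (A : seq nat -> set T) (X : seq (seq nat)) :
  (forall u, measurable (A u)) -> measurable (\bigcup_(u in [set` X]) A u).
Proof.
by move=> mA; apply: fin_bigcup_measurable => [|u _]; [exact: finite_seq|exact: mA].
Qed.

Lemma pr_seq_bigcup_le (A : seq nat -> set T) (X : seq (seq nat)) (e : R) :
  (forall u, measurable (A u)) -> (forall u, u \in X -> pr P (A u) <= e) ->
  pr P (\bigcup_(u in [set` X]) A u) <= (size X)%:R * e.
Proof.
move=> mA; elim: X => [|x X IH] h.
  by rewrite (_ : bigcup _ _ = set0) ?pr_set0 ?mul0r // predeqE => t; split=> // -[].
rewrite bigcup_seq_cons (le_trans (prU_le _ _ _)) //.
  exact: measurable_bigcup_seq.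
rewrite /= -natr1 mulrDl mul1r addrC lerD // ?IH // => [u uX|];
  by apply: h; rewrite inE ?uX ?eqxx ?orbT.
Qed.

(** The number of pairs is replaced by the square of the size, which is all that the recursion for
    survival needs. *)
Lemma pr_bonferroni (A : seq nat -> set T) (X : seq (seq nat)) (e : R) :
  uniq X -> (forall u, measurable (A u)) ->
  (forall u v, u != v -> pr P (A u `&` A v) <= e) -> 0 <= e ->
  \sum_(u <- X) pr P (A u) - (size X)%:R ^+ 2 * e <=
    pr P (\bigcup_(u in [set` X]) A u).
Proof.
move=> + mA Ae e0; elim: X => [|x X IH] /=.
  by rewrite big_nil !expr2 !mul0r subr0 pr_ge0.
move=> /andP[xX uX]; have {}IH := IH uX.
have mX := measurable_bigcup_seq X mA.
rewrite bigcup_seq_cons big_cons prU //.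
have le : pr P (A x `&` \bigcup_(u in [set` X]) A u) <= (size X)%:R * e.
  rewrite setI_bigcupr; apply: pr_seq_bigcup_le => u.
    exact: measurableI.
  by move=> uX'; apply: Ae; apply: contraNneq xX => ->.
rewrite -natr1; have n0 := ler0n R (size X); nra.
Qed.

(* With q n the probability of reaching generation n, the union bound corrected
   by one pair u, v gives [q n.+1 <= phi * q n - e * q n ^+ 2]. *)
Lemma extinction (phi : R) :
  (\esum_(u in [set: seq nat]) (Pc (frozen B u))%:E = phi%:E)%E -> phi <= 1 ->
  phi < 1 \/ (exists u v, [/\ ~~ suffix u v, ~~ suffix v u &
    0 < Pc (frozen B u `&` frozen B v)]) ->
  Pc (surv_oo B) = 0.
Proof.
move=> phiE phi1 cond; apply/eqP; rewrite eq_le cpr_ge0 andbT leNgt.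
(* If the survival probability [l] were positive, then [l <= q n] would make each generation lose at
   least a fixed amount, [(1 - phi) * l] or [e * l ^+ 2], while [q] stays nonnegative. *)
apply/negP => l0; set l := Pc (surv_oo B) in l0.
pose q n := Pc (surv B n).
have lq n : l <= q n.
  by apply: cpr_le; [exact: cyl_surv_oo|exact: cyl_surv|move=> c /(_ n); exact].
pose A n u := frozen B u `&` cshift u @^-1` surv B n.
have cA n u : cyl (desc [::]) (A n u) by apply: cyl_frozen_shift => //; exact: cyl_surv.
have mA n u := conf_measurable b (cA n u).
have PA n u : Pc (A n u) = Pc (frozen B u) * q n.
  by apply: cpr_frozen_shift; exact: cyl_surv.
have q0 n : 0 <= q n by exact: cpr_ge0.
have bound n (D : set (seq nat)) :
    ((Pc (\bigcup_(u in D) A n u))%:E <=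
    (q n)%:E * \esum_(u in D) (Pc (frozen B u))%:E)%E.
  rewrite /cpr preimage_bigcup; apply: (le_trans (pr_bigcup_le _ _ _)) => //.
    exact: countableP.
  rewrite -esumZl //; last by move=> u; rewrite lee_fin cpr_ge0.
  by apply: le_esum => u _; rewrite -EFinM lee_fin mulrC -PA.
have [phi_lt|[u [v [uv vu Puv]]]] := cond.
  apply: (@no_uniform_decrease _ q ((1 - phi) * l)) => //.
    by rewrite mulr_gt0 // subr_gt0.
  move=> n; have := bound n setT; rewrite phiE -EFinM lee_fin => h.
  apply: (le_trans h); have := lq n; nra.
pose e := Pc (frozen B u `&` frozen B v).
apply: (@no_uniform_decrease _ q (e * l ^+ 2)) => //.
  by rewrite mulr_gt0 // exprn_gt0.
move=> n.
have uvn : u != v by apply: contraNneq uv => ->; exact: suffix_refl.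
pose D := [set w | w <> u /\ w <> v].
have split_sum : (phi%:E = (Pc (frozen B u) + Pc (frozen B v))%:E +
    \esum_(w in D) (Pc (frozen B w))%:E)%E.
  rewrite -phiE (esumID [set u; v]) //; last by move=> *; rewrite lee_fin cpr_ge0.
  rewrite !setTI; congr (_ + _)%E; last first.
    by congr esum; rewrite predeqE => w; split=> [/not_orP|[wu wv] []].
  rewrite esum_fset; [|exact: finite_set2|by move=> *; rewrite lee_fin cpr_ge0].
  by rewrite fsbigU0 ?fsbig_set1 //= => w [-> wv]; move: uvn; rewrite wv eqxx.
have [f fE] : exists f, (\esum_(w in D) (Pc (frozen B w))%:E = f%:E)%E.
  exists (phi - (Pc (frozen B u) + Pc (frozen B v))).
  by rewrite EFinB split_sum addeAC subee // add0e.
move: split_sum; rewrite fE -EFinD => -[split_sum].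
have eqU : surv B n.+1 = (A n u `|` A n v) `|` \bigcup_(w in D) A n w.
  rewrite predeqE => c; split=> [[w _ Aw]|[[Au|Av]|[w _ Aw]]];
    [|by exists u|by exists v|by exists w].
  have [wu|wu] := eqVneq w u; first by left; left; rewrite -wu.
  have [wv|wv] := eqVneq w v; first by left; right; rewrite -wv.
  by right; exists w => //; split; apply/eqP.
have h1 : q n.+1 <= Pc (A n u `|` A n v) + Pc (\bigcup_(w in D) A n w).
  rewrite /q eqU; apply: prU_le.
    by apply: (conf_measurable b); exact: cylU (cA n u) (cA n v).
  apply: (conf_measurable (K := desc [::]) b); apply: cyl_countable => //.
  exact: countableP.
have h2 : Pc (A n u `|` A n v) =
    Pc (frozen B u) * q n + Pc (frozen B v) * q n - e * q n ^+ 2.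
  rewrite /cpr preimage_setU prU // -!/(cpr _ _ _ _) !PA.
  by rewrite -cpr_frozen_shift2 //; exact: cyl_surv.
have := bound n D; rewrite fE -EFinM lee_fin => h3.
have h4 : l ^+ 2 <= q n ^+ 2.
  by rewrite ler_pXn2r ?nnegrE ?lq ?cpr_ge0.
have e0 : 0 < e by [].
apply: (le_trans h1); rewrite h2.
have h5 : e * l ^+ 2 <= e * q n ^+ 2 by rewrite ler_pM2l.
have h6 : phi * q n <= q n by rewrite ler_piMl.
move: h3; rewrite mulrC => h3.
move: h6; rewrite split_sum !mulrDl; lra.
Qed.

End SurvivalProbability.

(** * Survival above mean one, and pairs of particles stopped together *)

Section Criterion.
Context d (T : measurableType d) (R : realType) (P : probability T R).
Variables (H : groupType) (m : H -> R) (nu : probability nat R).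
Hypothesis cH : countable [set: H].
Local Notation brw := (branching_random_walk P m nu).
Local Notation config := (forall j : brw_index, brw_value H j).
Variables (N : seq nat -> T -> nat) (S : seq nat -> T -> H).
Hypothesis b : brw N S.
Local Notation Pc := (cpr P N S).

Lemma pr_bigcap_ge (F : nat -> set T) (e : R) :
  (forall n, measurable (F n)) -> (forall n, F n.+1 `<=` F n) ->
  (forall n, e <= pr P (F n)) -> e <= pr P (\bigcap_n F n).
Proof.
move=> mF FS eF.
have mI : measurable (\bigcap_n F n) by exact: bigcapT_measurable.
have cv : P (F n) @[n --> \oo] --> P (\bigcap_n F n).
  apply: (@nonincreasing_cvg_mu _ _ _ P) => //.
    by rewrite (le_lt_trans (probability_le1 P _)) ?ltry.
  move=> i j ij; apply/subsetPset; move: ij => /subnK <-.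
  by elim: (j - i)%N => // k IH; rewrite addSn; exact: subset_trans (FS _) IH.
rewrite -lee_fin -prE //.
rewrite -(cvg_lim _ cv) //; apply: lime_ge; first by apply/cvg_ex; eexists; exact: cv.
by apply: nearW => n; rewrite prE // lee_fin.
Qed.

(* A finite set of labels already carries mean M > 1, and the Bonferroni
   inequality gives [M * q n - K * q n ^+ 2 <= q n.+1]. *)
Lemma supercritical (B : set H) :
  (1 < \esum_(u in [set: seq nat]) (Pc (frozen B u))%:E)%E ->
  0 < Pc (surv_oo B).
Proof.
move=> /ereal_sup_gt[_ [X [fX _] <-]].
rewrite fsbig_finite //= sumEFin lte_fin.
have uX : uniq (finmap.enum_fset (fset_set X)) by exact: finmap.fset_uniq.
move: uX; set X' : seq (seq nat) := finmap.enum_fset _ => uX.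
set M := \sum_(u <- X') _ => M1.
pose q n := Pc (surv B n).
pose A n u := frozen B u `&` cshift u @^-1` surv B n.
have cA n u : cyl (desc [::]) (A n u) by apply: cyl_frozen_shift => //; exact: cyl_surv.
have mA n u := conf_measurable b (cA n u).
have PA n u : Pc (A n u) = Pc (frozen B u) * q n.
  by apply: (cpr_frozen_shift cH B b); exact: cyl_surv.
have q0 n : 0 <= q n by exact: cpr_ge0.
have [w wP] : exists w, 0 < Pc (frozen B w).
  apply/not_existsP => h; have : M <= 0.
    by apply: sumr_le0 => u _; rewrite leNgt; apply/negP => /(h u).
  lra.
have qA n u : Pc (A n u) <= q n.+1.
  by apply: (cpr_le b (cA n u) (cyl_surv B cH n.+1)) => c Ac; exists u.
have qS n : q n.+1 <= q n.
  by apply: (cpr_le b (cyl_surv B cH _) (cyl_surv B cH _)); exact: surv_nonincr.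
have qpos n : 0 < q n.
  elim: n => [|n IH]; first by rewrite /q /cpr preimage_setT pr_setT.
  by apply: lt_le_trans (qA n w); rewrite PA mulr_gt0.
(* Comparable labels are never stopped together; for incomparable ones the two subtrees contribute
   [q n ^+ 2], and the joint history at most 1. *)
have A2 n u v : u != v -> Pc (A n u `&` A n v) <= q n ^+ 2.
  move=> uv.
  have [uv'|uv'] := boolP (suffix u v).
    rewrite (_ : A n u `&` A n v = set0) ?/cpr ?preimage_set0 ?pr_set0 ?sqr_ge0 //.
    rewrite predeqE => c; split=> // -[[fu _] [fv _]].
    by move: uv; rewrite (frozen_incomp fu fv uv') eqxx.
  have [vu|vu] := boolP (suffix v u).
    rewrite (_ : A n u `&` A n v = set0) ?/cpr ?preimage_set0 ?pr_set0 ?sqr_ge0 //.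
    rewrite predeqE => c; split=> // -[[fu _] [fv _]].
    by move: uv; rewrite (frozen_incomp fv fu vu) eqxx.
  rewrite (cpr_frozen_shift2 cH B b (cyl_surv B cH n) uv' vu).
  rewrite ler_piMl ?sqr_ge0 //; apply: pr_le1.
  by apply: measurableI; [exact: (conf_measurable b (@cyl_frozen H B cH u))|
    exact: (conf_measurable b (@cyl_frozen H B cH v))].
have step n : M * q n - (size X')%:R ^+ 2 * q n ^+ 2 <= q n.+1.
  have -> : M * q n = \sum_(u <- X') Pc (A n u).
    by rewrite mulr_suml; apply: eq_bigr => u _; rewrite PA.
  apply: (le_trans (pr_bonferroni (A := fun u => conf_of (brw_variable N S) @^-1` A n u)
    uX (mA n) (fun u v uv => A2 n u v uv) (sqr_ge0 _))).
  rewrite -preimage_bigcup.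
  apply: (cpr_le b (K := desc [::]) (K' := desc [::]) _ (cyl_surv B cH n.+1)).
    by apply: cyl_countable => //; exact: countableP.
  by move=> c [u _ Au]; exists u.
have X0 : 0 < (size X')%:R ^+ 2 :> R.
  rewrite exprn_gt0 // ltr0n lt0n; apply/eqP => /size0nil e.
  by move: M1; rewrite /M e big_nil; lra.
have [e e0 eq] := quadratic_lower_bound M1 X0 qpos qS step.
apply: (lt_le_trans e0); rewrite /cpr /surv_oo preimage_bigcap.
apply: pr_bigcap_ge => [n|n t|//].
  exact: (conf_measurable b (cyl_surv B cH n)).
exact: surv_nonincr.
Qed.

(** Serves two purposes: it doubles a path at the root to stop two particles at once
    ([frozen_pair]), and with [E0 = setT] it is a single trial at one generation of the leftmost
    line. *)
Definition block v (A : set H) (E0 E1 : set config) : set config :=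
  ([set c : config | (1 < (c (inl v) : nat))%N] `&`
   ([set c : config | A (c (inr (0%N :: v)))] `&`
    [set c : config | A (c (inr (1%N :: v)))])) `&`
  (cshift (0%N :: v) @^-1` E0 `&` cshift (1%N :: v) @^-1` E1).

Definition stepl (A : set H) : R := pr P (S [::] @^-1` A).

Lemma cpr_S_in u (A : set H) :
  Pc [set c : config | A (c (inr u))] = stepl A.
Proof.
apply: EFin_inj; rewrite /cpr /stepl.
have := brw_S cH [::] A b; have := brw_S cH u A b.
by move=> <- <-.
Qed.

Lemma incomp01 v : ~~ suffix (0%N :: v) (1%N :: v) /\ ~~ suffix (1%N :: v) (0%N :: v).
Proof.
by split; apply/negP => h; have := @suffix_size_eq _ _ h (leqnn _).
Qed.

Lemma cpr_block v A E0 E1 : cyl (desc [::]) E0 -> cyl (desc [::]) E1 ->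
  Pc (block v A E0 E1) = tail nu 1 * stepl A ^+ 2 * Pc E0 * Pc E1.
Proof.
move=> c0 c1.
have cN : cyl [set inl v : brw_index] [set c : config | (1 < (c (inl v) : nat))%N].
  exact: (@cyl_coord _ _ _ (inl v) [set n : nat | (1 < n)%N]).
have cS k : cyl [set inr (k :: v) : brw_index] [set c : config | A (c (inr (k :: v)))].
  exact: (@cyl_coord _ _ _ (inr (k :: v)) A).
have [i01 i10] := incomp01 v.
have cSS : cyl [set inr (0%N :: v); inr (1%N :: v)]
    ([set c : config | A (c (inr (0%N :: v)))] `&`
     [set c : config | A (c (inr (1%N :: v)))]).
  by apply: cylI; [apply: cylS (cS 0%N)|apply: cylS (cS 1%N)] => j ->; [left|right].
have cD k (E : set config) :
    cyl (desc [::]) E -> cyl (desc (k :: v)) (cshift (k :: v) @^-1` E).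
  exact: cyl_shift_desc.
rewrite /block.
rewrite (cprI b (K1 := [set inl v; inr (0%N :: v); inr (1%N :: v)])
  (K2 := desc (0%N :: v) `|` desc (1%N :: v))).
- rewrite (cprI b (fun j => @desc_disj _ _ j i01 i10) (cD _ _ c0) (cD _ _ c1)).
  rewrite !(cpr_shift cH _ b c0) !(cpr_shift cH _ b c1).
  rewrite (cprI b _ cN cSS); last by move=> _ -> [].
  rewrite (cprI b _ (cS 0%N) (cS 1%N)); last by move=> _ ->.
  by rewrite (cpr_N v 1 b) !cpr_S_in expr2; ring.
- move=> _ [[|]|] -> [|] /=.
  + by move=> /size_suffix /=; lia.
  + by move=> /size_suffix /=; lia.
  + by rewrite eqxx andbF.
  + by move=> /andP[/(negP i10)].
  + by move=> /andP[/(negP i01)].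
  + by rewrite eqxx andbF.
- apply: cylI; first by apply: cylS cN => _ ->; left; left.
  by apply: cylS cSS => _ [] ->; [left; right|right].
- by apply: cylI; [apply: cylS (cD _ _ c0)|apply: cylS (cD _ _ c1)] => j ?; [left|right].
Qed.

Lemma cyl_block v A E0 E1 : cyl (desc [::]) E0 -> cyl (desc [::]) E1 ->
  cyl (desc [::]) (block v A E0 E1).
Proof.
move=> c0 c1; apply: cylI; last first.
  by apply: cylI; [apply: cylS (@cyl_shift_desc H (0%N :: v) _ c0)|
    apply: cylS (@cyl_shift_desc H (1%N :: v) _ c1)] => j; exact: desc_desc0.
apply: cylI.
  apply: (@cyl_coord _ _ _ (inl v) [set n : nat | (1 < n)%N]) => /=.
  by rewrite suffix0s.
apply: cylI.
  by apply: (@cyl_coord _ _ _ (inr (0%N :: v)) A); rewrite /= suffix0s.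
by apply: (@cyl_coord _ _ _ (inr (1%N :: v)) A); rewrite /= suffix0s.
Qed.

Lemma tail_nonincr k : tail nu k.+1 <= tail nu k.
Proof. by apply: pr_le => // j /=; lia. Qed.

(** Some word [p] of positive weight first hits [B] at its end. Both children of the root can follow
    this same word, each along its own leftmost descendants, and their labels are incomparable. *)
Lemma frozen_pair (B : set H) u : 0 < tail nu 1 -> 0 < Pc (frozen B u) ->
  exists v w, [/\ ~~ suffix v w, ~~ suffix w v &
    0 < Pc (frozen B v `&` frozen B w)].
Proof.
move=> t1 Pu.
have [p [pu Bp Wp]] : exists p, [/\ size p = size u, first_hit B p &
    0 < weight1 m p].
  apply/not_existsP => h; suff : Pc (frozen B u) <= 0 by lra.
  rewrite -lee_fin /cpr.
  have -> : frozen B u = \bigcup_(p in first_hit B)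
      [set c | calive c u /\ csteps c u = p].
    rewrite predeqE => c; split=> [[cu Lc]|[p Lp [cu e]]]; last by rewrite /frozen /= e.
    by exists (csteps c u).
  rewrite preimage_bigcup; apply: (le_trans (pr_bigcup_le _ _ _)).
  - exact: countable_seq.
  - by move=> p _; apply: (conf_measurable b); exact: (@cyl_path H u [set p] cH).
  rewrite esum1 // => p Bp; congr (_%:E).
  have := cpr_path cH u p b; rewrite /cpr => ->; case: eqP => // pu.
  have := weight1_ge0 p b; rewrite le_eqVlt => /orP[/eqP <-|Wp].
    by rewrite mulr0.
  by case: (h p).
(* Words list the most recent step first, so the last letter [s] of [p] is the first step of the
   path; both children of the root make it, and [q] is left for their subtrees. *)
have [q [s pE]] : exists q s, p = rcons q s.
  by case/lastP: p Bp {pu Wp} => [[]//|q s _]; exists q, s.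
pose z := nseq (size q) 0%N.
have t0 : 0 < tail nu 0 by exact: lt_le_trans t1 (tail_nonincr 0).
pose E := [set c : config | calive c z /\ csteps c z = q].
have cE : cyl (desc [::]) E.
  apply: cylS (@cyl_path H z [set q] cH) => j; exact: anc_desc0.
have PE : 0 < Pc E.
  rewrite (cpr_path cH z q b) size_nseq eqxx.
  rewrite mulr_gt0 //.
    rewrite /tails /z; elim: (size q) => [|k IH] /=; first by rewrite big_nil.
    by rewrite big_cons mulr_gt0.
  move: Wp; rewrite pE /weight1 -cats1 big_cat /= => h.
  have := weight1_ge0 q b; rewrite le_eqVlt => /orP[/eqP e|//].
  by move: h; rewrite -/(weight1 m q) -e mul0r ltxx.
have PS : 0 < stepl [set s].
  have -> : stepl [set s] = m s.
    by rewrite -(cpr_S_in [::]) -(cpr_S [::] s b).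
  move: Wp; rewrite pE /weight1 -cats1 big_cat /= big_seq1 => h.
  have := brw_m_ge0 s b; rewrite le_eqVlt => /orP[/eqP e|//].
  by move: h; rewrite -e mulr0 ltxx.
exists (z ++ [:: 0%N]), (z ++ [:: 1%N]); split.
- by apply/negP => h; have := suffix_size_eq h; rewrite !size_cat leqnn => /(_ isT)
    /eqP; rewrite eqseq_cat // eqxx.
- by apply/negP => h; have := suffix_size_eq h; rewrite !size_cat leqnn => /(_ isT)
    /eqP; rewrite eqseq_cat // eqxx.
have PB := cpr_block [::] [set s] cE cE.
have PB0 : 0 < Pc (block [::] [set s] E E).
  by rewrite PB !mulr_gt0.
apply: (lt_le_trans PB0); apply: pr_le.
- exact: (conf_measurable b (cyl_block [::] [set s] cE cE)).
- apply: measurableI; exact: (conf_measurable b (@cyl_frozen H B cH _)).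
move=> t [[N2 [S0 S1]] [[a0 e0] [a1 e1]]].
split; split.
- rewrite calive_cat a0 /= andbT; move: N2 => /=; lia.
- by rewrite csteps_cat e0; move: Bp; rewrite pE -cats1 -S0.
- by rewrite calive_cat a1 /= andbT; move: N2 => /=; lia.
- by rewrite csteps_cat e1; move: Bp; rewrite pE -cats1 -S1.
Qed.

End Criterion.

(** * Almost sure statements over all labels *)

Section AlmostSure.
Context d (T : measurableType d) (R : realType) (P : probability T R).

Lemma ae_of_pr0 (A : set T) : measurable A -> pr P A = 0 ->
  \forall t \ae P, ~ A t.
Proof.
move=> mA A0; exists A; split=> //.
  by rewrite prE // A0.
by move=> t /=; rewrite not_notE.
Qed.

Lemma ae_forall_seq (F : seq nat -> T -> Prop) :
  (forall u, \forall t \ae P, F u t) -> \forall t \ae P, forall u, F u t.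
Proof.
move=> h.
have : \forall t \ae P, forall n, odflt True (omap (F ^~ t) (unpickle n)).
  apply/ae_foralln => n; case: (unpickle n) => [u|] /=; first exact: h.
  exact: aeW.
by apply: filterS => t ht u; have := ht (pickle u); rewrite pickleK.
Qed.

Lemma measurable_countable_bigcup (A : seq nat -> set T) D :
  (forall u, measurable (A u)) -> measurable (\bigcup_(u in D) A u).
Proof.
move=> mA; pose F n := if unpickle n is Some u then
  (if u \in D then A u else set0) else set0.
have -> : \bigcup_(u in D) A u = \bigcup_n F n.
  rewrite predeqE => t; split=> [[u Du Au]|[n _]].
    by exists (pickle u) => //; rewrite /F pickleK mem_set.
  by rewrite /F; case: (unpickle n) => // u; case: ifPn => // /[!inE] ? ?; exists u.
apply: bigcupT_measurable => n; rewrite /F.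
by case: (unpickle n) => // u; case: ifP.
Qed.

(** The first Borel-Cantelli lemma with labels as indices: outside a finite set of labels the
    probabilities sum to at most 1 / (n + 1), so infinitely many events occur with probability 0. *)
Lemma ae_finite (A : seq nat -> set T) : (forall u, measurable (A u)) ->
  (\esum_(u in [set: seq nat]) (pr P (A u))%:E < +oo)%E ->
  \forall t \ae P, finite_set [set u | A u t].
Proof.
move=> mA foo.
have s0 D : (0 <= \esum_(u in D) (pr P (A u))%:E)%E.
  by apply: esum_ge0 => u _; rewrite lee_fin pr_ge0.
have fin : (\esum_(u in [set: seq nat]) (pr P (A u))%:E)%E \is a fin_num.
  by rewrite ge0_fin_numE.
have /choice[X XP] n : exists X : set (seq nat), finite_set X /\
    (\esum_(u in ~` X) (pr P (A u))%:E <= (n.+1%:R^-1)%:E)%E.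
  have : (\esum_(u in [set: seq nat]) (pr P (A u))%:E - (n.+1%:R^-1)%:E <
      \esum_(u in [set: seq nat]) (pr P (A u))%:E)%E.
    by rewrite lteBlDr // lteDl // lte_fin invr_gt0 ltr0n.
  move=> /ereal_sup_gt[_ [X [fX _] <-]] h; exists X; split=> //.
  move: h; rewrite (esumID X) //; last by move=> *; rewrite lee_fin pr_ge0.
  rewrite !setTI (esum_fset fX); last by move=> *; rewrite lee_fin pr_ge0.
  rewrite fsbig_finite //= sumEFin.
  have : (\esum_(u in ~` X) (pr P (A u))%:E \is a fin_num)%E.
    rewrite ge0_fin_numE //; apply: le_lt_trans foo.
    rewrite (esumID X setT) //; last by move=> *; rewrite lee_fin pr_ge0.
    by rewrite !setTI leeDr.
  by move=> /fineK <-; rewrite -!EFinD lte_fin lee_fin; set c := n.+1%:R^-1;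
    set x := fine _; set y := \sum_(_ <- _) _; lra.
pose Bn n := \bigcup_(u in ~` X n) A u.
have mB n : measurable (Bn n) by exact: measurable_countable_bigcup.
have mI : measurable (\bigcap_n Bn n) by exact: bigcapT_measurable.
have Ble n : pr P (\bigcap_n Bn n) <= n.+1%:R^-1.
  apply: (@le_trans _ _ (pr P (Bn n))).
    by apply: pr_le => // t; apply.
  rewrite -lee_fin; have [_ h] := XP n; apply: le_trans h.
  by apply: pr_bigcup_le => //; exact: countableP.
have B0 : pr P (\bigcap_n Bn n) = 0.
  apply/eqP; rewrite eq_le pr_ge0 andbT leNgt; apply/negP => p0.
  set p := pr P _ in Ble p0.
  have := Ble (Num.truncn p^-1); rewrite leNgt => /negP; apply.
  rewrite -[ltRHS]invrK ltf_pV2 ?posrE ?invr_gt0 ?ltr0n //; exact: truncnS_gt.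
apply: filterS (ae_of_pr0 mI B0) => t nB.
apply: contrapT => inf; apply: nB => n _.
apply: contrapT => nBn; apply: inf; have [fX _] := XP n.
apply: sub_finite_set fX => u Au; apply: contrapT => nX.
by apply: nBn; exists u.
Qed.

End AlmostSure.

Section Extinction.
Context d (T : measurableType d) (R : realType) (P : probability T R).
Variables (H : groupType) (m : H -> R) (nu : probability nat R) (lambda : R).
Hypothesis cH : countable [set: H].
Hypothesis tl : (\esum_(k in [set: nat]) (tail nu k)%:E = lambda%:E)%E.
Local Notation brw := (branching_random_walk P m nu).
Local Notation config := (forall j : brw_index, brw_value H j).

Section OneWalk.
Variables (N : seq nat -> T -> nat) (S : seq nat -> T -> H).
Hypothesis b : brw N S.
Local Notation Pc := (cpr P N S).

Lemma expected_frozen (B : set H) :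
  (\esum_(u in [set: seq nat]) (Pc (frozen B u))%:E =
   weight m lambda (first_hit B))%E.
Proof. exact: (many_to_one cH (first_hit B) b tl). Qed.

Lemma surv_oo_eq0 (B : set H) : (weight m lambda (first_hit B) <= 1)%E ->
  (weight m lambda (first_hit B) < 1)%E \/ 0 < tail nu 1 ->
  Pc (surv_oo B) = 0.
Proof.
rewrite -expected_frozen => le1 cond.
have s0 : (0 <= \esum_(u in [set: seq nat]) (Pc (frozen B u))%:E)%E.
  by apply: esum_ge0 => u _; rewrite lee_fin cpr_ge0.
have [phi phiE] : exists phi,
    (\esum_(u in [set: seq nat]) (Pc (frozen B u))%:E = phi%:E)%E.
  exists (fine (\esum_(u in [set: seq nat]) (Pc (frozen B u))%:E)%E).
  by rewrite fineK // ge0_fin_numE // (le_lt_trans le1) ?ltry.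
apply: (extinction cH b phiE); first by rewrite -lee_fin -phiE.
have [phi_lt|phi_ge] := ltP phi 1; first by left.
right; case: cond => [|t1]; first by rewrite phiE lte_fin ltNge phi_ge.
have [u Pu] : exists u, 0 < Pc (frozen B u).
  apply/not_existsP => h.
  suff : phi%:E = 0%E by move=> [phi0]; move: phi_ge; rewrite phi0; lra.
  rewrite -phiE esum1 // => u _; congr (_%:E); apply/eqP.
  by rewrite eq_le cpr_ge0 andbT leNgt; apply/negP.
exact: (frozen_pair cH b t1 Pu).
Qed.

Lemma surv_oo_gt0 (B : set H) : (1 < weight m lambda (first_hit B))%E ->
  0 < Pc (surv_oo B).
Proof. by rewrite -expected_frozen; exact: (supercritical cH b). Qed.

Lemma ae_finite_frozen (B : set H) : (weight m lambda (first_hit B) < +oo)%E ->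
  \forall t \ae P, finite_set [set u | frozen B u (conf_of (brw_variable N S) t)].
Proof.
rewrite -expected_frozen => foo; apply: ae_finite foo => u.
exact: (conf_measurable b (@cyl_frozen H B cH u)).
Qed.

Lemma ae_not_surv (B : set H) : Pc (surv_oo B) = 0 ->
  \forall t \ae P, ~ surv_oo B (conf_of (brw_variable N S) t).
Proof. exact: (ae_of_pr0 (conf_measurable b (cyl_surv_oo B cH))). Qed.

End OneWalk.

(** Stated for the subtrees of all labels at once, because the arguments on a fixed configuration
    restart at every stopped particle. *)
Lemma ae_extinct N S (B : set H) : brw N S ->
  (weight m lambda (first_hit B) <= 1)%E ->
  (weight m lambda (first_hit B) < 1)%E \/ 0 < tail nu 1 ->
  \forall t \ae P, forall u,
    let c := cshift u (conf_of (brw_variable N S) t) in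
    ~ surv_oo B c /\ finite_set [set w | frozen B w c].
Proof.
move=> b w1 cond; apply: ae_forall_seq => u /=.
have bu := shift_brw u b.
have := ae_finite_frozen bu (le_lt_trans w1 (ltry 1)).
have := ae_not_surv bu (surv_oo_eq0 bu w1 cond).
apply: filterS2 => t; rewrite conf_shift.
by split.
Qed.

End Extinction.

(** * Consequences of extinction and survival for a fixed configuration *)

Section Configurations.
Variables (H : groupType).
Local Notation config := (forall j : brw_index, brw_value H j).
Implicit Types (c : config) (u v w : seq nat) (B K : set H).

Lemma first_hit_suffix B (p : seq H) : p != [::] -> B (gprod p) ->
  exists q1 q2 : seq H, p = q1 ++ q2 /\ first_hit B q2.
Proof.
have [n] := ubnP (size p); elim: n p => // n IH p sp p0 Bp.
have [[a [b [e a0 b0 Bb]]]|h] := pselect (exists a b,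
    [/\ p = a ++ b, a != [::], b != [::] & B (gprod b)]).
  have [|q1 [q2 [eb fq]]] := IH b _ b0 Bb.
    have sa : (0 < size a)%N by rewrite lt0n size_eq0.
    move: sp; rewrite e size_cat; lia.
  by exists (a ++ q1), q2; rewrite e eb catA.
exists [::], p; split=> //; split=> // a b e a0 b0 Bb.
by apply: h; exists a, b.
Qed.

Lemma frozen_suffix B c u : u != [::] -> calive c u -> B (cpos c u) ->
  exists w v, [/\ u = w ++ v, frozen B v c, calive (cshift v c) w &
    cpos c u = (cpos c v * cpos (cshift v c) w)%g].
Proof.
move=> u0 au Bu.
have [|q1 [q2 [e f2]]] := @first_hit_suffix B (csteps c u) _ Bu.
  by rewrite -size_eq0 size_csteps size_eq0.
exists (take (size q1) u), (drop (size q1) u).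
have eu : u = take (size q1) u ++ drop (size q1) u by rewrite cat_take_drop.
set w := take _ _ in eu *; set v := drop _ _ in eu *.
have vq : csteps c v = q2.
  have : csteps c (w ++ v) = q1 ++ q2 by rewrite -eu.
  rewrite csteps_cat => /eqP; rewrite eqseq_cat; first by move=> /andP[_ /eqP].
  rewrite size_csteps size_take; case: ltnP => // h.
  apply/eqP; rewrite eqn_leq h /=.
  by rewrite -(size_csteps c u) e size_cat leq_addr.
move: au; rewrite {1}eu calive_cat => /andP[av aw]; split=> //.
  by rewrite /frozen /= vq.
by rewrite {1}eu cpos_cat.
Qed.

(** Every visit of 1 ends a chain of successive returns. The chains have bounded length since some
    [surv n] fails, and each particle starts only finitely many first returns. *)
Lemma finite_visits1 c :
  (forall u, finite_set [set w | frozen [set 1%g] w (cshift u c)]) ->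
  ~ surv_oo [set 1%g] c -> finite_set [set u | calive c u /\ cpos c u = 1%g].
Proof.
move=> fin /existsNP[n /not_implyP[_]].
elim: n c fin => [|n IH] c fin ns; first by case: ns.
pose D := [set u | calive c u /\ cpos c u = 1%g].
pose F v := [set w ++ v | w in
  [set w | calive (cshift v c) w /\ cpos (cshift v c) w = 1%g]].
apply: (@sub_finite_set _ _ ([set [::]] `|`
  \bigcup_(v in [set v | frozen [set 1%g] v c]) F v)).
  move=> u [au pu]; have [->|u0] := eqVneq u [::]; [by left|right].
  have [w [v [eu fv aw pw]]] := @frozen_suffix [set 1%g] c u u0 au pu.
  exists v => //; exists w => //; split=> //.
  move: pu; rewrite pw; have [_ [_ pv _]] := fv.
  by rewrite /cpos [X in (X * _)%g]pv mul1g.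
rewrite finite_setU; split; first exact: finite_set1.
apply: bigcup_finite; first by have := fin [::]; rewrite cshift0.
move=> v fv; apply: finite_image; apply: IH.
  by move=> u; rewrite cshift_cat.
by move=> sv; apply: ns; exists v.
Qed.

(** The induction of [finite_visits1], but counting positions instead of particles: a particle of
    relative position 1 is not stopped, and there may be many of them, yet they add only one
    position. *)
Lemma finite_positions K c : is_subgroup K ->
  (forall u, finite_set [set w | frozen (K `\ 1%g) w (cshift u c)]) ->
  ~ surv_oo (K `\ 1%g) c ->
  finite_set [set cpos c u | u in [set u | calive c u /\ K (cpos c u)]].
Proof.
move=> [K1 KM KV] fin /existsNP[n /not_implyP[_]].
elim: n c fin => [|n IH] c fin ns; first by case: ns.
pose F v := [set (cpos c v * g)%g | g in [set cpos (cshift v c) w | w in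
  [set w | calive (cshift v c) w /\ K (cpos (cshift v c) w)]]].
apply: (@sub_finite_set _ _ ([set 1%g] `|`
  \bigcup_(v in [set v | frozen (K `\ 1%g) v c]) F v)).
  move=> _ [u [au Ku] <-].
  have [->|p1] := eqVneq (cpos c u) 1%g; [by left|right].
  have u0 : u != [::] by apply: contra_neq p1 => ->.
  have Bu : (K `\ 1%g) (cpos c u) by split=> //; exact/eqP.
  have [w [v [eu fv aw pw]]] := frozen_suffix u0 au Bu.
  exists v => //; exists (cpos (cshift v c) w) => //; exists w => //; split=> //.
  have [_ [_ [Kv _] _]] := fv.
  have -> : cpos (cshift v c) w = ((cpos c v)^-1 * cpos c u)%g.
    by rewrite pw mulKg.
  by apply: KM => //; exact: KV.
rewrite finite_setU; split; first exact: finite_set1.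
apply: bigcup_finite; first by have := fin [::]; rewrite cshift0.
move=> v fv; do 1!apply: finite_image; apply: IH.
  by move=> u; rewrite cshift_cat.
by move=> sv; apply: ns; exists v.
Qed.

Definition transient c := forall x, finite_set [set u | calive c u /\ cpos c u = x].

Lemma transientP c :
  (forall u, finite_set [set w | frozen [set 1%g] w (cshift u c)]) ->
  (forall u, ~ surv_oo [set 1%g] (cshift u c)) ->
  (forall x, finite_set [set u | frozen [set x] u c]) -> transient c.
Proof.
move=> fin ns hit x.
pose F v := [set w ++ v | w in
  [set w | calive (cshift v c) w /\ cpos (cshift v c) w = 1%g]].
apply: (@sub_finite_set _ _ ([set [::]] `|`
  \bigcup_(v in [set v | frozen [set x] v c]) F v)).
  move=> u [au pu]; have [->|u0] := eqVneq u [::]; [by left|right].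
  have [w [v [eu fv aw pw]]] := @frozen_suffix [set x] c u u0 au pu.
  exists v => //; exists w => //; split=> //.
  have [_ [_ pv _]] := fv.
  by apply: (mulgI (cpos c v)); rewrite -pw mulg1 pu /cpos pv.
rewrite finite_setU; split; first exact: finite_set1.
apply: bigcup_finite; first exact: hit.
move=> v fv; apply: finite_image; apply: finite_visits1 => //.
by move=> u; rewrite cshift_cat.
Qed.

(** All particles in the coset descend from particles at the entrance [x]; transience makes these
    finite in number, and each has finitely many positions below it inside the coset. *)
Lemma finite_coset K c (x : H) : is_subgroup K -> transient c ->
  (forall u, finite_set [set w | frozen (K `\ 1%g) w (cshift u c)]) ->
  (forall u, ~ surv_oo (K `\ 1%g) (cshift u c)) ->
  (forall u, calive c u -> K (x^-1 * cpos c u)%g ->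
    exists w v, u = w ++ v /\ cpos c v = x) ->
  finite_set [set cpos c u | u in [set u | calive c u /\ K (x^-1 * cpos c u)%g]].
Proof.
move=> sK tr fin ns entry.
pose F v := [set (x * g)%g | g in [set cpos (cshift v c) w | w in
  [set w | calive (cshift v c) w /\ K (cpos (cshift v c) w)]]].
apply: (@sub_finite_set _ _ (\bigcup_(v in [set v | calive c v /\ cpos c v = x]) F v)).
  move=> _ [u [au Ku] <-].
  have [w [v [eu pv]]] := entry _ au Ku.
  move: au; rewrite eu calive_cat => /andP[av aw].
  exists v => //; rewrite cpos_cat pv.
  exists (cpos (cshift v c) w) => //; exists w => //; split=> //.
  by move: Ku; rewrite eu cpos_cat pv mulKg.
apply: bigcup_finite; first exact: tr.
move=> v [av pv]; apply: finite_image; apply: finite_positions => //.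
by move=> u; rewrite cshift_cat.
Qed.

Lemma surv_long B K c n : is_subgroup K -> B `<=` K -> surv B n c ->
  exists u, [/\ calive c u, K (cpos c u) & (n <= size u)%N].
Proof.
move=> [K1 KM KV] BK; elim: n c => [|n IH] c /=; first by exists [::].
move=> [v _ [[av [v0 Bv _]] /IH[w [aw Kw nw]]]].
exists (w ++ v); split; first by rewrite calive_cat av aw.
  by rewrite cpos_cat; apply: KM => //; exact: BK.
have sv : (0 < size v)%N by rewrite -(size_csteps c) lt0n size_eq0.
rewrite size_cat; lia.
Qed.

(** Survival yields labels of arbitrary length inside the coset ([surv_long]). Finitely many
    positions would, by transience, carry only finitely many labels, whose lengths are bounded. *)
Lemma surv_infinite K c v : is_subgroup K -> transient c -> calive c v ->
  surv_oo (K `\ 1%g) (cshift v c) ->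
  infinite_set [set cpos c u | u in
    [set u | calive c u /\ K ((cpos c v)^-1 * cpos c u)%g]].
Proof.
move=> sK tr av sv fin.
have finU : finite_set [set u | calive c u /\ K ((cpos c v)^-1 * cpos c u)%g].
  apply: (@sub_finite_set _ _ (\bigcup_(x in [set cpos c u | u in
    [set u | calive c u /\ K ((cpos c v)^-1 * cpos c u)%g]])
    [set u | calive c u /\ cpos c u = x])).
    by move=> u [au Ku]; exists (cpos c u) => //; exists u.
  by apply: bigcup_finite => // x _; exact: tr.
have [n nP] : exists n, forall u, calive c u ->
    K ((cpos c v)^-1 * cpos c u)%g -> (size u < n)%N.
  have /finite_seqP[s sE] := finU.
  exists (\max_(u <- s) size u).+1 => u au Ku; rewrite ltnS.
  apply: (@leq_bigmax_seq _ s xpredT (fun u => size u)) => //.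
  by have : [set` s] u by rewrite -sE.
have BK : (K `\ 1%g) `<=` K by move=> x [].
have [w [aw Kw nw]] := surv_long sK BK (sv n I).
have := nP (w ++ v); rewrite calive_cat av aw cpos_cat mulKg size_cat => /(_ isT Kw).
lia.
Qed.

End Configurations.

(** * Generating functions of paths *)

Lemma cat_split (X : eqType) (p q c d : seq X) : p ++ q = c ++ d ->
  (exists x, q = x ++ d) \/ (exists x, [/\ x != [::], d = x ++ q & p = c ++ x]).
Proof.
elim: p c => [|a p IH] [|b c] /=.
- by move=> ->; left; exists [::].
- by move=> ->; left; exists (b :: c).
- by move=> <-; right; exists (a :: p).
- move=> [-> /IH[[x ->]|[x [x0 -> ->]]]]; first by left; exists x.
  by right; exists x.
Qed.

Section Weights.
Variables (R : realType) (H : groupType) (m : H -> R).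
Hypothesis m_ge0 : forall x, 0 <= m x.
Implicit Types (p q : seq H) (L : set (seq H)).

Definition wt (z : R) p := z ^+ size p * weight1 m p.

Lemma wt_ge0 z p : 0 <= z -> 0 <= wt z p.
Proof. by move=> z0; rewrite mulr_ge0 ?exprn_ge0 ?prodr_ge0. Qed.

Lemma wt_cat z p q : wt z (p ++ q) = wt z p * wt z q.
Proof. by rewrite /wt /weight1 size_cat exprD big_cat /=; ring. Qed.

Lemma wt0 z : wt z [::] = 1.
Proof. by rewrite /wt /weight1 big_nil mulr1. Qed.

Lemma wt_gt0 z p : 0 < z -> 0 < weight1 m p -> 0 < wt z p.
Proof. by move=> z0 p0; rewrite mulr_gt0 // exprn_gt0. Qed.

Lemma weight_ge0 z L : 0 <= z -> (0 <= weight m z L)%E.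
Proof. by move=> z0; apply: esum_ge0 => p _; rewrite lee_fin wt_ge0. Qed.

Lemma weight_le z z' L L' : 0 <= z -> z <= z' -> L `<=` L' ->
  (weight m z L <= weight m z' L')%E.
Proof.
move=> z0 zz' LL'; have z'0 := le_trans z0 zz'.
apply: (@le_trans _ _ (weight m z' L)).
  apply: le_esum => p _; rewrite lee_fin ler_wpM2r ?prodr_ge0 //.
  by rewrite lerXn2r.
rewrite /weight (esumID L L'); last by move=> p _; rewrite lee_fin wt_ge0.
rewrite (_ : L' `&` L = L); last by rewrite setIC; apply/setIidPl.
by rewrite leeDl // esum_ge0 // => p _; rewrite lee_fin wt_ge0.
Qed.

Lemma weightU z L L' : 0 <= z -> (forall p, L p -> ~ L' p) ->
  weight m z (L `|` L') = (weight m z L + weight m z L')%E.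
Proof.
move=> z0 dis; rewrite /weight (esumID L); last by move=> p _; rewrite lee_fin wt_ge0.
congr (_ + _)%E; congr (esum _ _); rewrite predeqE => p; split.
- by move=> [].
- by move=> Lp; split=> //; left.
- by move=> [[]].
- by move=> L'p; split; [right|move=> /dis].
Qed.

Definition catset L L' : set (seq H) := [set q.1 ++ q.2 | q in L `*` L'].

(** Generating functions multiply under unique factorization. The first one is assumed finite, so
    that it can be pulled out of the sum as a real constant. *)
Lemma weight_cat (z : R) L L' (g : R) : 0 <= z ->
  {in L `*` L' &, injective (fun q : seq H * seq H => q.1 ++ q.2)} ->
  weight m z L = g%:E -> weight m z (catset L L') = (g%:E * weight m z L')%E.
Proof.
move=> z0 inj gE.
rewrite /weight /catset esum_image //.
have g0 : 0 <= g by rewrite -lee_fin -gE weight_ge0.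
transitivity (\esum_(q in L `*`` (fun=> L')) (wt z q.2 * wt z q.1)%:E)%E.
  by apply: eq_esum => q _; rewrite -/(wt _ _) wt_cat mulrC.
rewrite -(@esum_esum _ _ _ L (fun=> L') (fun p q => (wt z q * wt z p)%:E)); last first.
  by move=> p q _ _; rewrite lee_fin mulr_ge0 ?wt_ge0.
rewrite esum_swap; last by move=> p q; rewrite lee_fin mulr_ge0 ?wt_ge0.
rewrite -esumZl //; last by move=> q; rewrite lee_fin wt_ge0.
apply: eq_esum => q _; under eq_esum do rewrite EFinM.
rewrite esumZl ?wt_ge0 //; last by move=> p; rewrite lee_fin wt_ge0.
by rewrite muleC -gE.
Qed.

Lemma first_hit_unique (B : set H) q1 q2 q1' q2' : first_hit B q2 ->
  first_hit B q2' -> q1 ++ q2 = q1' ++ q2' -> q1 = q1' /\ q2 = q2'.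
Proof.
move=> f2 f2' e.
have key a b a' b' : first_hit B b -> first_hit B b' -> a ++ b = a' ++ b' ->
    forall x, b' = x ++ b -> x = [::].
  move=> [b0 Bb _] [_ _ h'] _ x bE; apply/eqP/negPn/negP => x0.
  exact: h' bE x0 b0 Bb.
have sz : size q2 = size q2'.
  case: (cat_split e) => [[x xE]|[x [_ xE _]]].
    by have x0 := key _ _ _ _ f2' f2 (esym e) _ xE; rewrite xE x0.
  by have x0 := key _ _ _ _ f2 f2' e _ xE; rewrite xE x0.
have sz1 : size q1 = size q1'.
  by have := congr1 size e; rewrite !size_cat sz => /addIn.
by move/eqP: e; rewrite eqseq_cat // => /andP[/eqP -> /eqP ->].
Qed.

Definition loops : set (seq H) := [set p | gprod p = 1%g].

Lemma weight_nil z : weight m z [set [::]] = 1%E.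
Proof. by rewrite /weight esum_set1 -/(wt _ _) ?wt0. Qed.

(** The suffix [q2] is the part of the loop up to its first return to 1. In generating functions
    this reads g = 1 + g U. *)
Lemma loops_decomp : loops = [set [::]] `|` catset loops (first_hit [set 1%g]).
Proof.
rewrite predeqE => p; split=> [lp|[->//|[[q1 q2] /= [l1 [_ e2 _]] <-]]]; last first.
  by rewrite /loops /= gprod_cat l1 e2 mul1g.
have [->|p0] := eqVneq p [::]; [by left|right].
have [q1 [q2 [e f2]]] := @first_hit_suffix H [set 1%g] p p0 lp.
exists (q1, q2) => //=; split=> //=; have [_ e2 _] := f2.
by move: lp; rewrite e /loops /= gprod_cat e2 mul1g.
Qed.

Lemma weight_loops_lt1 z : 0 <= z -> (weight m z loops < +oo)%E ->
  (weight m z (first_hit [set 1%g]) < 1)%E.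
Proof.
move=> z0 goo; set U := weight m z (first_hit _).
have [g gE] : exists g, weight m z loops = g%:E.
  exists (fine (weight m z loops)); rewrite fineK //.
  by rewrite ge0_fin_numE // weight_ge0.
have e : (g%:E = 1 + g%:E * U)%E.
  rewrite -{1}gE loops_decomp weightU //; last first.
    move=> p -> [[q1 q2] /= [_ [q20 _ _]]] /(congr1 size) /=.
    by rewrite size_cat => /eqP; rewrite addn_eq0 !size_eq0 (negPf q20) andbF.
  rewrite weight_nil (weight_cat z0 _ gE) // => -[a b] [a' b'] /[!inE] /= -[_ fb] [_ fb'].
  by move=> /(first_hit_unique fb fb')[-> ->].
have U0 : (0 <= U)%E by exact: weight_ge0.
have g1 : 1 <= g.
  rewrite -lee_fin e leeDl // mule_ge0 // lee_fin.
  by rewrite -lee_fin -gE weight_ge0.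
case: U U0 e => [u| |] //.
- by rewrite !lee_fin lte_fin -EFinM -EFinD => u0 [e]; nra.
- by move=> _; rewrite gt0_muley // lte_fin; lra.
Qed.

(** A sum exceeding 1 at [z] has a finite partial sum exceeding 1, and this is still visible
    slightly below [z]. It carries the bounds inside the disc of convergence to the radius
    itself. *)
Lemma continuity_bound z L : 0 < z ->
  (forall z', 0 < z' -> z' < z -> (weight m z' L <= 1)%E) -> (weight m z L <= 1)%E.
Proof.
move=> z0 h; apply: ge_ereal_sup => _ [X [fX XL] <-].
rewrite fsbig_finite //= sumEFin lee_fin; set s := finmap.enum_fset _.
rewrite leNgt; apply/negP => s1.
set f := \sum_(p <- s) _ in s1.
pose K := \max_(p <- s) size p.
have [t [t0 t1 tf]] : exists t : R, [/\ 0 < t, t < 1 & 1 < t ^+ K * f].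
  have f0 : 0 < f by lra.
  (* With t = 1 - e, the Bernoulli inequality gives t^K >= 1 - K e, and this choice of [e] keeps K e
     below half of 1 - 1/f, hence t^K f > 1. *)
  pose e := (1 - f^-1) / (2 * K.+1%:R).
  have f1 : 0 < f^-1 by rewrite invr_gt0.
  have f2 : f^-1 < 1 by rewrite invf_lt1.
  have K0 : 0 < K.+1%:R :> R by rewrite ltr0n.
  have K1 : 1 <= K.+1%:R :> R by rewrite ler1n.
  have e0 : 0 < e by rewrite divr_gt0 ?subr_gt0 ?mulr_gt0.
  have eK : e * (2 * K.+1%:R) = 1 - f^-1.
    by rewrite divfK // mulf_neq0 ?gt_eqF.
  have e1 : e < 1 by nra.
  exists (1 - e); split; [lra|lra|].
  have bern n : 1 - n%:R * e <= (1 - e) ^+ n.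
    elim: n => [|n IH]; first by rewrite mul0r subr0 expr0.
    rewrite exprS -natr1; have := ler0n R n; nra.
  have fV : f^-1 * f = 1 by rewrite mulVf // gt_eqF.
  have := bern K; have Kp : K.+1%:R = K%:R + 1 :> R by rewrite natr1.
  rewrite Kp in eK; have := ler0n R K; move=> k0 bK.
  have : f^-1 < (1 - e) ^+ K by nra.
  by move=> fb; rewrite -[ltLHS]fV ltr_pM2r.
have := h (t * z); rewrite mulr_gt0 // gtr_pMl // => /(_ isT t1).
apply/negP; rewrite -ltNge.
apply: (@lt_le_trans _ _ (t ^+ K * f)%:E); first by rewrite lte_fin.
apply: esum_ge; exists X => //.
rewrite fsbig_finite //= sumEFin lee_fin /f mulr_sumr.
rewrite big_seq [leRHS]big_seq; apply: ler_sum => p ps.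
rewrite mulrA ler_wpM2r ?prodr_ge0 // exprMn ler_wpM2r ?exprn_ge0 ?(ltW z0) //.
apply: (ler_wiXn2l (ltW t0) (ltW t1)).
exact: (@leq_bigmax_seq _ s xpredT (fun p => size p)).
Qed.

(* Cut a path from 1 to v at its last visit of 1: with F0 the paths without
   return and U0 the loops avoiding v, the weight a of the hitting paths satisfies
   [a <= f + u * a], while appending a fixed path from v to 1 to those in F0
   gives [u + wt z p * f <= 1].  Truncating by length keeps a finite. *)
Lemma hit_bound z v p0 : 0 < z ->
  (weight m z (first_hit [set 1%g]) <= 1)%E ->
  gprod p0 = v^-1%g -> 0 < weight1 m p0 -> v != 1%g ->
  (weight m z (first_hit [set v]) < +oo)%E.
Proof.
move=> z0 U1 p0v wp0 v1; have z0' := ltW z0.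
(* Keeping only the part of [p0] up to its first hit of [v^-1] makes [p ++ q], for [q] in [F0], a
   first return to 1. *)
have [q1 [p [p0E fp]]] : exists q1 q2, p0 = q1 ++ q2 /\ first_hit [set v^-1%g] q2.
  apply: first_hit_suffix => //; apply: contra_neq v1 => p00.
  by move: p0v; rewrite p00 /= => /(congr1 (fun x => x^-1)%g); rewrite invg1 invgK.
have wp : 0 < weight1 m p.
  move: wp0; rewrite p0E /weight1 big_cat /=.
  rewrite -!/(weight1 m _) => h; have : 0 <= weight1 m p by exact: prodr_ge0.
  by rewrite le_eqVlt => /orP[/eqP e|//]; move: h; rewrite -e mulr0 ltxx.
have e0 : 0 < wt z p by exact: wt_gt0.
pose F0 := [set q | first_hit [set v] q /\
  forall a b, q = a ++ b -> b != [::] -> gprod b <> 1%g].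
pose U0 := [set q | first_hit [set 1%g] q /\
  forall a b, q = a ++ b -> gprod b <> v].
have fin L : L `<=` first_hit [set 1%g] -> exists r, weight m z L = r%:E.
  move=> LU; exists (fine (weight m z L)); rewrite fineK // ge0_fin_numE ?weight_ge0 //.
  by apply: le_lt_trans (ltry 1); apply: le_trans U1; exact: weight_le.
have [u uE] : exists u, weight m z U0 = u%:E by apply: fin => q [].
have pinj : {in [set p] `*` F0 &, injective (fun q : seq H * seq H => q.1 ++ q.2)}.
  move=> [a b] [a' b'] /[!inE] /= -[-> _] [-> _] /eqP.
  by rewrite eqseq_cat // eqxx => /eqP ->.
have pE : weight m z [set p] = (wt z p)%:E.
  by rewrite /weight esum_set1 // lee_fin wt_ge0.
have pF : catset [set p] F0 `<=` first_hit [set 1%g].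
  move=> _ [[a q] /= [-> [[q0 qv qn] q1n]] <-]; have [pn pv ph] := fp.
  split.
  - by rewrite -size_eq0 size_cat addn_eq0 !size_eq0 (negPf q0) andbF.
  - by rewrite /= gprod_cat qv pv mulgV.
  move=> c d /= e c0 d0.
  have [[x qE]|[x [x0 dE pE']]] := cat_split e; first exact: q1n qE d0.
  rewrite /= dE gprod_cat qv => gx.
  have gx' : gprod x = v^-1%g by apply: (mulgI v); rewrite gx mulgV.
  exact: ph pE' c0 x0 gx'.
have [fp' fpE] := fin _ pF.
have [f fE] : exists f, weight m z F0 = f%:E.
  move: fpE; rewrite (weight_cat z0' pinj pE).
  case: (weight m z F0) (weight_ge0 F0 z0') => [f _ _|_|//]; first by exists f.
  by rewrite gt0_muley // lte_fin.
have uf : u + wt z p * f <= 1.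
  rewrite -lee_fin EFinD EFinM -uE -fE -(weight_cat z0' pinj pE) -weightU //.
    apply: le_trans U1; apply: weight_le => // q [[]//|]; exact: pF.
  move=> q [_ qn] [[a b] /= [_ [[_ bv _] _]] qE].
  exact: (qn a b (esym qE) bv).
pose L n := first_hit [set v] `&` [set q | (size q <= n)%N].
have f0 : 0 <= f by rewrite -lee_fin -fE weight_ge0.
have u0 : 0 <= u by rewrite -lee_fin -uE weight_ge0.
(* Induction on the length bound, writing w for [wt z p]: the new weight is at most f + u / w, which
   is at most 1 / w because u + w f <= 1. *)
have Lle n : (weight m z (L n) <= ((wt z p)^-1)%:E)%E.
  elim: n => [|n IH].
    rewrite (_ : L 0%N = set0) /weight ?esum_set0 ?lee_fin ?invr_ge0 ?ltW //.
    rewrite predeqE => q; split=> // -[[q0 _ _]] /=.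
    by rewrite leqn0 size_eq0 (negPf q0).
  have [a aE] : exists a, weight m z (L n) = a%:E.
    exists (fine (weight m z (L n))); rewrite fineK // ge0_fin_numE ?weight_ge0 //.
    exact: le_lt_trans IH (ltry _).
  have sub : L n.+1 `<=` F0 `|` catset (L n) U0.
    move=> q [fq sq].
    have [h|/existsNP[x /existsNP[y /not_implyP[qE /not_implyP[y0 /contrapT yv]]]]]
      := pselect (forall a b, q = a ++ b -> b != [::] -> gprod b <> 1%g).
      by left.
    (* [y'] is the first return to 1, made before [v] is met; the remaining path [c] still hits [v]
       for the first time at its end and is strictly shorter. *)
    right; have [q1' [y' [yE fy]]] := @first_hit_suffix H [set 1%g] y y0 yv.
    have [y'0 y'1 _] := fy; have [q0 qv qn] := fq.
    pose c := x ++ q1'; have qE' : q = c ++ y' by rewrite /c -catA -yE.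
    have c0 : c != [::].
      by apply: contra_neq v1 => c0; rewrite -qv qE' c0 /= y'1.
    exists (c, y') => //=; split=> /=.
      split; last first.
        move: sq; rewrite /= qE' size_cat => sq; rewrite -ltnS.
        by apply: leq_trans sq; rewrite -addn1 leq_add2l lt0n size_eq0.
      split=> //.
        by move: qv; rewrite qE' /= gprod_cat y'1 mul1g.
      move=> a' b cE a0 b0 bv; apply: (qn a' (b ++ y')) => //.
      - by rewrite qE' cE catA.
      - by rewrite -size_eq0 size_cat addn_eq0 !size_eq0 (negPf b0).
      - by rewrite /= gprod_cat y'1 mul1g.
    split=> // a' b y'E bv.
    have [b0|b0] := eqVneq b [::].
      by move: v1; rewrite -bv b0 eqxx.
    apply: (qn (c ++ a') b) => //; first by rewrite qE' y'E catA.
    by rewrite -size_eq0 size_cat addn_eq0 !size_eq0 (negPf c0).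
  have cinj : {in L n `*` U0 &, injective (fun q : seq H * seq H => q.1 ++ q.2)}.
    move=> [x y] [x' y'] /[!inE] /= -[_ [fy _]] [_ [fy' _]].
    by move=> /(first_hit_unique fy fy')[-> ->].
  apply: (le_trans (weight_le z0' (lexx z) sub)).
  rewrite weightU //; last first.
    move=> q [_ qn] [[x y] /= [_ [[y0 y1 _] _]] qE].
    exact: (qn x y (esym qE) y0).
  rewrite (weight_cat z0' cinj aE) fE uE -EFinM -EFinD lee_fin.
  move: IH; rewrite aE lee_fin => IH.
  have eV : wt z p * (wt z p)^-1 = 1 by rewrite mulfV // gt_eqF.
  have V0 : 0 < (wt z p)^-1 by rewrite invr_gt0.
  nra.
apply: (@le_lt_trans _ _ ((wt z p)^-1)%:E); last exact: ltry.
apply: ge_ereal_sup => _ [X [fX XL] <-].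
have /finite_seqP[s sE] := fX.
apply: le_trans (Lle (\max_(q <- s) size q)).
apply: esum_ge; exists X => //; split=> // q Xq; split; first exact: XL.
apply: (@leq_bigmax_seq _ s xpredT (fun q => size q)) => //.
by have : [set` s] q by rewrite -sE.
Qed.

End Weights.

(** * Convolution powers, the radius of convergence and returns to 1 *)

Section Radius.
Variables (R : realType) (H : groupType) (m : H -> R).
Hypothesis m_ge0 : forall x, 0 <= m x.
Hypothesis m_fin : finite_set (supp m).

Lemma esum_fsbig (I : choiceType) (f : I -> R) : (forall i, 0 <= f i) ->
  finite_set [set i | f i != 0] ->
  ((\sum_(i \in [set: I]) f i)%:E = \esum_(i in [set: I]) (f i)%:E)%E.
Proof.
move=> f0 fin; set D := [set i | f i != 0] in fin *.
have -> : \sum_(i \in [set: I]) f i = \sum_(i \in D) f i.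
  by apply/esym/fsbig_widen => // i [_ nz]; apply/eqP; apply: contra_notT nz.
rewrite (esumID D); last by move=> i _; rewrite lee_fin.
rewrite !setTI (esum1 (D := ~` D)); last first.
  by move=> i nz; congr (_%:E); apply/eqP; apply: contra_notT nz.
rewrite adde0 esum_fset //; last by move=> i _; rewrite lee_fin.
by rewrite !fsbig_finite //= sumEFin.
Qed.

Lemma conv_pow_ge0 n x : 0 <= conv_pow m n x.
Proof.
elim: n x => [|n IH] x /=; first by case: eqP.
by apply: fsumr_ge0 => y _; rewrite mulr_ge0.
Qed.

(** [conv_pow] splits off the right-hand factor of the product, which is the most recent step and
    hence the head of the word. *)
Lemma conv_pow_weight n x : ((conv_pow m n x)%:E =
  \esum_(p in [set p | size p = n /\ gprod p = x]) (weight1 m p)%:E)%E.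
Proof.
have w0 (p : seq H) : (0 <= (weight1 m p)%:E)%E by rewrite lee_fin prodr_ge0.
elim: n x => [|n IH] x.
  have [->|x1] := eqVneq x 1%g; rewrite /= ?eqxx.
    rewrite (_ : [set p | _] = [set [::]]); last first.
      by rewrite predeqE => p; split=> [[/size0nil]|->].
    by rewrite esum_set1 // /weight1 big_nil.
  rewrite (negPf x1) (_ : [set p | _] = set0) ?esum_set0 //.
  by rewrite predeqE => p; split=> // -[/size0nil -> /= e]; rewrite e eqxx in x1.
rewrite /= esum_fsbig; first last.
- apply: (@sub_finite_set _ _ [set (x * s^-1)%g | s in supp m]).
    move=> y /= h; exists (y^-1 * x)%g.
      by apply: contraNneq h => ->; rewrite mulr0.
    by rewrite invgM invgK mulVKg.
  exact: finite_image.
- by move=> y; rewrite mulr_ge0 ?conv_pow_ge0.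
transitivity (\esum_(y in [set: H]) \esum_(p in [set p | size p = n /\ gprod p = y])
   (weight1 m ((y^-1 * x)%g :: p))%:E)%E.
  apply: eq_esum => y _; rewrite mulrC EFinM IH -esumZl //.
  by apply: eq_esum => p _; rewrite /weight1 big_cons EFinM.
rewrite esum_esum; last by move=> *; exact: w0.
apply/esym.
apply: (reindex_esum _ _ (fun q : H * seq H => (q.1^-1 * x)%g :: q.2)
  (fun p => (weight1 m p)%:E)); split.
- by move=> [y p] /= [_ [<- <-]]; split=> //; rewrite /= mulVKg.
- by move=> [y p] [y' p'] /[!inE] /= -[_ [_ <-]] [_ [_ <-]] [_ ->].
- case=> [[]//|s p [/= [sp] gp]]; exists (gprod p, p) => //=.
  by rewrite -gp mulKg.
Qed.

Lemma weight_loops_series (z : R) : 0 <= z ->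
  weight m z (@loops H) = (\sum_(n <oo) (conv_pow m n 1%g * z ^+ n)%:E)%E.
Proof.
move=> z0; have w0 (p : seq H) : (0 <= (z ^+ size p * weight1 m p)%:E)%E.
  by rewrite lee_fin mulr_ge0 ?exprn_ge0 ?prodr_ge0.
pose J n := [set p : seq H | size p = n /\ gprod p = 1%g].
have -> : @loops H = \bigcup_(n in [set: nat]) J n.
  by rewrite predeqE => p; split=> [lp|[n _ []//]]; exists (size p).
rewrite /weight esum_bigcupT //; last by move=> i j _ _ [p [[<- _] [<- _]]].
rewrite nneseries_esumT; last first.
  by move=> n; rewrite lee_fin mulr_ge0 ?conv_pow_ge0 ?exprn_ge0.
apply: eq_esum => n _; rewrite mulrC EFinM conv_pow_weight -esumZl ?exprn_ge0 //.
  by apply: eq_esum => p [-> _]; rewrite EFinM.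
by move=> p; rewrite lee_fin prodr_ge0.
Qed.

Lemma weight_loops_fin (z : R) : 0 <= z ->
  cvgn (series (fun n => conv_pow m n 1%g * z ^+ n)) ->
  (weight m z (@loops H) < +oo)%E.
Proof.
move=> z0 cv; rewrite weight_loops_series //.
have u0 n : 0 <= conv_pow m n 1%g * z ^+ n by rewrite mulr_ge0 ?conv_pow_ge0 ?exprn_ge0.
apply: (@le_lt_trans _ _ (limn (series (fun n => conv_pow m n 1%g * z ^+ n)))%:E);
  last exact: ltry.
apply: lime_le; first by apply: is_cvg_nneseries => n _ _; rewrite lee_fin.
apply: nearW => n; rewrite sumEFin lee_fin.
apply: nondecreasing_cvgn_le => //.
by apply/nondecreasing_seqP => k; rewrite !seriesEnat /= big_nat_recr //= lerDl.
Qed.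

Local Notation rad := (radius_of_convergence (fun n => conv_pow m n 1%g)).

Lemma return_lt1 (z : R) : 0 <= z -> (z%:E < rad)%E ->
  (weight m z (first_hit [set 1%g]) < 1)%E.
Proof.
move=> z0 /ereal_sup_gt[_ [z' [z'0 cv] <-]]; rewrite lte_fin => zz'.
have := weight_loops_lt1 m_ge0 z'0 (weight_loops_fin z'0 cv).
by apply: le_lt_trans; apply: weight_le => //; exact: ltW.
Qed.

Lemma return_le1 (z : R) : 0 < z -> (z%:E <= rad)%E ->
  (weight m z (first_hit [set 1%g]) <= 1)%E.
Proof.
move=> z0 zr; apply: continuity_bound => // z' z'0 z'z.
apply/ltW/return_lt1; first exact: ltW.
by apply: lt_le_trans zr; rewrite lte_fin.
Qed.

End Radius.

(** * Transience and the leftmost line *)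

Section Transience.
Context d (T : measurableType d) (R : realType) (P : probability T R).
Variables (H : groupType) (m : H -> R).
Hypothesis cH : countable [set: H].
Local Notation config := (forall j : brw_index, brw_value H j).
Local Notation brw := (branching_random_walk P m).
Local Notation conf N S := (conf_of (@brw_variable d T H N S)).

Lemma ae_forall_countable (I : choiceType) (F : I -> T -> Prop) :
  countable [set: I] ->
  (forall i, \forall t \ae P, F i t) -> \forall t \ae P, forall i, F i t.
Proof.
move=> cI h.
have [/eqP I0|/set0P I0] := boolP ([set: I] == set0).
  by apply: aeW => t i; have : [set: I] i by []; rewrite I0.
have [B [g [_ _ gsurj]]] := countable_nat_bij cI I0.
have : \forall t \ae P, forall n, F (g n) t by apply/ae_foralln => n; exact: h.
apply: filterS => t Ft i; have [n _ <-] : (g @` B) i by exact: gsurj.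
exact: Ft.
Qed.

Definition reaches := forall v : H, exists p, gprod p = v /\ 0 < weight1 m p.

Lemma ae_transient nu lambda N S : brw nu N S -> reaches ->
  (\esum_(k in [set: nat]) (tail nu k)%:E = lambda%:E)%E -> 0 < lambda ->
  (weight m lambda (first_hit [set 1%g]) <= 1)%E ->
  (weight m lambda (first_hit [set 1%g]) < 1)%E \/ 0 < tail nu 1 ->
  \forall t \ae P, transient (conf N S t).
Proof.
move=> b re tl l0 U1 cond.
have hits : \forall t \ae P, forall x : H,
    finite_set [set u | frozen [set x] u (conf N S t)].
  apply: ae_forall_countable => // x; apply: (ae_finite_frozen cH tl b).
  have [->|x1] := eqVneq x 1%g; first exact: le_lt_trans U1 (ltry 1).
  have [p [px wp]] := re x^-1%g.
  by apply: (hit_bound _ l0 U1 px wp x1) => s; exact: (brw_m_ge0 s b).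
have := ae_extinct cH tl b U1 cond.
move: hits; apply: filterS2 => t hit ext; apply: transientP => // u.
  by have [] := ext u.
by have [] := ext u.
Qed.

Lemma ae_steps nu N S : brw nu N S ->
  \forall t \ae P, forall u, supp m (S u t).
Proof.
move=> b; apply: ae_forall_seq => u.
have [mNS _ _ _] := b; have [_ mS] := mNS u.
have mA := mS (~` supp m).
apply: filterS (ae_of_pr0 mA _) => [t /= /contrapT //|].
apply: EFin_inj; rewrite (brw_S cH u _ b) esum1 // => x.
by move=> /negP; rewrite negbK => /eqP ->.
Qed.

(** With this constant offspring number and the same steps [S], the leftmost line is itself a
    branching walk on the same probability space, so everything proved above applies to it with mean
    1. *)
Definition one_child (u : seq nat) (t : T) : nat := 1%N.

Lemma line_brw nu N S : brw nu N S -> brw \d_1%N one_child S.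
Proof.
move=> [mNS _ SE iNS]; split=> [u|u k|//|s A us].
- split; last by have [] := mNS u.
  move=> A; have [A1|A1] := pselect (A 1%N).
    by rewrite (_ : _ @^-1` _ = setT) // predeqE.
  by rewrite (_ : _ @^-1` _ = set0) // predeqE.
- have -> : (\d_1%N : probability nat R) [set k] = ((1%N \in [set k])%:R%:E)%E.
    exact: diracE.
  have [k1|k1] := eqVneq k 1%N.
    rewrite (_ : _ @^-1` _ = setT) ?probability_setT ?mem_set //.
    by rewrite predeqE => t; split=> // _; rewrite /= k1.
  rewrite (_ : _ @^-1` _ = set0) ?measure0 ?memNset //.
    by move=> /= e; rewrite e eqxx in k1.
  by rewrite predeqE => t; split=> //= e; rewrite -e eqxx in k1.
(* A condition on the constant 1 is either always or never met, so it is replaced by [setT] or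
   [set0] and independence is inherited from [N] and [S]. *)
pose A' (j : brw_index) : set (brw_value H j) := match j with
  | inl w => if `[< A (inl w) 1%N >] then setT else set0
  | inr w => A (inr w) end.
have YA j : brw_variable one_child S j @^-1` A j =
    brw_variable N S j @^-1` A' j.
  case: j => w //=; case: asboolP => A1; by rewrite predeqE.
rewrite (eq_bigr _ (fun j _ => YA j)) (iNS s A' us).
by apply: eq_bigr => j _; rewrite YA.
Qed.

Lemma tail_dirac k : tail \d_1%N k = (k == 0%N)%:R :> R.
Proof.
rewrite /tail /pr.
have -> : (\d_1%N : probability nat R) [set j | (k < j)%N] =
    ((1%N \in [set j | (k < j)%N])%:R%:E)%E by exact: diracE.
case: k => [|k] /=; first by rewrite mem_set.
by rewrite memNset.
Qed.

Lemma tails_dirac : (\esum_(k in [set: nat])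
  (tail (\d_1%N : probability nat R) k)%:E = 1%:E)%E.
Proof.
rewrite (esumID [set 0%N]); last by move=> k _; rewrite lee_fin tail_ge0.
rewrite !setTI esum_set1 ?lee_fin ?tail_ge0 // esum1.
  by rewrite adde0 tail_dirac.
by move=> k /= k0; rewrite tail_dirac; case: k k0.
Qed.

Lemma calive_line (c : config) u : (forall w, c (inl w) = 1%N) ->
  calive c u = (u == nseq (size u) 0%N).
Proof.
move=> c1; elim: u => //= k u ->; rewrite c1 ltnS leqn0 eqseq_cons andbC.
by [].
Qed.

Lemma line_suffix (c : config) u v : (forall w, c (inl w) = 1%N) ->
  calive c u -> calive c v -> suffix u v \/ suffix v u.
Proof.
move=> c1; rewrite !calive_line // => /eqP -> /eqP ->.
have h i j : (i <= j)%N -> suffix (nseq i 0%N) (nseq j 0%N).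
  by move=> ij; apply/suffixP; exists (nseq (j - i) 0%N); rewrite -nseqD subnK.
by case/orP: (leq_total (size u) (size v)) => /h; [left|right].
Qed.

(** On a line all living labels are comparable, so at most one is stopped: the expected number of
    stopped particles is a probability. *)
Lemma line_hit nu N S (B : set H) : brw nu N S ->
  (pr P (\bigcup_u (conf one_child S @^-1` frozen B u)))%:E =
  weight m 1 (first_hit B).
Proof.
move=> b; have b1 := line_brw b.
rewrite pr_bigcup.
- exact: (expected_frozen cH tails_dirac b1).
- exact: countableP.
- by move=> u _; exact: (conf_measurable b1 (@cyl_frozen H B cH u)).
move=> u v _ _ [t [fu fv]].
have [uv|vu] := @line_suffix (conf one_child S t) u v (fun=> erefl) fu.1 fv.1.
  exact: frozen_incomp fu fv uv.
by apply/esym; exact: frozen_incomp fv fu vu.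
Qed.

(** The weight at 1 is a hitting probability, so it suffices to exhibit one event of positive
    probability that excludes a hit. Legal steps may be assumed as they hold almost surely. *)
Lemma line_escape nu N S (B : set H) (E : set config) : brw nu N S ->
  cyl (desc [::]) E -> 0 < cpr P one_child S E ->
  (forall c, E c -> (forall w, c (inl w) = 1%N) ->
    (forall w, supp m (c (inr w))) -> forall u, ~ frozen B u c) ->
  (weight m 1 (first_hit B) < 1)%E.
Proof.
move=> b cE E0 EB; have b1 := line_brw b.
have cB : cyl (desc [::]) (\bigcup_u frozen B u : set config).
  apply: cyl_countable => [|u _]; first exact: countableP.
  by apply: cylS (@cyl_frozen H B cH u) => j; exact: anc_desc0.
have mE := conf_measurable b1 cE; have mB := conf_measurable b1 cB.
rewrite -(line_hit B b) lte_fin -preimage_bigcup.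
set U := _ @^-1` (\bigcup_u _) in mB *.
have EU0 : pr P ((conf one_child S @^-1` E) `&` U) = 0.
  have := ae_steps b; rewrite /almost_everywhere /= => -[A [mA A0 hA]].
  apply/eqP; rewrite eq_le pr_ge0 andbT.
  have <- : pr P A = 0 by rewrite /pr A0.
  apply: pr_le => //; first exact: measurableI.
  move=> t [Et [u _ fu]]; apply: hA => /= st.
  exact: (EB _ Et (fun=> erefl) st u fu).
have := prU P mE mB; rewrite EU0 subr0 => eU.
have : pr P ((conf one_child S @^-1` E) `|` U) <= 1.
  by apply: pr_le1; exact: measurableU.
rewrite eU; move: E0; rewrite /cpr; lra.
Qed.

End Transience.

(** * Independent trials at the siblings of the leftmost line *)

Section Siblings.
Context d (T : measurableType d) (R : realType) (P : probability T R).
Variables (H : groupType) (m : H -> R) (nu : probability nat R).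
Hypothesis cH : countable [set: H].
Local Notation config := (forall j : brw_index, brw_value H j).
Local Notation brw := (branching_random_walk P m nu).
Local Notation conf N S := (conf_of (@brw_variable d T H N S)).

Definition zeros n := nseq n 0%N.

(* The coordinates read by a block at generation n of the leftmost line, with
   no condition on the subtree of the leftmost child. *)
Definition block_index n : set brw_index := [set j | match j with
  | inl w => w = zeros n \/ suffix (1%N :: zeros n) w
  | inr w => w = zeros n.+1 \/ suffix (1%N :: zeros n) w end].

Lemma suffix1_zeros n k : ~~ suffix (1%N :: zeros n) (zeros k).
Proof.
apply/negP => /suffixP[x e]; have : 1%N \in zeros k.
  by rewrite e mem_cat inE eqxx orbT.
by rewrite mem_nseq andbF.
Qed.

Lemma zeros_inj : injective zeros.
Proof. by move=> i j /(congr1 size); rewrite !size_nseq. Qed.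

Lemma block_index_disj i j x : i <> j -> block_index i x -> ~ block_index j x.
Proof.
have key n k w : suffix (1%N :: zeros n) w -> suffix (1%N :: zeros k) w -> n = k.
  have h a b : suffix (1%N :: zeros a) (1%N :: zeros b) -> a = b.
    move=> /suffixP[[|y s] /=]; first by move=> [/zeros_inj ->].
    move=> [_ e]; have := suffix1_zeros a b.
    by rewrite e suffix_suffix.
  move=> /suffixP[a ->] /suffixP[b] e.
  have [le|/ltnW le] := leqP (size (1%N :: zeros k)) (size (1%N :: zeros n)).
    by apply/esym/h; exact: suffix_cat_eq e le.
  by apply: h; exact: suffix_cat_eq (esym e) le.
move=> ij; case: x => w /= [->|wi] [wj|wj].
- by apply: ij; exact: zeros_inj.
- by move: (suffix1_zeros j i); rewrite wj.
- by move: wi; rewrite wj (negPf (suffix1_zeros _ _)).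
- by apply: ij; exact: key wi wj.
- by apply: ij; case: wj => /zeros_inj.
- by move: (suffix1_zeros j i.+1); rewrite -[zeros i.+1]/(0%N :: zeros i) wj.
- by move: (suffix1_zeros i j.+1); rewrite -[zeros j.+1]/(0%N :: zeros j) -wj wi.
- by apply: ij; exact: key wi wj.
Qed.

Lemma block_index_desc n j : block_index n j -> desc [::] j.
Proof.
case: j => w /=; first by rewrite suffix0s.
rewrite suffix0s /= => -[-> //|/suffixP[x ->]].
by rewrite -size_eq0 size_cat addnS.
Qed.

Lemma cyl_block_index n A (E : set config) : cyl (desc [::]) E ->
  cyl (block_index n) (block (zeros n) A setT E).
Proof.
move=> cE; apply: cylI.
  apply: cylI.
    by apply: (@cyl_coord _ _ _ (inl (zeros n)) [set n : nat | (1 < n)%N]); left.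
  apply: cylI.
    by apply: (@cyl_coord _ _ _ (inr (0%N :: zeros n)) A); left.
  apply: (@cyl_coord _ _ _ (inr (1%N :: zeros n)) A); right.
  exact: suffix_refl.
rewrite preimage_setT setTI.
apply: cylS (@cyl_shift_desc H (1%N :: zeros n) _ cE) => -[w|w] /=.
  by move=> ?; right.
by move=> /andP[? _]; right.
Qed.

Variables (N : seq nat -> T -> nat) (S : seq nat -> T -> H).
Hypothesis b : brw N S.
Local Notation Pc := (cpr P N S).

Lemma cpr_forall_lt (Q : nat -> set config) M :
  (forall n, cyl (block_index n) (Q n)) ->
  cyl [set j | exists2 n, (n < M)%N & block_index n j]
    [set c | forall n, (n < M)%N -> Q n c] /\
  Pc [set c | forall n, (n < M)%N -> Q n c] = \prod_(n < M) Pc (Q n).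
Proof.
move=> cQ; elim: M => [|M [IHc IHp]].
  have -> : [set c | forall n, (n < 0)%N -> Q n c] = setT.
    by rewrite predeqE => c; split=> // _ n; rewrite ltn0.
  rewrite big_ord0.
  by split; [exact: cylT|rewrite /cpr preimage_setT pr_setT].
have -> : [set c | forall n, (n < M.+1)%N -> Q n c] =
    [set c | forall n, (n < M)%N -> Q n c] `&` Q M.
  rewrite predeqE => c; split=> [h|[h hM] n].
    by split=> [n nM|]; apply: h => //; rewrite ltnS ltnW.
  by rewrite ltnS leq_eqVlt => /orP[/eqP -> //|nM]; exact: h.
split.
  apply: cylI.
    by apply: cylS IHc => j [n nM nj]; exists n => //; rewrite ltnS ltnW.
  by apply: cylS (cQ M) => j Mj; exists M.
rewrite big_ord_recr /= -IHp; apply: (cprI b _ IHc (cQ M)).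
move=> j [n nM nj]; apply: block_index_disj nj.
by move=> nM'; rewrite nM' ltnn in nM.
Qed.

(** The trials succeed independently with the same probability [a > 0], so one succeeds almost
    surely. The hypothesis [nu [set 0] = 0] keeps the leftmost line alive, hence the successful
    sibling is a living particle. *)
Lemma ae_trial (E : set config) : nu [set 0%N] = 0%E -> 0 < tail nu 1 ->
  cyl (desc [::]) E -> 0 < Pc E ->
  \forall t \ae P, exists u, calive (conf N S t) u /\ E (cshift u (conf N S t)).
Proof.
move=> nu0 t1 cE PE.
pose Q n := ~` block (zeros n) setT setT E.
have cQ n : cyl (block_index n) (Q n) by apply: cylC; exact: cyl_block_index.
have cT : cyl (desc [::]) ([set: config]) by exact: cylT.
pose a := tail nu 1 * Pc E.
have a0 : 0 < a by rewrite mulr_gt0.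
have PT : Pc setT = 1 by rewrite /cpr preimage_setT pr_setT.
have sT : stepl P S setT = 1 by rewrite /stepl preimage_setT pr_setT.
have PQ n : Pc (Q n) = 1 - a.
  rewrite /cpr; change (pr P (~` (conf N S @^-1` block (zeros n) setT setT E)) = 1 - a).
  have mB := conf_measurable b (@cyl_block_index n setT E cE).
  rewrite prC //.
  have := cpr_block cH b (zeros n) setT cT cE; rewrite /cpr => ->.
  by rewrite -/(cpr _ _ _ _) PT sT expr1n !mulr1.
have cI : cyl (desc [::]) (\bigcap_n Q n).
  apply: cyl_bigcap => [|n _]; first exact: countableP.
  by apply: cylS (cQ n) => j; exact: block_index_desc.
have P0 : Pc (\bigcap_n Q n) = 0.
  apply/eqP; rewrite eq_le cpr_ge0 andbT leNgt; apply/negP => p0.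
  have le M : Pc (\bigcap_n Q n) <= (1 - a) ^+ M.
    have [cM pM] := cpr_forall_lt M cQ.
    have -> : (1 - a) ^+ M = \prod_(n < M) Pc (Q n).
      by rewrite (eq_bigr (fun=> 1 - a)) ?prodr_const ?card_ord // => n _; rewrite PQ.
    by rewrite -pM; apply: (cpr_le b cI cM) => c h n _; exact: h.
  have a1 : 0 <= 1 - a by rewrite -(PQ 0%N) cpr_ge0.
  apply: (@no_uniform_decrease _ (fun M => (1 - a) ^+ M) (a * Pc (\bigcap_n Q n))).
  - by rewrite mulr_gt0.
  - by move=> M; rewrite exprn_ge0.
  - by move=> M; rewrite exprS; have := le M; nra.
have N1 : \forall t \ae P, forall u, (0 < N u t)%N.
  apply: ae_forall_seq => u; have [mNS NE _ _] := b; have [mN _] := mNS u.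
  have N0 : pr P (N u @^-1` [set 0%N]) = 0 by rewrite /pr (NE u 0%N) nu0.
  by apply: filterS (ae_of_pr0 (mN [set 0%N]) N0) => t /eqP; rewrite lt0n.
have := ae_of_pr0 (conf_measurable b cI) P0.
move: N1; apply: filterS2 => t N1 /existsNP[n /not_implyP[_ /contrapT]].
move=> [[/= n2 _] [_ Et]].
exists (1%N :: zeros n); split=> //=; rewrite n2 andbT.
by elim: n {n2 Et} => //= n ->; rewrite N1.
Qed.

(** Prescribing the steps [g] along the line makes the first [M] siblings start at known positions
    ([chain_positions]), each with [E] in its subtree. The probability is tiny but positive, which
    is enough for [ae_trial]. *)
Lemma cpr_chain (g : nat -> H) (E : set config) M : 0 < tail nu 1 ->
  (forall n, 0 < m (g n)) -> cyl (desc [::]) E -> 0 < Pc E ->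
  let F := [set c | forall n, (n < M)%N -> block (zeros n) [set g n] setT E c] in
  cyl (desc [::]) F /\ 0 < Pc F.
Proof.
move=> t1 g0 cE PE; have cQ n := @cyl_block_index n [set g n] E cE.
have [cF pF] := cpr_forall_lt M cQ; move=> F; split.
  by apply: cylS cF => j [n _]; exact: block_index_desc.
rewrite [Pc F]pF.
apply: prodr_gt0 => n _.
have cT : cyl (desc [::]) ([set: config]) by exact: cylT.
rewrite (cpr_block cH b (zeros n) [set g n] cT cE).
have PT : Pc setT = 1 by rewrite /cpr preimage_setT pr_setT.
have sg : stepl P S [set g n] = m (g n).
  by rewrite -(cpr_S_in cH b [::]) -(cpr_S [::] (g n) b).
by rewrite PT sg mulr1 !mulr_gt0 // exprn_gt0.
Qed.

Lemma chain_positions (g : nat -> H) (E : set config) M (c : config) :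
  (forall n, (n < M)%N -> block (zeros n) [set g n] setT E c) ->
  forall n, (n < M)%N -> [/\ calive c (1%N :: zeros n),
    cpos c (1%N :: zeros n) = gprod (rev (mkseq g n.+1)) &
    E (cshift (1%N :: zeros n) c)].
Proof.
move=> h n nM.
have hz k : (k <= n)%N -> calive c (zeros k) /\
    cpos c (zeros k) = gprod (rev (mkseq g k)).
  elim: k => [//|k IH] kn; have [az pz] := IH (ltnW kn).
  have [[/= N2 [/= S0 _]] _] := h k (leq_trans kn (ltnW nM)).
  split; first by rewrite /= az (ltn_trans _ N2).
  rewrite mkseqS rev_rcons /= -pz; congr (_ * _)%g; exact: S0.
have [az pz] := hz n (leqnn n).
have [[/= N2 [/= _ S1]] [_ En]] := h n nM.
split=> //=; first by rewrite az N2.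
by rewrite mkseqS rev_rcons /= -pz; congr (_ * _)%g; exact: S1.
Qed.

End Siblings.

(** * Words and ends of the free product *)

Section FreeProductWords.
Variables (I : choiceType) (G : I -> groupType).
Local Notation fp := (freeprod G).
Implicit Types (u l : letter G) (w : seq (letter G)) (v x y : fp).

(** The first letter of [v] if it lies in [G i], and 1 otherwise, by the default of [tagged_as]. The
    vertex [emb i (fproj i v)] is where the branch containing [v] is attached to the copy of
    [G i]. *)
Definition fproj i v : G i :=
  if val v is l :: _ then tagged_as (Tagged G (1%g : G i)) l else 1%g.

Lemma val_emb i (g : G i) : g != 1%g -> val (emb i g) = [:: Tagged G g].
Proof. by rewrite /emb /= => /negPf ->. Qed.

Lemma emb1 i : emb i (1%g : G i) = 1%g.
Proof. by apply: val_inj; rewrite /= eqxx. Qed.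

Lemma fproj_tag i (g : G i) v w : val v = Tagged G g :: w -> fproj i v = g.
Proof.
move=> vE; rewrite /fproj vE.
exact: (@tagged_asE I _ (Tagged G (1%g : G i)) g).
Qed.

Lemma fproj_tag_neq i l v w : val v = l :: w -> tag l != i -> fproj i v = 1%g.
Proof.
rewrite /fproj => -> li; rewrite /tagged_as /=; case: eqP => // e.
by case/eqP: li.
Qed.

Lemma fproj1 i : fproj i 1%g = 1%g. Proof. by []. Qed.

Lemma fproj_emb i (g : G i) : fproj i (emb i g) = g.
Proof.
have [->|g1] := eqVneq g 1%g; first by rewrite emb1.
exact: fproj_tag (val_emb g1).
Qed.

Lemma fproj_emb_neq i j (g : G j) : i != j -> fproj i (emb j g) = 1%g.
Proof.
move=> ij; have [->|g1] := eqVneq g 1%g; first by rewrite emb1.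
by apply: fproj_tag_neq (val_emb g1) _; rewrite eq_sym.
Qed.

Lemma emb_inj i : injective (emb (G := G) i).
Proof. by move=> g h e; rewrite -(fproj_emb g) e fproj_emb. Qed.

Lemma val_mul x y : val (x * y)%g = mul_word (val x) (val y).
Proof. by []. Qed.

Lemma val_mul_emb i (g : G i) y : val (emb i g * y)%g = mul_letter (Tagged G g) (val y).
Proof.
rewrite val_mul; have [->|g1] := eqVneq g 1%g.
  by rewrite emb1 /= /mul_letter /= eqxx.
by rewrite val_emb.
Qed.

Lemma embM i (g h : G i) : emb i (g * h)%g = (emb i g * emb i h)%g.
Proof.
apply: val_inj; rewrite val_mul_emb.
have -> (k : G i) : val (emb i k) = mul_letter (Tagged G k) [::].
  by rewrite /= /mul_letter /=; case: eqP.
have -> : val (emb i h) = mul_letter (Tagged G h) [::].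
  by rewrite /= /mul_letter /=; case: eqP.
by rewrite -mul_letterM.
Qed.

Lemma embV i (g : G i) : emb i g^-1%g = (emb i g)^-1%g.
Proof. by apply: (mulgI (emb i g)); rewrite -embM !mulgV emb1. Qed.

Lemma mul_letter_cons u w : reduced (u :: w) -> mul_letter u w = u :: w.
Proof.
rewrite reduced_cons => /and3P[u1 hw _]; rewrite /mul_letter (negPf u1).
by case: w hw => //= l w; rewrite eq_sym => /negPf ->.
Qed.

Lemma reduced_catr w w' : reduced (w ++ w') -> reduced w'.
Proof. by elim: w => //= u w IH; rewrite reduced_cons => /and3P[_ _ /IH]. Qed.

Lemma reduced_catl w w' : reduced (w ++ w') -> reduced w.
Proof.
elim: w => //= u w IH; rewrite !reduced_cons => /and3P[-> h /IH ->].
by case: w h {IH} => //= l w ->.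
Qed.

Lemma mul_word_cat w w' : reduced (w ++ w') -> mul_word w w' = w ++ w'.
Proof.
elim: w => //= u w IH r; rewrite IH; first exact: mul_letter_cons.
by move: r; rewrite reduced_cons => /and3P[].
Qed.

Lemma word_split v w w' : val v = w ++ w' ->
  exists x y, [/\ val x = w, val y = w' & v = (x * y)%g].
Proof.
move=> vE; have r := valP v; rewrite /= vE in r.
exists (exist _ w (reduced_catl r)), (exist _ w' (reduced_catr r)); split=> //.
by apply: val_inj; rewrite val_mul /= mul_word_cat.
Qed.

Lemma size_mul_letter u w : (size (mul_letter u w) <= (size w).+1)%N.
Proof.
rewrite /mul_letter; case: ifP => _ //; case: w => //= l w.
by case: ifP => _ //=; case: ifP => _ /=; lia.
Qed.

Lemma size_mul x y : (size (val (x * y)%g) <= size (val x) + size (val y))%N.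
Proof.
rewrite val_mul; elim: (val x) => //= u w IH.
exact: leq_trans (size_mul_letter _ _) _.
Qed.

Lemma size_emb i (g : G i) : (size (val (emb i g)) <= 1)%N.
Proof. by rewrite /=; case: ifP. Qed.

(** Right multiplication by at most one letter acts on the last letter only; the head may be altered
    within its factor or cancelled, but no other factor comes to the front. *)
Lemma head_tag l w w' : reduced (l :: w) -> reduced w' -> (size w' <= 1)%N ->
  if mul_word (l :: w) w' is l' :: _ then tag l' == tag l else true.
Proof.
move=> + r' s'; elim: w l => [|k w IH] l.
  rewrite reduced_cons => /and3P[l1 _ _] /=; rewrite /mul_letter (negPf l1).
  case: w' r' s' => [|u [|//]] /= _ _ //.
  case: eqP => /= e; last by rewrite eqxx.
  by case: ifP => _ //=; rewrite eqxx.
rewrite [reduced _]reduced_cons => /and3P[l1 lk /IH].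
rewrite (_ : mul_word (l :: k :: w) w' = mul_letter l (mul_word (k :: w) w')) //.
case: (mul_word (k :: w) w') => [_|u s /eqP uk].
  by rewrite /mul_letter (negPf l1).
by rewrite /mul_letter (negPf l1) uk eq_sym (negPf lk) /=.
Qed.

Lemma val_mul_long v l k w i (g : G i) : val v = l :: k :: w ->
  exists w', val (v * emb i g)%g = l :: w'.
Proof.
move=> vE; have r := valP v; rewrite /= vE in r.
move: r; rewrite reduced_cons => /and3P[l1 lk rw].
have := head_tag rw (valP (emb i g)) (size_emb g).
rewrite val_mul vE (_ : mul_word (l :: k :: w) (val (emb i g)) =
  mul_letter l (mul_word (k :: w) (val (emb i g)))) //.
case: (mul_word (k :: w) _) => [_|u s /eqP uk].
  by exists [::]; rewrite /mul_letter (negPf l1).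
by exists (u :: s); rewrite /mul_letter (negPf l1) uk eq_sym (negPf lk).
Qed.

(* Leaving the branch of [fproj i v] is only possible from the vertex at which
   the branch is attached to the copy of [G i]. *)
Lemma fproj_change i k v (g : G k) : fproj i (v * emb k g)%g <> fproj i v ->
  v = emb i (fproj i v).
Proof.
case vE: (val v) => [|l [|l' w]] h.
- have -> : v = 1%g by apply: val_inj.
  by rewrite fproj1 emb1.
- have r := valP v; rewrite /= vE in r.
  have l1 : tagged l != 1%g by move: r; rewrite reduced_cons => /and3P[].
  case: l vE l1 r => j a vE l1 r; have [e|ji] := eqVneq j i.
    subst j; rewrite (fproj_tag vE); apply: val_inj.
    by rewrite vE val_emb.
  case: h; rewrite (fproj_tag_neq vE) //.
  have -> : v = emb j a by apply: val_inj; rewrite vE val_emb.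
  have [->|g1] := eqVneq g 1%g.
    by rewrite emb1 mulg1 fproj_emb_neq // eq_sym.
  have [e|jk] := eqVneq j k.
    by subst k; rewrite -embM fproj_emb_neq // eq_sym.
  have : val (emb j a * emb k g)%g = [:: Tagged G a; Tagged G g].
    rewrite val_mul !val_emb //= mul_letter_cons // !reduced_cons /= l1 g1 jk.
    by [].
  by move=> /fproj_tag_neq ->.
have [w' vgE] := val_mul_long g vE.
by case: h; rewrite /fproj vE vgE.
Qed.

Lemma freeprod_ind (K : set fp) : K 1%g ->
  (forall i (g : G i) v, K v -> K (emb i g * v)%g) -> forall v, K v.
Proof.
move=> K1 KM v; case vE: (val v) => [|l w].
  by have -> : v = 1%g by apply: val_inj.
elim: w l v vE => [|l' w IH] [i a] v vE.
  have r := valP v; rewrite /= vE reduced_cons /= in r.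
  have -> : v = (emb i a * 1)%g.
    by rewrite mulg1; apply: val_inj; rewrite vE val_emb //; case/and3P: r.
  exact: KM.
have [x [y [xE yE ->]]] := @word_split v [:: Tagged G a] (l' :: w) vE.
have -> : x = emb i a.
  apply: val_inj; rewrite xE val_emb //.
  by have := valP x; rewrite /= xE reduced_cons => /and3P[].
exact/KM/(IH l').
Qed.

End FreeProductWords.

(** * Connectivity outside a set, rays and ends of a graph *)

Section Connectivity.
Variables (V : Type) (E : V -> V -> Prop).
Implicit Types (F : set V) (u v w : V) (rho sigma : nat -> V).

Lemma conn_refl F u : ~ F u -> connected_off E F u u.
Proof. by move=> Fu; exists 0%N, (fun=> u). Qed.

Lemma conn_step F u v w : connected_off E F u v -> E v w -> ~ F w ->
  connected_off E F u w.
Proof.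
move=> [n [p [p0 pn pF pE]]] vw Fw.
exists n.+1, (fun k => if (k <= n)%N then p k else w); split.
- by [].
- by rewrite ltnn.
- by move=> k _; case: ifP => // /pF.
move=> k; rewrite ltnS => kn; rewrite kn; case: ltnP => h; first exact: pE.
have -> : k = n by apply/eqP; rewrite eqn_leq kn.
by rewrite pn.
Qed.

Lemma conn_ind F u (Q : V -> Prop) : Q u ->
  (forall v w, connected_off E F u v -> Q v -> E v w -> ~ F w -> Q w) ->
  forall v, connected_off E F u v -> Q v.
Proof.
move=> Qu Qs v [n [p [p0 pn pF pE]]].
have h k : (k <= n)%N -> Q (p k) /\ connected_off E F u (p k).
  elim: k => [|k IH] kn.
    by rewrite p0; split=> //; apply: conn_refl; rewrite -p0; exact: pF.
  have [Qk ck] := IH (ltnW kn); split.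
    by apply: Qs ck Qk _ _; [exact: pE|exact: pF].
  by apply: conn_step ck _ _; [exact: pE|exact: pF].
by rewrite -pn; have [] := h n (leqnn n).
Qed.

Lemma conn_trans F u v w : connected_off E F u v -> connected_off E F v w ->
  connected_off E F u w.
Proof. by move=> uv; apply: conn_ind => // x y _ ux xy Fy; exact: conn_step ux xy Fy. Qed.

Lemma conn_notinl F u v : connected_off E F u v -> ~ F u.
Proof. by move=> [n [p [<- _ pF _]]]; exact: pF. Qed.

Lemma conn_notin F u v : connected_off E F u v -> ~ F v.
Proof. by move=> [n [p [_ <- pF _]]]; exact: pF. Qed.

Hypothesis E_sym : forall u v, E u v -> E v u.

Lemma conn_sym F u v : connected_off E F u v -> connected_off E F v u.
Proof.
move=> uv; have := conn_notinl uv; move: v uv; apply: conn_ind.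
  by move=> /conn_refl.
move=> v w uv IH vw Fw Fu; apply: conn_trans (IH Fu).
apply: (conn_step (conn_refl Fw)); first exact: E_sym.
exact: conn_notin uv.
Qed.

Lemma conn_sub F F' u v : F' `<=` F -> connected_off E F u v ->
  connected_off E F' u v.
Proof.
by move=> FF' [n [p [p0 pn pF pE]]]; exists n, p; split=> // k /pF h /FF'.
Qed.

Lemma ray_leaves F rho : ray E rho -> finite_set F ->
  exists n0, forall n, (n0 <= n)%N -> ~ F (rho n).
Proof.
move=> [inj _] fF; have fin : finite_set (rho @^-1` F).
  by apply: finite_preimage => // x y _ _; exact: inj.
have /finite_seqP[s sE] := fin.
exists (\max_(k <- s) k).+1 => n + Fn; rewrite ltnNge => /negP; apply.
apply: (@leq_bigmax_seq _ s xpredT id) => //.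
by have : [set` s] n by rewrite -sE.
Qed.

Lemma ray_conn F rho n : ray E rho -> (forall k, (n <= k)%N -> ~ F (rho k)) ->
  forall k l, (n <= k)%N -> (n <= l)%N -> connected_off E F (rho k) (rho l).
Proof.
move=> [_ rE] nF; have h k : (n <= k)%N -> connected_off E F (rho n) (rho k).
  move=> /subnK <-; elim: (k - n)%N => [|j IH].
    by apply: conn_refl; exact: nF.
  by rewrite addSn; apply: conn_step IH _ _ => //; apply: nF; rewrite -addSn leq_addl.
by move=> k l nk nl; apply: conn_trans (h l nl); apply: conn_sym; exact: h.
Qed.

Lemma ray_meet rho sigma n k : infinite_set (range sigma `&` range rho) ->
  exists a b, [/\ (n <= a)%N, (k <= b)%N & sigma a = rho b].
Proof.
move=> inf; apply: contrapT => h; apply: inf.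
apply: (@sub_finite_set _ _ (sigma @` `I_n `|` rho @` `I_k)); last first.
  by rewrite finite_setU; split; apply: finite_image; exact: finite_II.
move=> v [[a _ av] [b _ bv]].
have [an|an] := ltnP a n; first by left; exists a.
have [bk|bk] := ltnP b k; first by right; exists b.
by exfalso; apply: h; exists a, b; split=> //; rewrite av.
Qed.

Lemma ray_equiv_conn F rho rho' : ray E rho -> ray E rho' -> ray_equiv E rho rho' ->
  finite_set F -> exists n0, forall k l, (n0 <= k)%N -> (n0 <= l)%N ->
    connected_off E F (rho k) (rho' l).
Proof.
move=> r r' [s [rs i i']] fF.
have [n1 h1] := ray_leaves r fF; have [n2 h2] := ray_leaves r' fF.
have [n3 h3] := ray_leaves rs fF.
exists (maxn n1 n2) => k l; rewrite !geq_max => /andP[k1 k2] /andP[l1 l2].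
have [a [b [a3 b1 ab]]] := ray_meet n3 n1 i.
have [a' [b' [a3' b2 ab']]] := ray_meet n3 n2 i'.
apply: (conn_trans (ray_conn r h1 k1 b1)); rewrite -ab.
apply: (conn_trans (ray_conn rs h3 a3 a3')); rewrite ab'.
exact: (ray_conn r' h2 b2 l2).
Qed.

Lemma ray_equiv_refl rho : ray E rho -> ray_equiv E rho rho.
Proof.
move=> r; have inf : infinite_set (range rho).
  have [inj _] := r; move=> fin; apply: infinite_nat.
  rewrite -(preimage_range rho); apply: finite_preimage => // x y _ _; exact: inj.
by exists rho; rewrite setIid.
Qed.

Definition end_of rho : set (nat -> V) :=
  [set rho' | ray E rho' /\ ray_equiv E rho rho'].

Lemma end_of_ends rho : ray E rho -> ends E (end_of rho).
Proof. by move=> r; exists rho. Qed.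

Lemma mem_end_of rho : ray E rho -> end_of rho rho.
Proof. by move=> r; split=> //; exact: ray_equiv_refl. Qed.

(** One ray represents its end: by [ray_equiv_conn] any equivalent ray is eventually connected to it
    outside [F]. *)
Lemma end_componentI F rho v n0 : ray E rho -> finite_set F ->
  (forall n, (n0 <= n)%N -> connected_off E F v (rho n)) ->
  end_component E F (end_of rho) v.
Proof.
move=> r fF h; split; first exact: conn_notinl (h n0 (leqnn _)).
move=> rho' [r' eq]; have [n1 h1] := ray_equiv_conn r r' eq fF.
apply: (@sub_finite_set _ _ (rho' @` `I_n1)).
  move=> _ [[k _ <-] nc]; have [kn|kn] := ltnP k n1; first by exists k.
  exfalso; apply: nc; apply: conn_trans (h (maxn n0 n1) (leq_maxl _ _)) _.
  by apply: h1 => //; exact: leq_maxr.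
exact/finite_image/finite_II.
Qed.

Lemma end_componentE F omega rho v : omega rho -> ray E rho ->
  end_component E F omega v ->
  exists n0, forall n, (n0 <= n)%N -> connected_off E F v (rho n).
Proof.
move=> orho [inj _] [_ /(_ _ orho) fin].
have fin' : finite_set (rho @^-1` (range rho `\` component E F v)).
  by apply: finite_preimage => // x y _ _; exact: inj.
have /finite_seqP[s sE] := fin'.
exists (\max_(k <- s) k).+1 => n nn; apply: contrapT => nc.
have : [set` s] n by rewrite -sE; split=> //; exists n.
move=> ns; move: nn; rewrite ltnNge => /negP; apply.
exact: (@leq_bigmax_seq _ s xpredT id).
Qed.

Lemma ends_conn omega rho rho' F : ends E omega -> omega rho -> omega rho' ->
  finite_set F -> exists n0, forall k l, (n0 <= k)%N -> (n0 <= l)%N ->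
    connected_off E F (rho k) (rho' l).
Proof.
move=> [s rs <-] [r sr] [r' sr'] fF.
have [n1 h1] := ray_equiv_conn rs r sr fF.
have [n2 h2] := ray_equiv_conn rs r' sr' fF.
exists (maxn n1 n2) => k l; rewrite !geq_max => /andP[k1 k2] /andP[l1 l2].
apply: conn_trans (h2 (maxn n1 n2) l (leq_maxr _ _) l2).
by apply: conn_sym; apply: h1 => //; exact: leq_maxl.
Qed.

End Connectivity.

Lemma conn_map (V V' : Type) (E : V -> V -> Prop) (E' : V' -> V' -> Prop)
    (f : V -> V') (F : set V) (F' : set V') u v :
  (forall x y, E x y -> E' (f x) (f y)) -> (forall x, F' (f x) -> F x) ->
  connected_off E F u v -> connected_off E' F' (f u) (f v).
Proof.
move=> fE fF uv; have nu := conn_notinl uv; move: v uv; apply: conn_ind.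
  by apply: conn_refl => /fF.
move=> v w _ IH vw Fw; apply: conn_step IH _ _; first exact: fE.
by move=> /fF.
Qed.

Lemma ray_map (V V' : Type) (E : V -> V -> Prop) (E' : V' -> V' -> Prop)
    (f : V -> V') rho : injective f ->
  (forall x y, E x y -> E' (f x) (f y)) -> ray E rho -> ray E' (f \o rho).
Proof. by move=> inj fE [rinj rE]; split=> [x y /inj /rinj|n] //; exact: fE. Qed.

Lemma ray_equiv_map (V V' : Type) (E : V -> V -> Prop) (E' : V' -> V' -> Prop)
    (f : V -> V') rho rho' : injective f ->
  (forall x y, E x y -> E' (f x) (f y)) -> ray_equiv E rho rho' ->
  ray_equiv E' (f \o rho) (f \o rho').
Proof.
move=> inj fE [s [rs i i']]; exists (f \o s).
have h t : infinite_set (range s `&` range t) ->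
    infinite_set (range (f \o s) `&` range (f \o t)).
  move=> it fin; apply: it.
  have : finite_set (f @^-1` (range (f \o s) `&` range (f \o t))).
    by apply: finite_preimage fin => x y _ _; exact: inj.
  apply: sub_finite_set => v [[a _ av] [b _ bv]].
  by split; [exists a => //=; rewrite av|exists b => //=; rewrite bv].
by split; [exact: ray_map fE rs|exact: h|exact: h].
Qed.

(** * Infinite vertex sets of a Cayley graph accumulate along a ray *)

Section Konig.
Variables (H : groupType) (S : set H).
Hypothesis S_sym : forall s, S s -> S s^-1%g.

Definition word_in (p : seq H) := forall s, s \in p -> S s.
Hypothesis S_gen : forall v, exists2 p, word_in p & gprod p = v.

Lemma cayley_sym x y : cayley S x y -> cayley S y x.
Proof. by rewrite /cayley => /S_sym; rewrite invgM invgK. Qed.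

Lemma cayley_mul z x y : cayley S x y -> cayley S (z * x)%g (z * y)%g.
Proof. by rewrite /cayley invgM -mulgA mulKg. Qed.

Lemma cayley_step x s : S s -> cayley S x (x * s)%g.
Proof. by rewrite /cayley mulKg. Qed.

Lemma cayley_conn x y : connected_off (cayley S) set0 x y.
Proof.
have [p Sp pE] := S_gen (x^-1 * y)%g.
have -> : y = (x * gprod p)%g by rewrite pE mulVKg.
elim: p Sp {pE} => [|s p IH] Sp /=; first by rewrite mulg1; exact: conn_refl.
have {}IH := IH (fun t tp => Sp t (mem_behead (s := s :: p) tp)).
by rewrite mulgA; apply: conn_step IH _ _ => //; apply: cayley_step;
  apply: Sp; rewrite inE eqxx.
Qed.

Definition geodesic (p : seq H) := word_in p /\
  forall q, word_in q -> gprod q = gprod p -> (size p <= size q)%N.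

Lemma geodesic_ex v : exists2 p, geodesic p & gprod p = v.
Proof.
pose Q n := `[< exists p, [/\ word_in p, gprod p = v & size p = n] >].
have exQ : exists n, Q n.
  by have [p Sp pv] := S_gen v; exists (size p); apply/asboolP; exists p.
case: (ex_minnP exQ) => n /asboolP[p [Sp pv pn]] min.
exists p => //; split=> // q Sq qv.
by rewrite pn; apply: min; apply/asboolP; exists q; split=> //; rewrite qv.
Qed.

Lemma geodesic_cat p q : geodesic (p ++ q) -> geodesic q.
Proof.
move=> [Spq min]; split.
  by move=> s sq; apply: Spq; rewrite mem_cat sq orbT.
move=> q' Sq' e; have := min (p ++ q'); rewrite !size_cat leq_add2l; apply.
  move=> s; rewrite mem_cat => /orP[sp|]; last exact: Sq'.
  by apply: Spq; rewrite mem_cat sp.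
by rewrite !gprod_cat e.
Qed.

Lemma geodesic_size p q : geodesic p -> geodesic q -> gprod p = gprod q ->
  size p = size q.
Proof.
move=> [Sp mp] [Sq mq] e; apply/eqP; rewrite eqn_leq mp //=.
by rewrite mq.
Qed.

Hypothesis S_fin : finite_set S.

(* Konig's lemma for chosen geodesic words of the elements of B: a vertex beyond
   a prefix of a geodesic is at least as far from 1 as this prefix. *)
Lemma konig (B : set H) : infinite_set B -> exists rho, ray (cayley S) rho /\
  forall F, finite_set F -> exists n0, exists2 b, B b &
    forall n, (n0 <= n)%N -> connected_off (cayley S) F b (rho n).
Proof.
move=> Binf.
have /choice[geo geoP] v : exists p, geodesic p /\ gprod p = v.
  by have [p ? ?] := geodesic_ex v; exists p.
pose big p := infinite_set [set b | B b /\ suffix p (geo b)].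
have bigS p : big p -> exists s, S s /\ big (s :: p).
  move=> bp; apply: contrapT => /forallNP h; apply: bp.
  apply: (@sub_finite_set _ _ ([set gprod p] `|`
    \bigcup_(s in S) [set b | B b /\ suffix (s :: p) (geo b)])).
    move=> b [Bb /suffixP[q qE]]; case/lastP: q qE => [|q s] qE.
      by left; have [_ <-] := geoP b; rewrite qE.
    right; have [[Sg _] _] := geoP b; exists s.
      by apply: Sg; rewrite qE mem_cat mem_rcons inE eqxx.
    by split=> //; apply/suffixP; exists q; rewrite qE cat_rcons.
  rewrite finite_setU; split; first exact: finite_set1.
  apply: bigcup_finite => // s Ss; apply: contrapT => inf.
  by apply: (h s).
have /choice[nxt nxtP] p : exists s, big p -> S s /\ big (s :: p).
  have [/bigS[s sP]|np] := pselect (big p); first by exists s.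
  by exists 1%g => /np.
pose path n := iter n (fun p => nxt p :: p) [::].
have path_big n : big (path n).
  elim: n => [|n IH]; last by have [] := nxtP _ IH.
  move=> fin; apply: Binf; apply: sub_finite_set fin => b Bb.
  by split=> //; rewrite suffix0s.
have path_size n : size (path n) = n by elim: n => //= n ->.
have path_geo n : geodesic (path n).
  have [b [Bb /suffixP[q qE]]] : [set b | B b /\ suffix (path n) (geo b)] !=set0.
    by apply: infinite_setN0; exact: path_big.
  by have [gb _] := geoP b; rewrite qE in gb; exact: geodesic_cat gb.
pose rho n := gprod (path n).
have rr : ray (cayley S) rho.
  split=> [i j e|n].
    by rewrite -(path_size i) -(path_size j); exact: geodesic_size.
  rewrite /rho /=; apply: cayley_step.
  by have [] := nxtP _ (path_big n).
exists rho; split=> // F /finite_seqP[s sE].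
pose n0 := (\max_(x <- s) size (geo x)).+1.
have Fout p : geodesic p -> (n0 <= size p)%N -> ~ F (gprod p).
  move=> gp np Fp; have [gg gE] := geoP (gprod p).
  have sp : size (geo (gprod p)) = size p by exact: geodesic_size.
  move: np; rewrite -sp /n0 ltnNge => /negP; apply.
  apply: (@leq_bigmax_seq _ s xpredT (fun x => size (geo x))) => //.
  by have : [set` s] (gprod p) by rewrite -sE.
have [b [Bb /suffixP[q qE]]] : [set b | B b /\ suffix (path n0) (geo b)] !=set0.
  by apply: infinite_setN0; exact: path_big.
exists n0, b => // n nn.
have [gb gbE] := geoP b.
have : connected_off (cayley S) F (rho n0) b.
  rewrite -gbE qE; rewrite qE in gb; move: gb {qE}.
  elim: q => [|t q IH] gb.
    by apply: conn_refl; apply: Fout; [exact: path_geo|rewrite path_size].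
  have gb' : geodesic (q ++ path n0) by exact: (@geodesic_cat [:: t]).
  apply: (conn_step (IH gb')).
    apply: cayley_step; have [Sg _] := gb; apply: Sg; by rewrite /= inE eqxx.
  apply: (Fout _ gb); by rewrite size_cat path_size leq_addl.
move=> /(conn_sym cayley_sym) cb; apply: (conn_trans cb).
apply: (ray_conn cayley_sym rr (n := n0)) => // k nk.
by apply: (Fout _ (path_geo k)); rewrite path_size.
Qed.

End Konig.

Lemma words_subgroup (H : groupType) (S : set H) :
  (forall s, S s -> S s^-1%g) ->
  is_subgroup [set v : H | exists2 p, word_in S p & gprod p = v].
Proof.
move=> sym; split.
- by exists [::].
- move=> _ _ [p Sp <-] [q Sq <-]; exists (q ++ p); last by rewrite gprod_cat.
  by move=> s; rewrite mem_cat => /orP[/Sq|/Sp].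
move=> _ [p Sp <-]; exists (rev [seq s^-1%g | s <- p]).
  by move=> s; rewrite mem_rev => /mapP[t tp ->]; exact/sym/Sp.
elim: p {Sp} => [|s p IH] /=; first by rewrite invg1.
by rewrite rev_cons -cats1 gprod_cat /= mul1g invgM IH.
Qed.

Lemma generates_words (H : groupType) (S : set H) :
  (forall s, S s -> S s^-1%g) -> generates S ->
  forall v, exists2 p, word_in S p & gprod p = v.
Proof.
move=> sym gen v.
suff : [set v : H | exists2 p, word_in S p & gprod p = v] v by [].
rewrite (gen _ (words_subgroup sym)) // => s Ss.
by exists [:: s] => [t|]; rewrite ?inE /= ?mul1g // => /eqP ->.
Qed.

(** * The Cayley graph of the free product and the copies of its factors *)

Section FreeProductGraph.
Variables (R : realType) (r : nat) (G : 'I_r -> groupType).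
Variables (alpha : 'I_r -> R) (mu_ : forall i, G i -> R).
Hypothesis mu_law : forall i, step_law (@mu_ i).
Hypothesis alpha_gt0 : forall i, 0 < alpha i.
Local Notation fp := (freeprod G).
Local Notation law := (fp_law alpha mu_).
Local Notation gr := (fp_graph alpha mu_).
Local Notation gri i := (cayley (supp (@mu_ i))).
Implicit Types (v w x : fp) (F A : set fp) (i j k : 'I_r).

Lemma mu_ge0 i g : 0 <= @mu_ i g.
Proof. by have [[h _ _] _ _ _] := mu_law i. Qed.

Lemma fp_law_fibre i w : \sum_(x \in emb i @^-1` [set w]) @mu_ i x =
  if pselect (exists g, emb i g = w) is left _ then @mu_ i (fproj i w) else 0.
Proof.
case: pselect => [[g <-]|nex].
  rewrite fproj_emb (_ : _ @^-1` _ = [set g]) ?fsbig_set1 //.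
  by rewrite predeqE => h; split=> [/emb_inj|->].
rewrite (_ : _ @^-1` _ = set0) ?fsbig_set0 //.
by rewrite predeqE => h; split=> // e; apply: nex; exists h.
Qed.

Lemma fp_law_emb_gt0 k g : supp (@mu_ k) g -> 0 < law (emb k g).
Proof.
move=> mg; have term_ge0 i :
    0 <= alpha i * \sum_(x \in emb i @^-1` [set emb k g]) @mu_ i x.
  rewrite mulr_ge0 ?(ltW (alpha_gt0 i)) // fp_law_fibre.
  by case: pselect => [?|?] //=; exact: mu_ge0.
rewrite /fp_law (bigD1 k) //= ltr_wpDr ?sumr_ge0 // mulr_gt0 //.
rewrite fp_law_fibre fproj_emb; case: pselect => [_|[]]; last by exists g.
by rewrite lt_def mg mu_ge0.
Qed.

Lemma fp_suppP w : supp law w <-> exists k g, supp (@mu_ k) g /\ w = emb k g.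
Proof.
split=> [lw|[k [g [mg ->]]]]; last by rewrite /supp /= gt_eqF ?fp_law_emb_gt0.
apply: contrapT => h; move: lw; rewrite /supp /= /fp_law big1 ?eqxx // => i _.
rewrite fp_law_fibre; case: pselect => [[g gw]|_]; last by rewrite mulr0.
have [->|mg] := eqVneq (@mu_ i (fproj i w)) 0; first by rewrite mulr0.
by case: h; exists i, g; rewrite -gw fproj_emb in mg *.
Qed.

Lemma fp_supp_finite : finite_set (supp law).
Proof.
apply: (@sub_finite_set _ _ (\bigcup_(k in [set: 'I_r]) emb k @` supp (@mu_ k))).
  by move=> w /fp_suppP[k [g [mg ->]]]; exists k => //; exists g.
apply: bigcup_finite => // k _; apply: finite_image.
by have [[]] := mu_law k.
Qed.

Lemma mu_supp_sym i g : supp (@mu_ i) g -> supp (@mu_ i) g^-1%g.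
Proof. by have [_ sym _ _] := mu_law i; rewrite /supp /= sym. Qed.

Lemma fp_supp_sym w : supp law w -> supp law w^-1%g.
Proof.
move=> /fp_suppP[k [g [mg ->]]]; apply/fp_suppP; exists k, g^-1%g; split.
  exact: mu_supp_sym.
by rewrite embV.
Qed.

Lemma gr_sym x y : gr x y -> gr y x.
Proof. exact: (cayley_sym fp_supp_sym). Qed.

Lemma mu_words i (g : G i) : exists2 p, word_in (supp (@mu_ i)) p & gprod p = g.
Proof.
by apply: generates_words; [exact: mu_supp_sym|have [] := mu_law i].
Qed.

Lemma fp_words v : exists2 p, word_in (supp law) p & gprod p = v.
Proof.
have [K1 KM _] := words_subgroup fp_supp_sym.
move: v; apply: freeprod_ind => // i g v Kv; apply: KM => //.
have [p Sp <-] := mu_words g; exists [seq emb i s | s <- p].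
  by move=> s /mapP[t tp ->]; apply/fp_suppP; exists i, t; split=> //; exact: Sp.
elim: p {Sp} => [|s p IH] /=; first by rewrite emb1.
by rewrite embM IH.
Qed.

Lemma fp_countable : countable [set: fp].
Proof.
have /finite_seqP[s sE] := fp_supp_finite.
pose f (l : seq nat) := gprod [seq nth 1%g s n | n <- l] : fp.
apply: (@sub_countable _ _ _ [set: seq nat]); last exact: countableP.
apply: card_le_trans (card_image_le f setT).
apply: subset_card_le => v _; have [p Sp <-] := fp_words v.
exists [seq index x s | x <- p] => //; rewrite /f -map_comp; congr gprod.
rewrite -[RHS]map_id; apply/eq_in_map => x /Sp xs /=; apply: nth_index.
by have : [set` s] x by rewrite -sE.
Qed.

Lemma fp_reaches : reaches law.
Proof.
move=> v; have [p Sp pv] := fp_words v; exists p; split=> //.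
rewrite /weight1 big_seq; apply: prodr_gt0 => s /Sp /fp_suppP[k [g [mg ->]]].
exact: fp_law_emb_gt0.
Qed.

(** [into x] parametrizes the coset x Gamma_i, and [into x (proj x i v)] is its vertex nearest to
    [v], where the branch of [v] is attached. The base point [x] may be any element of the coset. *)
Definition into x i (g : G i) : fp := (x * emb i g)%g.
Definition proj x i v : G i := fproj i (x^-1 * v)%g.

Lemma proj_into x i g : proj x i (into x g) = g.
Proof. by rewrite /proj /into mulKg fproj_emb. Qed.

Lemma into_inj x i : injective (@into x i).
Proof. by move=> g h /(congr1 (proj x i)); rewrite !proj_into. Qed.

Lemma proj_change x i k v (g : G k) : proj x i (v * emb k g)%g <> proj x i v ->
  v = into x (proj x i v).
Proof.
rewrite /proj /into mulgA => ne; have e := fproj_change ne.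
by rewrite -e mulVKg.
Qed.

Lemma gr_step v w : gr v w -> exists k g, supp (@mu_ k) g /\ w = (v * emb k g)%g.
Proof.
by move=> /fp_suppP[k [g [mg e]]]; exists k, g; split=> //; rewrite -e mulVKg.
Qed.

Lemma gr_proj x i v w : gr v w -> proj x i v <> proj x i w ->
  v = into x (proj x i v).
Proof.
by move=> /gr_step[k [g [_ ->]]] /nesym; exact: proj_change.
Qed.

Lemma gr_into x i g h : gri i g h -> gr (into x g) (into x h).
Proof.
move=> gh; rewrite /fp_graph /cayley; apply/fp_suppP; exists i, (g^-1 * h)%g.
by split=> //; rewrite /into invgM -mulgA mulKg embM embV.
Qed.

(** By [gr_proj] the projection changes only along edges inside the coset. A path between different
    branches therefore uses both vertices of attachment. *)
Lemma conn_proj F x i v w : connected_off gr F v w ->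
  proj x i v <> proj x i w ->
  ~ F (into x (proj x i v)) /\ ~ F (into x (proj x i w)).
Proof.
move=> vw; pose Q u := proj x i v = proj x i u \/
  ~ F (into x (proj x i v)) /\ ~ F (into x (proj x i u)).
suff : Q w by case.
move: w vw; apply: conn_ind; first by left.
move=> u w vu Qu uw Fw; have Fu := conn_notin vu.
have [e|ne] := pselect (proj x i u = proj x i w); first by rewrite /Q -e.
right; have uE := gr_proj uw ne; have wE := gr_proj (gr_sym uw) (nesym ne).
rewrite -wE; split=> //; case: Qu => [->|[]//]; by rewrite -uE.
Qed.

(** Follow any path from [v] to its vertex of attachment [b]: it can leave the branch only through
    [b], and until then it avoids [F]. *)
Lemma conn_branch F x i v :
  (forall u, F u -> proj x i u <> proj x i v) ->
  connected_off gr F v (into x (proj x i v)).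
Proof.
move=> Fv; set b := into x _.
have vb : connected_off gr set0 v b := cayley_conn fp_words v b.
pose Q u := (proj x i u = proj x i v /\ connected_off gr F v u) \/
  connected_off gr F v b.
suff key u : connected_off gr set0 v u -> Q u by case: (key b vb) => [[]|].
move: u; apply: conn_ind.
  by left; split=> //; apply: conn_refl => /Fv.
move=> u w _ Qu uw _; case: Qu => [[pu cu]|]; last by right.
have [e|ne] := pselect (proj x i u = proj x i w).
  left; split; first by rewrite -e.
  by apply: conn_step cu uw _ => /Fv; rewrite -e.
by right; have := gr_proj uw ne; rewrite pu -/b => <-.
Qed.

End FreeProductGraph.

Lemma end_of_mul (H : groupType) (S : set H) (x : H) (rho : nat -> H) :
  end_of (cayley S) (fun n => x * rho n)%g =
  [set (fun n => x * rho' n)%g | rho' in end_of (cayley S) rho].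
Proof.
have mv z rho1 rho2 : end_of (cayley S) rho1 rho2 ->
    end_of (cayley S) (fun n => z * rho1 n)%g (fun n => z * rho2 n)%g.
  move=> [r eq]; split.
    apply: (ray_map (f := fun y => z * y)%g) r; first exact: mulgI.
    exact: cayley_mul.
  apply: (ray_equiv_map (f := fun y => z * y)%g) eq; first exact: mulgI.
  exact: cayley_mul.
rewrite predeqE => rho'; split=> [/(mv x^-1%g) h|[rho1 h <-]]; last exact: mv.
exists (fun n => x^-1 * rho' n)%g; last first.
  by apply/funext => n; rewrite mulVKg.
move: h; congr (end_of _ _ _); apply/funext => n; by rewrite mulKg.
Qed.

(** * Ends of the copies of the factors *)

Section FreeProductEndTheory.
Variables (R : realType) (r : nat) (G : 'I_r -> groupType).
Variables (alpha : 'I_r -> R) (mu_ : forall i, G i -> R).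
Hypothesis mu_law : forall i, step_law (@mu_ i).
Hypothesis alpha_gt0 : forall i, 0 < alpha i.
Local Notation fp := (freeprod G).
Local Notation law := (fp_law alpha mu_).
Local Notation gr := (fp_graph alpha mu_).
Local Notation gri i := (cayley (supp (@mu_ i))).
Implicit Types (v w x : fp) (F A : set fp) (i j k : 'I_r).

Let gsym := gr_sym mu_law alpha_gt0.
Let gconn F x i v w := @conn_proj R r G alpha mu_ mu_law alpha_gt0 F x i v w.

Lemma into_ray x i rho0 : ray (gri i) rho0 -> ray gr (@into _ _ x i \o rho0).
Proof.
apply: ray_map; first exact: into_inj.
exact: (gr_into mu_law alpha_gt0).
Qed.

Lemma ends_factor_ray i omega : ends_factor alpha mu_ i omega ->
  exists x rho0, ray (gri i) rho0 /\ omega (@into _ _ x i \o rho0).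
Proof.
move=> [x [omega1 [_ [_ [rho0 r0 <-] sub]] ->]].
exists x, rho0; split=> //; exists (emb i \o rho0) => //.
by apply: sub; exists rho0 => //; split=> //; exact: ray_equiv_refl.
Qed.

Lemma into_ends_factor x i rho0 : ray (gri i) rho0 ->
  ends_factor alpha mu_ i (end_of gr (@into _ _ x i \o rho0)).
Proof.
move=> r0; have emb_gr := gr_into mu_law alpha_gt0 (1%g : fp) (i := i).
have into1 g : into 1%g g = emb i g by rewrite /into mul1g.
have embE g h : gri i g h -> gr (emb i g) (emb i h).
  by move=> /emb_gr; rewrite !into1.
exists x, (end_of gr (emb i \o rho0)); last first.
  by rewrite /translate -end_of_mul.
split.
  apply: end_of_ends; apply: ray_map r0 => //; exact: emb_inj.
exists (end_of (gri i) rho0); first exact: end_of_ends.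
move=> _ [rho' [r' eq] <-]; split.
  by apply: ray_map r' => //; exact: emb_inj.
by apply: ray_equiv_map eq => //; exact: emb_inj.
Qed.

Lemma ray_avoid (V : eqType) (E : V -> V -> Prop) (rho : nat -> V) n y : ray E rho ->
  exists2 k, (n <= k)%N & rho k <> y.
Proof.
move=> [inj _]; have [e|ne] := eqVneq (rho n) y; last by exists n => //; apply/eqP.
by exists n.+1 => //; rewrite -e => /inj /eqP; rewrite eqn_leq ltnn.
Qed.

(** If the projection were finite, its image in the coset could be removed. The vertex [a] of [A] in
    the component of the end would then be joined to a ray in the coset although its own vertex of
    attachment is gone. *)
Lemma limit_factor_infinite A i omega : limit_ends gr A omega ->
  ends_factor alpha mu_ i omega -> exists x, infinite_set (proj x i @` A).
Proof.
move=> [eo lim] /ends_factor_ray[x [rho0 [r0 orho]]]; exists x => fin.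
have fF : finite_set (@into _ _ x i @` (proj x i @` A)) by exact: finite_image.
have [a [Aa ca]] := lim _ fF.
have [n0 h0] := end_componentE orho (into_ray x r0) ca.
have [k nk ka] := ray_avoid n0 (proj x i a) r0.
have [|+ _] := @gconn _ x i _ _ (h0 k nk).
  by rewrite /= proj_into => e; apply: ka.
by move=> nF; apply: nF; exists (proj x i a) => //; exists a.
Qed.

Lemma infinite_factor_limit A i x : infinite_set (proj x i @` A) ->
  exists omega rho0, [/\ limit_ends gr A omega, ends_factor alpha mu_ i omega,
    ray (gri i) rho0 & omega (@into _ _ x i \o rho0)].
Proof.
move=> inf; have muf : finite_set (supp (@mu_ i)) by have [[]] := mu_law i.
have [rho0 [r0 h0]] := konig (@mu_supp_sym _ _ _ _ mu_law i) (mu_words mu_law (i := i))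
  muf inf.
have rr := into_ray x r0.
exists (end_of gr (@into _ _ x i \o rho0)), rho0; split=> //;
  [|exact: into_ends_factor|exact: mem_end_of].
split; first exact: end_of_ends.
(* In the factor the projection of [F] is removed. A vertex [a] whose projection is outside it has a
   branch disjoint from [F], so [a] reaches the coset, and the path in the factor lifts. *)
move=> F fF; have [n0 [_ [a Aa <-] hb]] := h0 _ (finite_image (proj x i) fF).
exists a; split=> //; apply: (end_componentI gsym rr fF (n0 := n0)) => n nn.
apply: (@conn_trans _ _ _ _ (into x (proj x i a))).
  apply: (conn_branch mu_law alpha_gt0) => u Fu e.
  by apply: (conn_notinl (hb n nn)); exists u.
apply: conn_map (hb n nn) => [g h|g Fg]; first exact: (gr_into mu_law alpha_gt0).
by exists (into x g) => //; rewrite proj_into.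
Qed.

Lemma infinite_limit A : infinite_set A -> exists omega, limit_ends gr A omega.
Proof.
move=> inf.
have [rho [rr h]] := konig (fp_supp_sym mu_law alpha_gt0) (fp_words mu_law alpha_gt0)
  (fp_supp_finite mu_law alpha_gt0) inf.
exists (end_of gr rho); split; first exact: end_of_ends.
move=> F fF; have [n0 [b Bb hb]] := h F fF.
by exists b; split=> //; exact: (end_componentI gsym rr fF hb).
Qed.

(** A different coset of the same factor projects to a single vertex; removing this vertex separates
    rays in the two cosets. *)
Lemma cosets_ends_neq x x' i rho0 rho0' omega : ends gr omega ->
  (forall g : G i, x' <> into x g) -> ray (gri i) rho0 ->
  omega (@into _ _ x i \o rho0) -> omega (@into _ _ x' i \o rho0') -> False.
Proof.
move=> eo xx' r0 o1 o2.
have const g : proj x i (into x' g) = proj x i x'.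
  apply: contrapT => /proj_change; exact: xx'.
have [n0 h0] := ends_conn gsym eo o2 o1 (finite_set1 (into x (proj x i x'))).
have [l nl ly] := ray_avoid n0 (proj x i x') r0.
have [|+ _] := @gconn _ x i _ _ (h0 n0 l (leqnn _) nl); last by rewrite /= const.
by rewrite /= const proj_into; exact: nesym.
Qed.

Lemma infinite_word_reduced (w : nat -> letter G) n : infinite_word w ->
  reduced (mkseq w n).
Proof.
move=> ww; rewrite /reduced; apply/andP; split.
  by apply/allP => l /mapP[k _ ->]; have [/eqP] := ww k.
apply/(sortedP (w 0%N)) => k; rewrite size_mkseq => kn.
rewrite !nth_mkseq //; last exact: ltnW.
by apply/eqP; have [] := ww k.
Qed.

(** The prefixes of an infinite word eventually have constant projection to x Gamma_i, as a change
    would require a prefix in this coset. A ray in the coset does not. *)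
Lemma factor_not_infinite i omega : ends_factor alpha mu_ i omega ->
  ~ ends_infinite alpha mu_ omega.
Proof.
move=> /ends_factor_ray[x [rho0 [r0 orho]]] [eo [w ww dw]].
pose v n : fp := exist _ (mkseq w n) (infinite_word_reduced n ww).
have vS n : v n.+1 = (v n * emb (tag (w n)) (tagged (w n)))%g.
  apply: val_inj; rewrite val_mul /= mul_word_cat; last first.
    have := infinite_word_reduced n.+1 ww; rewrite mkseqS -cats1.
    have [/eqP/negPf wn _] := ww n; rewrite wn.
    by case: (w n).
  rewrite mkseqS -cats1; have [/eqP/negPf wn _] := ww n; rewrite wn.
  by case: (w n).
(* Elements of the coset of [x] have at most one letter more than [x], so prefixes of this length
   lie outside it. *)
pose n1 := (size (val x)).+2.
have const n : (n1 <= n)%N -> proj x i (v n) = proj x i (v n1).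
  move=> /subnK <-; elim: (n - n1)%N => // k IH.
  rewrite addSn -IH vS; apply: contrapT => /proj_change e.
  have : (size (val (v (k + n1)%N)) <= size (val x) + 1)%N.
    by rewrite e; apply: leq_trans (size_mul _ _) _; rewrite leq_add2l size_emb.
  by rewrite [size _]size_mkseq /n1; move: (size (val x)) => s; lia.
have [N _ hN] := dw _ (finite_set1 (into x (proj x i (v n1)))).
have [v' v'E cv] := hN (maxn N n1) (leq_maxl _ _).
have v'v : v' = v (maxn N n1) by exact: val_inj.
have [n0 h0] := end_componentE orho (into_ray x r0) cv.
have [l nl ly] := ray_avoid n0 (proj x i (v n1)) r0.
have [|+ _] := @gconn _ x i _ _ (h0 l nl); rewrite v'v const ?leq_maxr //=.
by rewrite proj_into; exact: nesym.
Qed.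

End FreeProductEndTheory.

Lemma prefix_nth (X : eqType) (x0 : X) (s t : seq X) k : prefix s t ->
  (k < size s)%N -> nth x0 t k = nth x0 s k.
Proof. by move=> /prefixP[u ->] ks; rewrite nth_cat ks. Qed.

(** * Limits of vertex sets with finite projections *)

Section InfiniteWords.
Variables (R : realType) (r : nat) (G : 'I_r -> groupType).
Variables (alpha : 'I_r -> R) (mu_ : forall i, G i -> R).
Hypothesis mu_law : forall i, step_law (@mu_ i).
Hypothesis alpha_gt0 : forall i, 0 < alpha i.
Local Notation fp := (freeprod G).
Local Notation gr := (fp_graph alpha mu_).
Implicit Types (v w x : fp) (F A : set fp) (i j k : 'I_r).

Let gsym := gr_sym mu_law alpha_gt0.

Lemma fproj_neq1 i v : fproj i v <> 1%g ->
  exists s, val v = Tagged G (fproj i v) :: s.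
Proof.
case vE: (val v) => [|[j a] s] v1.
  by case: v1; have -> : v = 1%g by apply: val_inj.
have [e|ji] := eqVneq j i; last by case: v1; rewrite (fproj_tag_neq vE).
by subst j; exists s; rewrite (fproj_tag vE).
Qed.

Lemma reduced_overlap (w : seq (letter G)) l s :
  reduced (rcons w l) -> reduced (l :: s) -> reduced (w ++ l :: s).
Proof.
elim: w => [//|u w IH] rw rl; move: rw; rewrite rcons_cons reduced_cons.
move=> /and3P[u1 h rw]; rewrite cat_cons reduced_cons u1 (IH rw rl) andbT /=.
by case: w h {IH rw}.
Qed.

Lemma val_branch x i v (g : G i) : g <> 1%g ->
  reduced (rcons (val x) (Tagged G g)) -> proj x i v = g ->
  exists s, val v = val x ++ Tagged G g :: s.
Proof.
rewrite /proj => g1 rx e; have [|s sE] := @fproj_neq1 i (x^-1 * v)%g.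
  by rewrite e.
exists s; rewrite -[v](mulVKg x) val_mul sE e mul_word_cat //.
apply: reduced_overlap => //.
by have := valP (x^-1 * v)%g; rewrite /= -[mul_word _ _]/(val (x^-1 * v)%g) sE e.
Qed.

(** A ray of the end has eventually constant projections, again by [conn_proj]. This fixes its
    letters one by one: once the vertices start with [x], the next letter is their projection to a
    coset of [x]. *)
Lemma limit_ends_infinite A omega : (forall x i, finite_set (proj x i @` A)) ->
  limit_ends gr A omega -> ends_infinite alpha mu_ omega.
Proof.
move=> finA [eo lim]; split=> //; have [rho rr oE] := eo.
have orho : omega rho by rewrite -oE; exact: mem_end_of.
have stable x i : exists n0 y, forall n, (n0 <= n)%N -> proj x i (rho n) = y.
  have fF : finite_set (@into _ _ x i @` (proj x i @` A)).
    exact/finite_image/finA.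
  have [a [Aa ca]] := lim _ fF.
  have [n0 h0] := end_componentE orho rr ca.
  exists n0, (proj x i a) => n nn; apply: contrapT => ne.
  have [|nF _] := conn_proj mu_law alpha_gt0 (x := x) (i := i) (h0 n nn).
    exact: nesym.
  by apply: nF; exists (proj x i a) => //; exists a.
(* Uniformity over the factors is needed because the factor of the next letter is only known once
   the ray is far out. *)
have stable_all x : exists n0, forall i n, (n0 <= n)%N ->
    proj x i (rho n) = proj x i (rho n0).
  have /choice[f fP] i : exists n0, forall n, (n0 <= n)%N ->
      proj x i (rho n) = proj x i (rho n0).
    by have [n0 [y h]] := stable x i; exists n0 => n nn; rewrite !h.
  exists (\max_(i < r) f i) => i n nn.
  have fi : (f i <= \max_(i < r) f i)%N by exact: leq_bigmax.
  by rewrite (fP i n) ?(fP i _ fi) // (leq_trans fi).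
have prefixes (k : nat) : exists w : seq (letter G), size w = k /\
    exists n0, forall n, (n0 <= n)%N -> prefix w (val (rho n)).
  elim: k => [|k [w [wk [n0 h0]]]].
    by exists [::]; split=> //; exists 0%N => n _; exact: prefix0s.
  have [x xw] : exists x, val x = w.
    have /prefixP[s /word_split[x [y [xw _ _]]]] := h0 n0 (leqnn _).
    by exists x.
  have rhoE n : (n0 <= n)%N -> val (rho n) = w ++ val (x^-1 * rho n)%g.
    move=> /h0 /prefixP[s sE]; have [x' [y [xw' ys e]]] := word_split sE.
    have -> : x = x' by apply: val_inj; rewrite xw xw'.
    by rewrite e mulKg ys -sE -e.
  have [n1 h1] := stable_all x.
  (* The ray leaves the vertex [x], so the prefix [x] is followed by a further letter. *)
  have [n2 h2] := ray_leaves rr (finite_set1 x).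
  pose n3 := maxn n0 (maxn n1 n2).
  have head n : (n3 <= n)%N -> exists l s, val (x^-1 * rho n)%g = l :: s.
    rewrite !geq_max => /and3P[_ _ nn2].
    case e: (val (x^-1 * rho n)%g) => [|l s]; last by exists l, s.
    case: (h2 n nn2); have e1 : (x^-1 * rho n)%g = 1%g by apply: val_inj.
    by rewrite -[rho n](mulVKg x) e1 mulg1.
  have [[j a] [s sE]] := head n3 (leqnn _).
  exists (rcons w (Tagged G a)); split; first by rewrite size_rcons wk.
  exists n3 => n nn; have := nn; rewrite {1}/n3 !geq_max => /and3P[nn0 nn1 nn2].
  have n13 : (n1 <= n3)%N by rewrite /n3 !leq_max leqnn orbT.
  have pa : proj x j (rho n) = a.
    rewrite (h1 j n nn1) -(h1 j n3 n13).
    exact: (fproj_tag sE).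
  have a1 : a <> 1%g.
    have := valP (x^-1 * rho n3)%g; rewrite /= -[mul_word _ _]/(val (x^-1 * rho n3)%g) sE.
    by rewrite reduced_cons => /and3P[/eqP].
  have [|s' s'E] := @fproj_neq1 j (x^-1 * rho n)%g; first by rewrite [fproj _ _]pa.
  rewrite (rhoE n nn0) s'E [fproj _ _]pa -cats1.
  by rewrite -[X in prefix _ (w ++ X)]cat1s catA prefix_prefix.
have /choice[W WP] := prefixes.
have rW (k : nat) : reduced (W k).
  have [_ [n0 h]] := WP k; have /prefixP[s sE] := h n0 (leqnn _).
  by have := valP (rho n0); rewrite /= sE => /reduced_catl.
have l0 : letter G.
  by have [] := WP 1%N; case: (W 1%N) => // l.
pose w (k : nat) := nth l0 (W k.+1) k.
have wW (k : nat) : mkseq w k = W k.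
  have [sk [n0 h0]] := WP k.
  apply: (@eq_from_nth _ l0); rewrite size_mkseq // => a ak.
  rewrite nth_mkseq // /w; have [sa [n1 h1]] := WP a.+1.
  rewrite -(prefix_nth l0 (h1 _ (leq_maxr n0 n1))) ?sa //.
  by rewrite -(prefix_nth l0 (h0 _ (leq_maxl n0 n1))) ?sk.
exists w.
  move=> k; have := rW k.+2; rewrite -wW !mkseqS -!cats1 -catA => /reduced_catr.
  by rewrite !reduced_cons => /and3P[/eqP w1 /eqP wn _].
move=> F /finite_seqP[s sE].
exists (\max_(u <- s) size (val u)).+1 => // n /= nn.
case: n nn => // n nn; pose v : fp := exist _ (W n.+1) (rW n.+1).
exists v; first by rewrite wW.
have [x xW] : exists x, val x = W n by exists (exist _ (W n) (rW n)).
pose l := w n; have vE : W n.+1 = rcons (W n) (Tagged G (tagged l)).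
  by rewrite -!wW mkseqS /l; case: (w n).
have l1 : tagged l <> 1%g.
  have := rW n.+1; rewrite vE -cats1 => /reduced_catr.
  by rewrite reduced_cons => /and3P[/eqP].
have rx : reduced (rcons (val x) (Tagged G (tagged l))) by rewrite xW -vE.
have vx : v = into x (tagged l).
  apply: val_inj; rewrite /into val_mul val_emb; last exact/eqP.
  by rewrite mul_word_cat cats1 // /= vE xW.
have [_ [n0 h0]] := WP n.+1.
rewrite -oE; apply: (end_componentI gsym rr (n0 := n0)).
  by apply/finite_seqP; exists s.
move=> q qn.
have pq : proj x (tag l) (rho q) = tagged l.
  have /prefixP[t] := h0 q qn; rewrite vE cat_rcons => tE.
  have [x' [y [x'W yE e]]] := word_split tE.
  have xx' : x = x' by apply: val_inj; rewrite xW.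
  by rewrite /proj e xx' mulKg (fproj_tag yE).
apply: (conn_sym gsym); rewrite vx -pq; apply: (conn_branch mu_law alpha_gt0).
(* An element of [F] in this branch would begin with all [n.+1] letters, but [n] is at least the
   largest length in [F]. *)
move=> u Fu; rewrite pq => pu.
have [t tE] := val_branch l1 rx pu.
have us : u \in s by have : [set` s] u by rewrite -sE.
have := @leq_bigmax_seq _ s xpredT (fun u : fp => size (val u)) u us isT.
rewrite tE size_cat xW; have [-> _] := WP n; rewrite /= => h.
move: nn; rewrite ltnS => /(leq_trans h).
by rewrite addnS ltnNge leq_addr.
Qed.

End InfiniteWords.

(** * Conclusion *)

(** Layer cake formula: k is the number of j with j < k, and expectation and sum are exchanged. *)
Lemma tails_mean (R : realType) (nu : probability nat R) (lambda : R) :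
  ('E_nu[fun k : nat => k%:R%R] = lambda%:E)%E ->
  (\esum_(k in [set: nat]) (tail nu k)%:E = lambda%:E)%E.
Proof.
move=> <-; rewrite unlock.
pose f (j k : nat) : \bar R := (\1_[set k | (j < k)%N] k)%:E.
have fE k : (k%:R%:E = \sum_(j <oo) f j k :> \bar R)%E.
  rewrite nneseries_esumT; last by move=> j; rewrite lee_fin indicE.
  rewrite (esumID `I_k); last by move=> j _; rewrite lee_fin indicE.
  rewrite !setTI (esum1 (D := ~` `I_k)); last first.
    move=> j /negP jk; rewrite /f indicE memNset //=; exact/negP.
  rewrite adde0 esum_fset; [|exact: finite_II|by move=> *; rewrite lee_fin indicE].
  rewrite -fsbig_ord /= (eq_bigr (fun=> 1%E)); last first.
    by move=> j _; rewrite /f indicE mem_set //; exact: ltn_ord.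
  by rewrite sumEFin sumr_const card_ord.
transitivity (\int[nu]_k (\sum_(j <oo) f j k))%E; last first.
  by apply: eq_integral => k _; rewrite -fE.
rewrite integral_nneseries //; last first.
- by move=> j k _; rewrite lee_fin indicE.
- rewrite nneseries_esumT; last first.
    by move=> j; apply: integral_ge0 => k _; rewrite lee_fin indicE.
  apply: eq_esum => j _; rewrite integral_indic // setIT.
  by rewrite -prE.
Qed.

(** * First hitting probabilities of the random walk as path weights *)

Section HittingSeries.
Context d (T : measurableType d) (R : realType) (P : probability T R).
Variables (H : groupType) (m : H -> R) (X : nat -> T -> H).
Hypothesis cH : countable [set: H].
Hypothesis m_ge0 : forall x, 0 <= m x.
Hypothesis X_walk : random_walk P m X.

Fixpoint increments (n : nat) (t : T) : seq H :=
  if n is n'.+1 then ((X n' t)^-1 * X n t)%g :: increments n' t else [::].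

Lemma size_increments n t : size (increments n t) = n.
Proof. by elim: n => //= n ->. Qed.

Lemma gprod_increments n t : X 0%N t = 1%g -> gprod (increments n t) = X n t.
Proof. by move=> X0; elim: n => //= n ->; rewrite mulVKg. Qed.

Lemma drop_increments n k t : (k <= n)%N ->
  drop (n - k) (increments n t) = increments k t.
Proof.
elim: n k => [|n IH] k; first by rewrite leqn0 => /eqP ->.
rewrite leq_eqVlt => /orP[/eqP ->|]; first by rewrite subnn drop0.
by rewrite ltnS => kn; rewrite subSn //= IH.
Qed.

Definition path_event (p : seq H) : set T :=
  [set t | X 0%N t = 1%g /\ increments (size p) t = p].

Definition vertex (p : seq H) (k : nat) : H := gprod (drop (size p - k) p).

(** Turns increments into positions, the form in which [random_walk] prescribes the joint law. *)
Lemma path_eventE p : path_event p =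
  [set t | forall k, (k <= size p)%N -> X k t = vertex p k].
Proof.
rewrite predeqE => t; split=> [[X0 ip] k kp|h].
  by rewrite /vertex -{2}ip drop_increments // gprod_increments.
split; first by rewrite h // /vertex subn0 drop_size.
suff h' k : (k <= size p)%N -> increments k t = drop (size p - k) p.
  by rewrite h' // subnn drop0.
elim: k => [|k IH] kp; first by rewrite subn0 drop_size.
rewrite /= IH ?(ltnW kp) // (h _ kp) (h _ (ltnW kp)) /vertex.
have -> : (size p - k = (size p - k.+1).+1)%N by lia.
have lt : (size p - k.+1 < size p)%N by lia.
by rewrite (drop_nth 1%g lt) /= mulKg.
Qed.

Lemma pr_path_event p : pr P (path_event p) = weight1 m p.
Proof.
have [_ XP] := X_walk; rewrite path_eventE /pr XP /vertex subn0 drop_size eqxx mul1r /=.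
rewrite /weight1 (big_nth 1%g) big_mkord [RHS](reindex_inj rev_ord_inj) /=.
apply: eq_bigr => k _.
have -> : (size p - k = (size p - k.+1).+1)%N by have := ltn_ord k; lia.
have lt : (size p - k.+1 < size p)%N by have := ltn_ord k; lia.
by rewrite (drop_nth 1%g lt) /= mulKg.
Qed.

Lemma first_hit_increments (B : set H) n t : X 0%N t = 1%g -> (0 < n)%N ->
  first_hit B (increments n t) <->
  B (X n t) /\ forall k, (1 <= k < n)%N -> ~ B (X k t).
Proof.
move=> X0 n0; split=> [[_ Bn h]|[Bn h]].
  split; first by rewrite -gprod_increments.
  move=> k /andP[k0 kn]; rewrite -gprod_increments //.
  apply: (h (take (n - k) (increments n t))).
  - by rewrite -(drop_increments t (ltnW kn)) cat_take_drop.
  - by rewrite -size_eq0 size_take size_increments; case: ltnP; lia.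
  - by rewrite -size_eq0 size_increments; lia.
split; first by rewrite -size_eq0 size_increments; lia.
  by rewrite gprod_increments.
move=> q1 q2 e q10 q20.
have sz : (n = size q1 + size q2)%N by rewrite -size_cat -e size_increments.
have s1 : (0 < size q1)%N by rewrite lt0n size_eq0.
have s2 : (0 < size q2)%N by rewrite lt0n size_eq0.
have -> : q2 = increments (size q2) t.
  rewrite -(@drop_increments n); last by lia.
  by rewrite e sz addnK drop_size_cat.
by rewrite gprod_increments //; apply: h; lia.
Qed.

Lemma pr_X0 : pr P (~` (X 0%N @^-1` [set 1%g])) = 0.
Proof.
have [mX XP] := X_walk; rewrite prC; last exact: mX.
have -> : X 0%N @^-1` [set 1%g] = path_event [::].
  by rewrite predeqE => t; split=> [|[]].
by rewrite pr_path_event /weight1 big_nil subrr.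
Qed.

Lemma pr_first_hit (B : set H) n : (0 < n)%N ->
  (P [set t | B (X n t) /\ forall k, (1 <= k < n)%N -> ~ B (X k t)] =
   \esum_(p in first_hit B `&` [set p | size p = n]) (weight1 m p)%:E)%E.
Proof.
move=> n0; have [mX _] := X_walk.
set A := [set t | _]; set J := first_hit B `&` _.
have mA : measurable A.
  have -> : A = (X n @^-1` B) `&`
      \bigcap_(k in [set k | (1 <= k < n)%N]) (X k @^-1` (~` B)).
    by rewrite predeqE => t; split.
  apply: measurableI; first exact: mX.
  by apply: bigcap_measurableType => k _; exact: mX.
have mP p : measurable (path_event p).
  rewrite path_eventE (_ : [set t | _] =
    \bigcap_(k in [set k | (k <= size p)%N]) (X k @^-1` [set vertex p k])).
    by apply: bigcap_measurableType => k _; exact: mX.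
  by rewrite predeqE.
have cJ : countable J by exact: countable_seq.
have mU : measurable (\bigcup_(p in J) path_event p).
  have [/eqP ->|/set0P J0] := boolP (J == set0).
    by rewrite bigcup_set0.
  have [D [g gb]] := countable_nat_bij cJ J0.
  rewrite (_ : \bigcup_(p in J) path_event p = \bigcup_(k in D) path_event (g k)).
    exact: bigcup_measurable.
  rewrite predeqE => t; split=> [[p Jp tp]|[k Dk tk]].
    by have [_ _ /(_ _ Jp)[k Dk gk]] := gb; exists k; rewrite ?gk.
  by exists (g k) => //; case: gb => gD _ _; exact: gD.
have mX0 := mX 0%N [set 1%g].
rewrite prE // -(eq_esum (fun p _ => congr1 EFin (pr_path_event p))).
rewrite -(pr_bigcup P cJ (fun p _ => mP p)); last first.
  move=> p q [_ sp] [_ sq] [t [[_ tp] [_ tq]]].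
  by rewrite -tp -tq sp sq.
congr (_%:E); apply/eqP; rewrite eq_le; apply/andP; split.
  (* The walk starts at 1 only almost surely, and increments determine positions only on that event;
     the rest is a null set. *)
  have -> : A = (A `&` X 0%N @^-1` [set 1%g]) `|`
      (A `&` ~` (X 0%N @^-1` [set 1%g])).
    by rewrite -setIUr setUv setIT.
  have mA0 := measurableI _ _ mA mX0.
  have mA1 := measurableI _ _ mA (measurableC mX0).
  apply: (le_trans (prU_le P mA0 mA1)); rewrite -[leRHS]addr0 lerD //.
    apply: pr_le => // t [At X0].
    exists (increments n t); last by split=> //; rewrite size_increments.
    split; last exact: size_increments.
    exact/first_hit_increments.
  rewrite -pr_X0; apply: pr_le => //; exact: measurableC.
apply: pr_le => // t [p [fp pn] [X0 tp]].
by apply/first_hit_increments => //; rewrite -pn tp.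
Qed.

Lemma hitting_series (B : set H) z : 0 <= z ->
  (\sum_(1 <= n <oo) P [set t | B (X n t) /\
     forall k, (1 <= k < n)%N -> ~ B (X k t)] * (z ^+ n)%:E =
   weight m z (first_hit B))%E.
Proof.
move=> z0.
pose J n := first_hit B `&` [set p : seq H | size p = n].
have -> : first_hit B = \bigcup_(n in [set n | (1 <= n)%N]) J n.
  rewrite predeqE => p; split=> [fp|[n _ []//]]; exists (size p) => //=.
  by have [p0 _ _] := fp; rewrite lt0n size_eq0.
have w0 (p : seq H) : (0 <= (z ^+ size p * weight1 m p)%:E)%E.
  by rewrite lee_fin mulr_ge0 ?exprn_ge0 ?prodr_ge0.
rewrite eseries_cond nneseries_esum; last first.
  by move=> n _; rewrite mule_ge0 ?measure_ge0 // lee_fin exprn_ge0.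
rewrite (_ : [set n | _] = [set n | (1 <= n)%N]); last by rewrite predeqE.
transitivity (\esum_(n in [set n | (1 <= n)%N]) \esum_(p in J n)
    (z ^+ size p * weight1 m p)%:E)%E; last first.
  apply/esym/esum_bigcupT => //.
  by move=> i j _ _ [p [[_ <-] [_ <-]]].
apply: eq_esum => n n1; rewrite pr_first_hit // muleC -esumZl ?exprn_ge0 //.
  by apply: eq_esum => p [_ <-]; rewrite EFinM.
by move=> p; rewrite lee_fin prodr_ge0.
Qed.

End HittingSeries.

(** * Projections of the visited set to the cosets of a factor *)

Section BranchingOnFreeProduct.
Variables (R : realType) (r : nat) (G : 'I_r -> groupType).
Variables (alpha : 'I_r -> R) (mu_ : forall i, G i -> R).
Hypothesis mu_law : forall i, step_law (@mu_ i).
Hypothesis alpha_gt0 : forall i, 0 < alpha i.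
Local Notation fp := (freeprod G).
Local Notation law := (fp_law alpha mu_).
Local Notation gr := (fp_graph alpha mu_).
Local Notation config := (forall j : brw_index, brw_value fp j).
Implicit Types (x y : fp) (i j : 'I_r) (c : config).

Definition legal c := forall u : seq nat, supp law (c (inr u)).

Definition cvisited c : set fp := [set cpos c u | u in [set u | calive c u]].

Lemma conn_history c u v : legal c -> connected_off gr
  (~` [set cpos c v' | v' in [set v' | suffix v v' /\ suffix v' (u ++ v)]])
  (cpos c v) (cpos c (u ++ v)).
Proof.
move=> lc; elim: u => [|k u IH].
  by apply: conn_refl => /=; apply; exists v => //; split; exact: suffix_refl.
apply: (@conn_step _ _ _ _ (cpos c (u ++ v))).
- apply: conn_sub IH => x nx [v' [vv' v'u] e]; apply: nx; exists v' => //.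
  split=> //; apply: (suffix_trans v'u).
  by apply/suffixP; exists [:: k].
- by apply: cayley_step; exact: lc.
- apply; exists (k :: (u ++ v)) => //; split; last exact: suffix_refl.
  by apply/suffixP; exists (k :: u).
Qed.

Definition factor i : set fp := range (emb i).

Lemma factor_subgroup i : is_subgroup (factor i).
Proof.
split.
- by exists 1%g => //; exact: emb1.
- by move=> _ _ [g _ <-] [h _ <-]; exists (g * h)%g => //; exact: embM.
- by move=> _ [g _ <-]; exists g^-1%g => //; exact: embV.
Qed.

Lemma factor_nontrivialE i : factor_nontrivial (G := G) i = factor i `\ 1%g.
Proof.
rewrite predeqE => x; split=> [[g /= g1 <-]|[[g _ <-] /= g1]].
  split; first by exists g.
  by move=> /= e; apply: g1; apply: emb_inj; rewrite e emb1.
by exists g => //= e; apply: g1; rewrite e emb1.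
Qed.

Lemma passes c u x i : legal c -> proj x i 1%g <> proj x i (cpos c u) ->
  (exists2 v, suffix v u & cpos c v = into x (proj x i 1%g)) /\
  (exists2 v, suffix v u & cpos c v = into x (proj x i (cpos c u))).
Proof.
move=> lc ne; have := conn_history u [::] lc; rewrite cats0 => h.
have [] := conn_proj mu_law alpha_gt0 (x := x) (i := i) h ne.
move=> /contrapT[v1 [_ s1] e1] /contrapT[v2 [_ s2] e2].
by split; [exists v1|exists v2].
Qed.

(** A projection other than that of 1 is itself a visited vertex of the coset, by [passes]. The
    coset is based at [y], the projection of 1, because lines of descent can enter it only there, as
    [finite_coset] requires. *)
Lemma finite_proj c i : legal c -> transient c ->
  (forall u, finite_set [set w | frozen (factor i `\ 1%g) w (cshift u c)]) ->
  (forall u, ~ surv_oo (factor i `\ 1%g) (cshift u c)) ->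
  forall x, finite_set (proj x i @` cvisited c).
Proof.
move=> lc tr fin ns x; set y := into x (proj x i 1%g).
have yx g : into y g = into x (proj x i 1%g * g)%g by rewrite /y /into -mulgA embM.
have yE u : factor i (y^-1 * cpos c u)%g -> cpos c u = into x (proj x i (cpos c u)).
  move=> [g _ e]; have -> : cpos c u = into y g by rewrite /into e mulVKg.
  by rewrite yx proj_into.
have entry u : calive c u -> factor i (y^-1 * cpos c u)%g ->
    exists w v, u = w ++ v /\ cpos c v = y.
  move=> au fu; have [e|ne] := pselect (proj x i 1%g = proj x i (cpos c u)).
    by exists [::], u; split=> //; rewrite (yE u fu) -e.
  by have [[v /suffixP[w uE] vy] _] := passes lc ne; exists w, v.
have fc := finite_coset (factor_subgroup i) tr fin ns entry.
apply: (@sub_finite_set _ _ ([set proj x i 1%g] `|` (proj x i @`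
  [set cpos c u | u in [set u | calive c u /\ factor i (y^-1 * cpos c u)%g]]))).
  move=> _ [_ [u au <-] <-].
  have [e|ne] := pselect (proj x i 1%g = proj x i (cpos c u)); first by left.
  right; have [_ [v /suffixP[w uE] vE]] := passes lc ne.
  exists (cpos c v); last by rewrite vE proj_into.
  exists v => //; split; first by move: au; rewrite /= uE calive_cat => /andP[].
  exists ((proj x i 1%g)^-1 * proj x i (cpos c u))%g => //.
  by rewrite vE /y /into invgM -mulgA mulKg embM embV.
rewrite finite_setU; split; [exact: finite_set1|exact: finite_image].
Qed.

Lemma infinite_proj c i v : legal c -> transient c -> calive c v ->
  surv_oo (factor i `\ 1%g) (cshift v c) ->
  infinite_set (proj (cpos c v) i @` cvisited c).
Proof.
move=> lc tr av sv fin.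
apply: (surv_infinite (factor_subgroup i) tr av sv).
have := finite_image (into (cpos c v) (i := i)) fin; apply: sub_finite_set.
move=> _ [u [au [g _ e]] <-].
have uE : cpos c u = into (cpos c v) g by rewrite /into e mulVKg.
exists g; last by rewrite uE.
by exists (cpos c u); [exists u|rewrite uE proj_into].
Qed.

Lemma supp_factor x : supp law x -> exists i, (factor i `\ 1%g) x.
Proof.
move=> /(fp_suppP mu_law alpha_gt0)[i [g [mg ->]]]; exists i.
split; first by exists g.
rewrite /= -(emb1 G i) => /emb_inj g1.
by move: mg; rewrite g1 /supp /=; have [_ _ _ ->] := mu_law i; rewrite eqxx.
Qed.

(** A leftmost line in this event stays forever in the branches beyond Gamma_i^x ([escape_proj]),
    because moving to any other branch at 1 would require a visit of 1. *)
Definition escape i : set config :=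
  [set c : config | (factor i `\ 1%g) (c (inr [:: 0%N]))] `&`
  ~` (\bigcup_u frozen [set 1%g] u).

Lemma escape_proj c i w : escape i c -> legal c ->
  calive c (w ++ [:: 0%N]) -> fproj i (cpos c (w ++ [:: 0%N])) <> 1%g.
Proof.
move=> [[[g _ gE] g1] nf] lc aw e.
have s0 : cpos c [:: 0%N] = emb i g by rewrite /cpos /= mul1g gE.
have h := conn_history w [:: 0%N] lc.
have [] := conn_proj mu_law alpha_gt0 (x := 1%g) (i := i) h.
  rewrite /proj invg1 !mul1g e s0 fproj_emb => g1'; apply: g1.
  by rewrite /= -gE g1' emb1.
move=> _ /contrapT[v [/suffixP[w1 v0] /suffixP[w2 vw]]].
rewrite /proj invg1 mul1g e /into emb1 mulg1 => v1.
have vn : v != [::] by rewrite v0; case: (w1).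
have av : calive c v by move: aw; rewrite vw calive_cat => /andP[].
have [_ [v' [_ fv' _ _]]] := @frozen_suffix _ [set 1%g] c v vn av v1.
by apply: nf; exists v'.
Qed.

Context d (T : measurableType d) (P : probability T R).
Variables (nu : probability nat R).
Variables (N : seq nat -> T -> nat) (S : seq nat -> T -> fp).
Hypothesis NS : branching_random_walk P law nu N S.
Local Notation conf N S := (conf_of (@brw_variable d T fp N S)).
Let cH := fp_countable mu_law alpha_gt0.

Lemma ae_legal : \forall t \ae P, legal (conf N S t).
Proof. exact: (ae_steps cH NS). Qed.

Lemma cyl_escape i : cyl (desc [::]) (escape i).
Proof.
apply: cylI.
  apply: (@cyl_coord _ _ _ (inr [:: 0%N]) (factor i `\ 1%g)).
  by [].
apply: cylC; apply: cyl_countable => [|u _]; first exact: countableP.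
by apply: cylS (@cyl_frozen fp [set 1%g] cH u) => j; exact: anc_desc0.
Qed.

Let NS1 := line_brw NS.

(** Not returning to 1 has positive probability, and the first step lies in one of finitely many
    factors. *)
Lemma escape_gt0 : (weight law 1 (first_hit [set 1%g]) < 1)%E ->
  exists i, 0 < cpr P (@one_child d T) S (escape i).
Proof.
rewrite -(line_hit cH [set 1%g] NS) lte_fin => lt1.
apply/not_existsP => h.
have mU : measurable (\bigcup_u (conf (@one_child d T) S @^-1` frozen [set 1%g] u)).
  by apply: measurable_countable_bigcup => u;
    exact: (conf_measurable NS1 (@cyl_frozen fp [set 1%g] cH u)).
have e0 i : \forall t \ae P, ~ escape i (conf (@one_child d T) S t).
  apply: (ae_of_pr0 (conf_measurable NS1 (cyl_escape i))).
  by apply/eqP; rewrite eq_le pr_ge0 andbT leNgt; apply/negP/h.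
have all0 : \forall t \ae P, forall i, ~ escape i (conf (@one_child d T) S t).
  by apply: ae_forall_countable => //; exact: countableP.
have ae1 : \forall t \ae P,
    (\bigcup_u (conf (@one_child d T) S @^-1` frozen [set 1%g] u)) t.
  move: all0 ae_legal; apply: filterS2 => t ne lt.
  apply: contrapT => nU; have [i fi] := supp_factor (lt [:: 0%N]).
  apply: (ne i); split=> // -[u _ fu]; apply: nU; by exists u.
move: ae1; rewrite /almost_everywhere /= => -[A [mA A0 hA]].
have : pr P (~` (\bigcup_u (conf (@one_child d T) S @^-1` frozen [set 1%g] u))) <= pr P A.
  by apply: pr_le => //; exact: measurableC.
rewrite prC // {2}/pr A0 /=; lra.
Qed.

Lemma alive_first (c : config) u : (forall w, c (inl w) = 1%N) -> u != [::] ->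
  calive c u -> exists w, u = w ++ [:: 0%N].
Proof.
move=> c1 u0; rewrite calive_line // => /eqP ->.
case: (size u) (size_eq0 u) u0 => [<-//|n] _ _.
by exists (nseq n 0%N); rewrite -[[:: 0%N]]/(nseq 1 0%N) -nseqD addn1.
Qed.

(* Escaping through a factor k other than i avoids [G i]; if only the escape
   through [G i] has positive probability, step first into another factor. *)
Lemma factor_hit_lt1 i : (2 <= r)%N ->
  (weight law 1 (first_hit [set 1%g]) < 1)%E ->
  (weight law 1 (first_hit (factor i `\ 1%g)) < 1)%E.
Proof.
move=> r2 U1; have [k ek] := escape_gt0 U1.
have c0 (c : config) u B : frozen B u c -> u != [::].
  by move=> [_ [+ _ _]]; apply: contra_neq => ->.
have [ik|ki] := eqVneq i k; last first.
  apply: (line_escape cH NS (cyl_escape k) ek) => c ec c1 lc u fu.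
  have [w uE] := alive_first c1 (c0 _ _ _ fu) fu.1.
  have [au [_ [[g _ gE] _] _]] := fu.
  apply: (@escape_proj c k w ec lc); rewrite -uE //.
  by rewrite /cpos -gE fproj_emb_neq // eq_sym.
subst k.
have [k ki] : exists k : 'I_r, k != i.
  have [i0|i0] := eqVneq (val i) 0%N.
    by exists (Ordinal r2); apply/eqP => /(congr1 val) /=; rewrite i0.
  exists (Ordinal (ltnW r2)); apply: contra_neq i0 => /(congr1 val) /= <-.
  by [].
have [t mt] : exists t, supp (@mu_ k) t.
  apply: contrapT => /forallNP nt; have [[_ _ s1] _ _ _] := mu_law k.
  move: s1; rewrite fsbig1; first by move=> /eqP; rewrite eq_sym oner_eq0.
  by move=> x _; apply/eqP/negPn/negP; exact: nt.
have t1 : t != 1%g.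
  by apply: contraNneq mt => ->; have [_ _ _ ->] := mu_law k.
(* After the step [t] into the factor [k], a later visit of [g] in Gamma_i^x has relative position
   t^-1 g, whose first letter is not in [G i]; this contradicts [escape_proj] for the shifted
   line. *)
pose E := [set c : config | [set emb k t] (c (inr [:: 0%N]))] `&`
  cshift [:: 0%N] @^-1` escape i.
have cT : cyl [set inr [:: 0%N] : brw_index]
    [set c : config | [set emb k t] (c (inr [:: 0%N]))].
  exact: (@cyl_coord _ _ _ (inr [:: 0%N]) [set emb k t]).
have cS := @cyl_shift_desc fp [:: 0%N] _ (cyl_escape i).
have cE : cyl (desc [::]) E.
  apply: cylI; first by apply: cylS cT => _ ->.
  by apply: cylS cS => j; exact: desc_desc0.
have PE : 0 < cpr P (@one_child d T) S E.
  rewrite (cprI NS1 _ cT cS); last by move=> _ -> /andP[_]; rewrite eqxx.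
  rewrite (cpr_shift cH _ NS1 (cyl_escape i)) mulr_gt0 //.
  have -> := cpr_S [:: 0%N] (emb k t) NS1.
  exact: fp_law_emb_gt0.
apply: (line_escape cH NS cE PE) => c [/= ct ec] c1 lc u fu.
have [w uE] := alive_first c1 (c0 _ _ _ fu) fu.1.
have [au [_ [[g _ gE] g1] _]] := fu.
have s0 : cpos c [:: 0%N] = emb k t by rewrite /cpos /= mul1g ct.
have c1' w' : cshift [:: 0%N] c (inl w') = 1%N by exact: c1.
have lc' : legal (cshift [:: 0%N] c) by move=> w'; exact: lc.
move: au; rewrite uE calive_cat => /andP[_ aw].
have wE : cpos (cshift [:: 0%N] c) w = ((emb k t)^-1 * emb i g)%g.
  have : cpos c u = emb i g by rewrite /cpos gE.
  by rewrite uE cpos_cat s0 => <-; rewrite mulKg.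
have g1' : g != 1%g.
  by apply: contra_notN g1 => /eqP g1; rewrite /= -gE g1 emb1.
have fw : fproj i (cpos (cshift [:: 0%N] c) w) = 1%g /\
    fproj i (emb k t)^-1%g = 1%g.
  rewrite -embV fproj_emb_neq 1?eq_sym // wE -embV; split=> //.
  apply: (@fproj_tag_neq _ _ _ (Tagged G t^-1%g) _ [:: Tagged G g]) => //.
  rewrite val_mul val_emb ?invg_eq1 // val_emb //= mul_letter_cons //.
  by rewrite !reduced_cons /= invg_eq1 t1 g1' ki.
have w0 : w != [::].
  apply: contraNneq g1' => w0; move: wE; rewrite w0 /cpos /= => /esym/eqP.
  rewrite -(inj_eq (mulgI (emb k t))) mulVKg mulg1 => /eqP e.
  by rewrite -(fproj_emb g) e fproj_emb_neq // eq_sym.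
have [w' w'E] := alive_first c1' w0 aw.
by apply: (@escape_proj _ i w' ec lc'); rewrite -w'E //; have [] := fw.
Qed.

End BranchingOnFreeProduct.

Section Conclusion.
Variables (R : realType) (r : nat) (G : 'I_r -> groupType).
Variables (alpha : 'I_r -> R) (mu_ : forall i, G i -> R).
Hypothesis mu_law : forall i, step_law (@mu_ i).
Hypothesis alpha_gt0 : forall i, 0 < alpha i.
Local Notation fp := (freeprod G).
Local Notation law := (fp_law alpha mu_).
Local Notation gr := (fp_graph alpha mu_).
Local Notation config := (forall j : brw_index, brw_value fp j).
Implicit Types (x y : fp) (i j : 'I_r) (c : config).
Local Notation nontriv i := (factor (G := G) i `\ 1%g).

(** A set is infinite when no finite list contains it, and there are only countably many lists over
    the countable group [G i]. *)
Lemma measurable_infinite_proj x i : cyl (setT : set brw_index)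
  [set c : config | infinite_set (proj x i @` cvisited c)].
Proof.
have cG : countable [set: G i].
  have := fp_countable mu_law alpha_gt0; move=> /countable_injP[f finj].
  apply/countable_injP; exists (f \o emb i) => g h _ _ /finj e.
  by apply: emb_inj; apply: e; rewrite inE.
rewrite (_ : [set c | _] = \bigcap_(s in [set: seq (G i)]) \bigcup_u
    [set c : config | calive c u /\ [set p | proj x i (gprod p) \notin s] (csteps c u)]).
  apply: cyl_bigcap; first exact: countable_seq.
  move=> s _; apply: cyl_countable => [|u _]; first exact: countableP.
  by apply: cylS (@cyl_path fp u _ (fp_countable mu_law alpha_gt0)).
rewrite predeqE => c; split=> [inf s _|h fin].
  apply: contrapT => nex; apply: inf.
  apply: (@sub_finite_set _ _ [set` s]); last exact: finite_seq.
  move=> _ [_ [u au <-] <-] /=; apply: contrapT => /negP ns.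
  by apply: nex; exists u.
have /finite_seqP[s sE] := fin.
have [u _ [au /= /negP]] := h s I; apply.
suff : [set` s] (proj x i (cpos c u)) by [].
by rewrite -sE; exists (cpos c u) => //; exists u.
Qed.

Context d (T : measurableType d) (P : probability T R).
Variables (S : seq nat -> T -> fp).
Local Notation conf N S := (conf_of (@brw_variable d T fp N S)).
Let cH := fp_countable mu_law alpha_gt0.

Lemma visitedE N t : visited N S t = cvisited (conf N S t).
Proof.
have aE u : alive N t u = calive (conf N S t) u by elim: u => //= k u ->.
have pE u : position S t u = cpos (conf N S t) u.
  by elim: u => //= k u ->.
rewrite predeqE => x; split=> -[u au <-]; exists u; rewrite ?pE //=.
  by rewrite -aE.
by rewrite aE.
Qed.

Lemma ae_finite_proj nu lambda N i : branching_random_walk P law nu N S ->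
  (\esum_(k in [set: nat]) (tail nu k)%:E = lambda%:E)%E ->
  (\forall t \ae P, transient (conf N S t)) ->
  (weight law lambda (first_hit (nontriv i)) <= 1)%E ->
  (weight law lambda (first_hit (nontriv i)) < 1)%E \/ 0 < tail nu 1 ->
  \forall t \ae P, forall x, finite_set (proj x i @` cvisited (conf N S t)).
Proof.
move=> b tl tr w1 cond; have ext := ae_extinct cH tl b w1 cond.
have lg := ae_legal mu_law alpha_gt0 b.
have tl' : \forall t \ae P, transient (conf N S t) /\ legal alpha mu_ (conf N S t).
  by move: tr lg; apply: filterS2.
move: tl' ext; apply: filterS2 => t [tt lt] et x.
by apply: (finite_proj mu_law alpha_gt0) => // u; have [] := et u.
Qed.

Lemma ae_line nu N : branching_random_walk P law nu N S -> (2 <= r)%N ->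
  (1%:E < radius_of_convergence (fun n => conv_pow law n (1%g : fp)))%E ->
  \forall t \ae P, exists omega,
    limit_ends gr (cvisited (conf (@one_child d T) S t)) omega /\
    ends_infinite alpha mu_ omega.
Proof.
move=> b r2 rad; have b1 := line_brw b.
have m0 x : 0 <= law x by exact: (brw_m_ge0 x b).
have U1 := return_lt1 m0 (fp_supp_finite mu_law alpha_gt0) ler01 rad.
have tr := ae_transient cH b1 (fp_reaches mu_law alpha_gt0) (tails_dirac R) ltr01
  (ltW U1) (or_introl U1).
have fin : \forall t \ae P, forall i x,
    finite_set (proj x i @` cvisited (conf (@one_child d T) S t)).
  apply: ae_forall_countable => [|i]; first exact: countableP.
  have w1 := factor_hit_lt1 mu_law alpha_gt0 b i r2 U1.
  exact: ae_finite_proj b1 (tails_dirac R) tr (ltW w1) (or_introl w1).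
move: tr fin; apply: filterS2 => t tt ft.
(* The line never dies, so it has infinitely many labels, and transience allows only finitely many
   of them at each vertex. *)
have inf : infinite_set (cvisited (conf (@one_child d T) S t)).
  move=> fin; have : finite_set [set u | calive (conf (@one_child d T) S t) u].
    apply: (@sub_finite_set _ _ (\bigcup_(x in cvisited (conf (@one_child d T) S t))
      [set u | calive (conf (@one_child d T) S t) u /\
        cpos (conf (@one_child d T) S t) u = x])).
      by move=> u au; exists (cpos (conf (@one_child d T) S t) u) => //; exists u.
    by apply: bigcup_finite => // x _; exact: tt.
  have az n : calive (conf (@one_child d T) S t) (zeros n).
    by rewrite calive_line // /zeros size_nseq.
  move=> fa; apply: infinite_nat.
  have : finite_set (zeros @^-1` [set u | calive (conf (@one_child d T) S t) u]).
    by apply: finite_preimage fa => n k _ _; exact: zeros_inj.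
  by apply: sub_finite_set => n _; exact: az.
have [omega lo] := infinite_limit mu_law alpha_gt0 inf.
exists omega; split=> //.
by apply: (limit_ends_infinite mu_law alpha_gt0 _ lo) => x i; exact: ft.
Qed.

Lemma limit_ends_sub A A' omega : A `<=` A' -> limit_ends gr A omega ->
  limit_ends gr A' omega.
Proof.
move=> AA' [eo lim]; split=> // F /lim[v [Av cv]]; exists v; split=> //.
exact: AA'.
Qed.

Lemma ae_infinite_end nu N : branching_random_walk P law nu N S ->
  nu [set 0%N] = 0%E -> (2 <= r)%N ->
  (1%:E < radius_of_convergence (fun n => conv_pow law n (1%g : fp)))%E ->
  \forall t \ae P, exists omega,
    limit_ends gr (cvisited (conf N S t)) omega /\ ends_infinite alpha mu_ omega.
Proof.
move=> b nu0 r2 rad; have ln := ae_line b r2 rad.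
have N1 : \forall t \ae P, forall u, (0 < N u t)%N.
  apply: ae_forall_seq => u; have [mNS NE _ _] := b; have [mN _] := mNS u.
  have N0 : pr P (N u @^-1` [set 0%N]) = 0 by rewrite /pr (NE u 0%N) nu0.
  by apply: filterS (ae_of_pr0 (mN [set 0%N]) N0) => t /eqP; rewrite lt0n.
move: ln N1; apply: filterS2 => t [omega [lo oo]] N1; exists omega; split=> //.
apply: limit_ends_sub lo => _ [u au <-]; exists u.
  have : calive (conf (@one_child d T) S t) u by [].
  rewrite /=; elim: u {au} => //= k u IH /andP[/IH -> /= k0].
  by apply: leq_trans (N1 u); move: k0; rewrite ltnS leqn0 => /eqP ->.
by rewrite /cpos; congr gprod; elim: u {au} => //= k u ->.
Qed.

Lemma alternating (L : nat -> letter G) : infinite_word L ->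
  forall n, val (gprod (rev (mkseq (fun n => emb (tag (L n)) (tagged (L n))) n))) =
    mkseq L n.
Proof.
move=> wL; elim=> [//|n IH]; rewrite mkseqS rev_rcons [gprod _]/=.
have eL : val (emb (tag (L n)) (tagged (L n))) = [:: L n].
  rewrite val_emb; first by case: (L n).
  by apply/eqP; have [] := wL n.
have rn := infinite_word_reduced n.+1 wL; rewrite mkseqS -cats1 in rn.
by rewrite val_mul IH eL mul_word_cat // cats1 -mkseqS.
Qed.

(** For every M, almost surely some particle has below it M surviving siblings in distinct cosets,
    and each coset carries its own end. A finite list of ends is then refuted with M one larger than
    its size. *)
Lemma ae_infinitely_many nu N lambda i : branching_random_walk P law nu N S ->
  nu [set 0%N] = 0%E -> (2 <= r)%N -> 0 < tail nu 1 ->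
  (\esum_(k in [set: nat]) (tail nu k)%:E = lambda%:E)%E ->
  (\forall t \ae P, transient (conf N S t)) ->
  (1 < weight law lambda (first_hit (nontriv i)))%E ->
  \forall t \ae P, infinite_set [set omega |
    limit_ends gr (cvisited (conf N S t)) omega /\ ends_factor alpha mu_ i omega].
Proof.
move=> b nu0 r2 t1 tl tr w1.
have PE := surv_oo_gt0 cH tl b w1; have cE := cyl_surv_oo (nontriv i) cH.
have letters k : exists t : G k, supp (@mu_ k) t /\ t <> 1%g.
  have [t mt] : exists t, supp (@mu_ k) t.
    apply: contrapT => /forallNP nt; have [[_ _ s1] _ _ _] := mu_law k.
    move: s1; rewrite fsbig1; first by move=> /eqP; rewrite eq_sym oner_eq0.
    by move=> x _; apply/eqP/negPn/negP; exact: nt.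
  exists t; split=> // t0; move: mt; rewrite t0 /supp /=.
  by have [_ _ _ ->] := mu_law k; rewrite eqxx.
have /choice[a aP] (k : 'I_r) : exists l : letter G, tag l = k /\
    supp (@mu_ (tag l)) (tagged l) /\ tagged l <> 1%g.
  by have [t tP] := letters k; exists (Tagged G t).
(* Steps taken alternately from two factors never cancel, so the position after n steps is a word of
   exactly n letters. *)
pose k0 := Ordinal (ltnW r2); pose k1 := Ordinal r2.
pose L n := if odd n then a k1 else a k0.
have LP n : supp (@mu_ (tag (L n))) (tagged (L n)) /\ tagged (L n) <> 1%g.
  by rewrite /L; case: (odd n); [have [] := aP k1|have [] := aP k0].
have wL : infinite_word L.
  move=> n; split; first by have [] := LP n.
  rewrite /L /=; have [e0 _] := aP k0; have [e1 _] := aP k1.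
  by case: (odd n) => /=; rewrite e0 e1 => /(congr1 val).
pose g n : fp := emb (tag (L n)) (tagged (L n)).
have g0 n : 0 < law (g n).
  by apply: (fp_law_emb_gt0 mu_law alpha_gt0); have [] := LP n.
pose F M := [set c : config | forall n, (n < M)%N ->
  block (zeros n) [set g n] setT (surv_oo (nontriv i)) c].
have trial M : \forall t \ae P, exists u, calive (conf N S t) u /\
    F M (cshift u (conf N S t)).
  have [cF PF] := cpr_chain cH b M t1 g0 cE PE.
  exact: (ae_trial cH b nu0 t1 cF PF).
have trials : \forall t \ae P, forall M, exists u, calive (conf N S t) u /\
    F M (cshift u (conf N S t)).
  exact/ae_foralln.
have lt : \forall t \ae P, transient (conf N S t) /\ legal alpha mu_ (conf N S t).
  by move: tr (ae_legal mu_law alpha_gt0 b); apply: filterS2.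
move: trials lt; apply: filterS2 => t tt [trt lgt]; set c := conf N S t in tt trt lgt *.
move=> /finite_seqP[s sE]; pose M := (size s).+1.
(* Twice as many siblings as needed: only the even generations [n + n] are used, so that the lengths
   of the base points differ by at least 2. *)
have [u [au Fu]] := tt (M + M)%N.
have pos n (nM : (n < M)%N) : exists omega rho0,
    [/\ limit_ends gr (cvisited c) omega, ends_factor alpha mu_ i omega,
      ray (cayley (supp (@mu_ i))) rho0 &
      omega (@into _ _ (cpos c u * gprod (rev (mkseq g (n + n).+1)))%g i \o rho0)].
  have nM2 : (n + n < M + M)%N by rewrite -addnS leq_add // ltnW.
  have [aw pw sw] := chain_positions Fu nM2.
  pose w := (1%N :: zeros (n + n)) ++ u.
  have aw' : calive c w by rewrite /w calive_cat au aw.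
  have sw' : surv_oo (nontriv i) (cshift w c) by rewrite /w -cshift_cat.
  have := infinite_proj lgt trt aw' sw'.
  rewrite {1}/w cpos_cat pw; exact: (infinite_factor_limit mu_law alpha_gt0).
have /choice[om omP] n : exists omega, (n < M)%N -> exists rho0,
    [/\ limit_ends gr (cvisited c) omega, ends_factor alpha mu_ i omega,
      ray (cayley (supp (@mu_ i))) rho0 &
      omega (@into _ _ (cpos c u * gprod (rev (mkseq g (n + n).+1)))%g i \o rho0)].
  have [nM|nM] := boolP (n < M)%N; last by exists set0.
  by have [omega h] := pos n nM; exists omega.
(* An element of the coset of v is longer than v by at most one letter. *)
have distinct n k : (n < k)%N -> (k < M)%N -> om n <> om k.
  move=> nk kM e.
  have [rho [[eo _] _ r0 o0]] := omP n (ltn_trans nk kM).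
  have [rho' [_ _ r0' o0']] := omP k kM; rewrite -e in o0'.
  apply: (cosets_ends_neq mu_law alpha_gt0 eo _ r0 o0 o0') => h.
  rewrite /into -mulgA => /mulgI e'.
  have := congr1 (fun v : fp => size (val v)) e'.
  rewrite alternating // size_mkseq => sz.
  have := leq_trans (size_mul (gprod (rev (mkseq g (n + n).+1))) (emb i h))
    (leq_add (leqnn _) (size_emb h)).
  rewrite -sz alternating // size_mkseq; lia.
have uo : uniq (map om (iota 0 M)).
  rewrite map_inj_in_uniq ?iota_uniq // => n k; rewrite !mem_iota !add0n /=.
  move=> nM kM e; case: (ltngtP n k) => // h.
    by case: (distinct _ _ h kM).
  by case: (distinct _ _ h nM).
have sub : {subset map om (iota 0 M) <= s}.
  move=> y /mapP[n]; rewrite mem_iota add0n => nM ->.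
  suff : [set` s] (om n) by [].
  by rewrite -sE; have [rho [? ? _ _]] := omP n nM.
by have := uniq_leq_size uo sub; rewrite size_map size_iota ltnn.
Qed.

End Conclusion.

Theorem theorem3p1 (R : realType) (r : nat) (G : 'I_r -> groupType)
  (mu_ : forall i : 'I_r, G i -> R) (alpha : 'I_r -> R)
  (nu : probability nat R) (lambda : R)
  (* the probability space of the random walk *)
  (dX : measure_display) (TX : measurableType dX) (PX : probability TX R)
  (X : nat -> TX -> freeprod G)
  (* the probability space of the branching random walk *)
  (d : measure_display) (T : measurableType d) (P : probability T R)
  (N : seq nat -> T -> nat) (S : seq nat -> T -> freeprod G)
  (r_ge2 : (2 <= r)%N)
  (G_nontrivial : forall i, exists x : G i, x <> 1%g)
  (G_fg : forall i, finitely_generated (G i))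
  (G_not_dihedral : ~ (r = 2%N /\ forall i, ([set: G i] #= `I_2)%card))
  (mu_law : forall i, step_law (@mu_ i))
  (alpha_gt0 : forall i, 0 < alpha i)
  (alpha_sum : \sum_(i < r) alpha i = 1)
  (X_walk : random_walk PX (fp_law alpha mu_) X)
  (nu0 : nu [set 0%N] = 0%E)
  (nu1 : (nu [set 1%N] < 1)%E)
  (nu_moment2 : ('E_nu[fun k : nat => (k%:R ^+ 2)%R] < +oo)%E)
  (nu_mean : ('E_nu[fun k : nat => k%:R%R] = lambda%:E)%E)
  (NS_brw : branching_random_walk P (fp_law alpha mu_) nu N S)
  (lambda_gt1 : 1 < lambda)
  (lambda_le : (lambda%:E <= radius_of_convergence
    (fun n => conv_pow (fp_law alpha mu_) n (1%g : freeprod G)))%E)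
  (i : 'I_r) :
  let Lambda t := limit_ends (fp_graph alpha mu_) (visited N S t) in
  let Omega j := ends_factor alpha mu_ j in
  let Omega_oo := ends_infinite alpha mu_ in
  let event := [set t | Lambda t `&` Omega i !=set0] in
  [/\ measurable event /\ (P event = 0%E \/ P event = 1%E),
      P event = 1%E <-> (1 < xi PX X i lambda)%E,
      (xi PX X i lambda <= 1)%E -> \forall t \ae P,
        Lambda t !=set0 /\ Lambda t `&` Omega i = set0,
      (forall j, (xi PX X j lambda <= 1)%E) -> \forall t \ae P,
        Lambda t !=set0 /\ Lambda t `<=` Omega_oo
    & (1 < xi PX X i lambda)%E -> \forall t \ae P,
        [/\ Omega_oo `&` Lambda t !=set0,
            Omega_oo `&` Lambda t `<` Lambda t,
            Lambda t `&` Omega i !=set0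
          & infinite_set (Lambda t `&` Omega i)]].
Proof.
move=> Lambda Omega Omega_oo event.
have b := NS_brw.
have cH := fp_countable mu_law alpha_gt0.
have tl := tails_mean nu_mean.
have m0 x : 0 <= fp_law alpha mu_ x by exact: (brw_m_ge0 x b).
have l0 : 0 < lambda by exact: lt_trans lambda_gt1.
(* Since nu(0) = 0 and nu(1) < 1, two or more children have positive probability; this settles the
   critical cases below. *)
have t1 : 0 < tail nu 1.
  rewrite /tail; set A := [set j | (1 < j)%N].
  have e0 : pr nu [set 0%N] = 0 by rewrite /pr nu0.
  have e1 : pr nu [set 1%N] < 1 by rewrite -lte_fin -prE.
  have : pr nu [set: nat] <= pr nu ([set 0%N] `|` [set 1%N]) + pr nu A.
    rewrite (_ : [set: nat] = ([set 0%N] `|` [set 1%N]) `|` A) ?prU_le //.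
    by rewrite predeqE => -[|[|k]]; split=> // _; [left; left|left; right|right].
  have : pr nu ([set 0%N] `|` [set 1%N]) <= pr nu [set 0%N] + pr nu [set 1%N].
    exact: prU_le.
  rewrite pr_setT; lra.
have xiE j : xi PX X j lambda =
    weight (fp_law alpha mu_) lambda (first_hit (factor j `\ 1%g)).
  by rewrite -factor_nontrivialE -(hitting_series cH m0 X_walk _ (ltW l0)).
have rad1 : (1%:E < radius_of_convergence
    (fun n => conv_pow (fp_law alpha mu_) n (1%g : freeprod G)))%E.
  by apply: lt_le_trans lambda_le; rewrite lte_fin.
have U1 := return_le1 m0 (fp_supp_finite mu_law alpha_gt0) l0 lambda_le.
have tr := ae_transient cH b (fp_reaches mu_law alpha_gt0) tl l0 U1 (or_intror t1).
have oo := ae_infinite_end mu_law alpha_gt0 b nu0 r_ge2 rad1.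
pose c := conf_of (@brw_variable d T (freeprod G) N S).
have LE t : Lambda t = limit_ends (fp_graph alpha mu_) (cvisited (c t)).
  by rewrite /Lambda visitedE.
have fin j : (xi PX X j lambda <= 1)%E ->
    \forall t \ae P, forall x, finite_set (proj x j @` cvisited (c t)).
  rewrite xiE => w1.
  exact: (ae_finite_proj mu_law alpha_gt0 b tl tr w1 (or_intror t1)).
(* Ends are eliminated from the event in favour of infinite projections, which depend on countably
   many coordinates and are measurable. *)
have evE : event = \bigcup_(x in [set: freeprod G])
    (c @^-1` [set c | infinite_set (proj x i @` cvisited c)]).
  rewrite predeqE => t; split=> [[omega [lo fo]]|[x _ /= inf]].
    rewrite LE in lo.
    by have [x inf] := limit_factor_infinite mu_law alpha_gt0 lo fo; exists x.
  have [omega [rho0 [lo fo _ _]]] := infinite_factor_limit mu_law alpha_gt0 inf.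
  by exists omega; rewrite LE.
have mev : measurable event.
  rewrite evE.
  rewrite -[X in measurable X]/(\bigcup_(x in [set: freeprod G])
    (c @^-1` [set c | infinite_set (proj x i @` cvisited c)])).
  rewrite -preimage_bigcup.
  apply: (conf_measurable (K := setT) b); apply: cyl_countable => // x _.
  exact: (measurable_infinite_proj mu_law alpha_gt0).
have low : (xi PX X i lambda <= 1)%E -> \forall t \ae P,
    Lambda t !=set0 /\ Lambda t `&` Omega i = set0.
  move=> /fin; move: oo; apply: filterS2 => t [omega [lo _]] ft; split.
    by exists omega; rewrite LE.
  rewrite predeqE => omega'; split=> // -[]; rewrite LE => lo' fo'.
  by have [x] := limit_factor_infinite mu_law alpha_gt0 lo' fo'; apply.
have high : (1 < xi PX X i lambda)%E -> \forall t \ae P,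
    [/\ Omega_oo `&` Lambda t !=set0, Omega_oo `&` Lambda t `<` Lambda t,
      Lambda t `&` Omega i !=set0 & infinite_set (Lambda t `&` Omega i)].
  rewrite xiE => /(ae_infinitely_many mu_law alpha_gt0 b nu0 r_ge2 t1 tl tr).
  move: oo; apply: filterS2 => t [omega [lo oo]] inf; rewrite LE.
  have [omega' [lo' fo']] := infinite_setN0 inf.
  split=> //; [by exists omega|split; first by move=> ? []|by exists omega'].
  by move=> /(_ omega' lo')[/(factor_not_infinite mu_law alpha_gt0 fo')].
have P0 : (xi PX X i lambda <= 1)%E -> P event = 0%E.
  move=> /low[A [mA A0 hA]]; apply/eqP; rewrite eq_le measure_ge0 andbT -A0.
  apply: le_measure; rewrite ?inE // => t [omega et]; apply: hA => -[_ e0].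
  by have : set0 omega by rewrite -e0.
have P1 : (1 < xi PX X i lambda)%E -> P event = 1%E.
  move=> /high[A [mA A0 hA]].
  have e0 : pr P (~` event) = 0.
    apply/eqP; rewrite eq_le pr_ge0 andbT.
    have <- : pr P A = 0 by rewrite /pr A0.
    apply: pr_le => //; first exact: measurableC.
    by move=> t ne; apply: hA => -[_ _ /ne].
  rewrite prE //; move: e0; rewrite prC // => e0; congr (_%:E); lra.
split.
- by split=> //; case: (leP (xi PX X i lambda) 1%E) => [/P0|/P1]; [left|right].
- split=> [e1|/P1 //]; rewrite ltNge; apply/negP => /P0; rewrite e1.
  by move=> /eqP; rewrite eqe oner_eq0.
- exact: low.
- move=> le1; have all : \forall t \ae P, forall j x,
      finite_set (proj x j @` cvisited (c t)).
    by apply: ae_forall_countable => [|j]; [exact: countableP|exact: fin].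
  move: oo all; apply: filterS2 => t [omega [lo _]] ft; rewrite LE.
  split; first by exists omega.
  by move=> omega' lo'; apply: (limit_ends_infinite mu_law alpha_gt0 _ lo').
- exact: high.
Qed.
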